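(* Let $E$ be a complex Fréchet space and let $M$ be the superspace with coordinates $z=(x,\xi,w)$ described in the context. Consider the linear functional $\mathcal D_E(M)\to E$ (called an oscillating integral) defined by $$f\mapsto \int_M dx\,d\xi\,dw\ e^{2ia_0\omega_0(x,w)}f(x,\xi,w).$$ For every weight $\mu$ bounded by a polynomial function, this functional can be extended to a continuous linear functional $\mathcal B^\mu_E(M)\to E$. Moreover, for any weight $\mu'>\mu$ bounded by a polynomial function such that $\lim_{|y|\to\infty}\frac{\mu(y)}{\mu'(y)}=0$, there is only one such extension which is continuous for the topology induced on $\mathcal B^\mu_E(M)$ by the topology of $\mathcal B^{\mu'}_E(M)$.
   Context: $a_0\in\mathbb R\setminus\{0\}$ is fixed, $m$ is even, $n\ge 0$. $M\simeq\mathbb R^{m|n}$ has even coordinates $(x,w)$ with $x,w$ each having $m/2$ components and odd (anticommuting) coordinates $\xi=(\xi^1,\dots,\xi^n)$; its body is $\mathbb BM=\mathbb R^{m/2}\times\mathbb R^{m/2}$, with points $y=(x,w)$, and $\omega_0(x,w)=x\cdot w$ (usual scalar product). An $E$-valued smooth superfunction on $M$ is identified with its family of components: $f(x,\xi,w)=\sum_{I\subset\{1,\dots,n\}}f_I(x,w)\xi^I$, with $f_I\in C^\infty(\mathbb BM,E)$ and $\xi^I$ the ordered product of the $\xi^i$, $i\in I$. The Berezin integral over $\xi$ is $\int d\xi\, f(x,\xi,w)=f_{\{1,\dots,n\}}(x,w)$, and $\int_M dx\,d\xi\,dw$ is Berezin integration followed by Lebesgue integration over $\mathbb BM$. $E$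 has seminorms $|\cdot|_j$, $j\in\mathbb N$. $\mathcal D_E(M)$ is the space of those $f$ all of whose components $f_I$ are smooth with compact support. For $\mu\in C^\infty(\mathbb BM,\mathbb R_+^* )$, $\mathcal B^\mu_E(M)$ is the space of smooth $E$-valued superfunctions $f$ such that for all multi-indices $\alpha$ and all $j,I$ there is $C_{j,\alpha,I}>0$ with $|D^\alpha f_I(y)|_j<C_{j,\alpha,I}\,\mu(y)$ for all $y\in\mathbb BM$; it is a Fréchet space for the seminorms $|f|^{(\mu)}_{j,\alpha}=\sup_{y\in\mathbb BM}\{\frac1{\mu(y)}\sum_I|D^\alpha f_I(y)|_j\}$. A function $\mu\in C^\infty(\mathbb BM,\mathbb R_+^* )$ is a weight if $\mu\in\mathcal B^\mu_{\mathbb C}(\mathbb BM)$, i.e. $|D^\alpha\mu|\le C_\alpha\mu$ for every $\alpha$. *)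

(* Defs.v *)
From HB Require Import structures.
From mathcomp Require Import all_boot all_order all_algebra.
From mathcomp Require Import all_classical all_reals all_analysis.
From mathcomp Require Import complex.

Set Implicit Arguments.
Unset Strict Implicit.
Unset Printing Implicit Defensive.

Import Order.TTheory GRing.Theory Num.Theory.
Import numFieldNormedType.Exports.

Local Open Scope classical_set_scope.
Local Open Scope complex_scope.
Local Open Scope ring_scope.

Section seminorms.
Context {R : realType}.

(* Neighbourhood filter of x in the locally convex topology generated by the
   seminorms q_i: a basis is given by the finite intersections of balls. *)
Definition seminorm_nbhs (I : eqType) (V : zmodType) (q : I -> V -> R) (x : V)
    : set_system V :=
  [set A | exists (s : seq I) (e : R), 0 < e /\
     forall y, (forall i, i \in s -> q i (y - x) < e) -> A y].

(* Continuity of L restricted to B, where B carries the topology (induced by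
   the one) generated by q and the target the one generated by p. *)
Definition seminorm_continuous_on (I J : eqType) (V W : zmodType)
    (q : I -> V -> R) (B : set V) (p : J -> W -> R) (L : V -> W) : Prop :=
  forall f, B f ->
    L @ within B (seminorm_nbhs q f) `=>` seminorm_nbhs p (L f).

Definition linear_on (K : pzRingType) (V W : lmodType K) (B : set V)
    (L : V -> W) : Prop :=
  forall (a : K) f g, B f -> B g -> L (a *: f + g) = a *: L f + L g.

Record frechet (E : lmodType R[i]) (p : nat -> E -> R) : Prop := Frechet {
  frechetD : forall j x y, p j (x + y) <= p j x + p j y ;
  frechetZ : forall j (a : R[i]) x, p j (a *: x) = Normc.normc a * p j x ;
  frechet_separated : forall x, (forall j, p j x = 0) -> x = 0 ;
  frechet_complete : forall u : nat -> E,
    (forall j e, 0 < e -> exists N, forall k l, (N <= k)%N -> (N <= l)%N ->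
       p j (u k - u l) < e) ->
    exists x, u @ \oo `=>` seminorm_nbhs p x }.

Definition absC (_ : nat) (z : R[i]) : R := Normc.normc z.

End seminorms.

Section product_sigma_finite.
Local Open Scope ereal_scope.
Context {d1 d2 : measure_display} {T1 : measurableType d1}
  {T2 : measurableType d2} {R : realType}.
Variables (m1 : {sigma_finite_measure set T1 -> \bar R})
  (m2 : {sigma_finite_measure set T2 -> \bar R}).

(* The library's product measure under an alias, because type inference does
   not find the sigma-finite structure of m1 \x m2 itself. *)
Definition sf_product : set (T1 * T2) -> \bar R := m1 \x m2.

HB.instance Definition _ := Measure.copy sf_product (m1 \x m2).

Let sf_product_sigma_finite : sigma_finite setT sf_product.
Proof.
have /sigma_finiteP[F [TF ndF Foo]] := sigma_finiteT m1.
have /sigma_finiteP[G [TG ndG Goo]] := sigma_finiteT m2.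
exists (fun n => F n `*` G n).
  rewrite -setXTT TF TG predeqE => -[x y]; split.
    move=> [/= [n _ Fnx] [k _ Gky]]; exists (maxn n k) => //; split.
    - by move: x Fnx; exact/subsetPset/ndF/leq_maxl.
    - by move: y Gky; exact/subsetPset/ndG/leq_maxr.
  by move=> [n _ []/= ? ?]; split; exists n.
move=> k; have [? ?] := Foo k; have [? ?] := Goo k.
split; first exact: measurableX.
by rewrite /sf_product product_measure1E// lte_mul_pinfty// ge0_fin_numE.
Qed.

HB.instance Definition _ := Measure_isSigmaFinite.Build _ _ _ sf_product
  sf_product_sigma_finite.

End product_sigma_finite.

Section lebesgue_measure_Rn.
Variable R : realType.

Record sigma_finite_space := SigmaFiniteSpace {
  sfs_disp : measure_display ;
  sfs_type : measurableType sfs_disp ;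
  sfs_mu : {sigma_finite_measure set sfs_type -> \bar R} }.

(* Lebesgue measure on R^N, as an iterated product measure on
   R * (R * (... * unit)); [rV_of] identifies this product with 'rV[R]_N. *)
Fixpoint lebesgue_space (N : nat) : sigma_finite_space :=
  if N is N'.+1 then
    SigmaFiniteSpace
      (sf_product (@lebesgue_measure R) (sfs_mu (lebesgue_space N')))
  else SigmaFiniteSpace (\d_tt : {sigma_finite_measure set unit -> \bar R}).

Fixpoint rV_of (N : nat) : sfs_type (lebesgue_space N) -> 'rV[R]_N :=
  match N return sfs_type (lebesgue_space N) -> 'rV[R]_N with
  | 0 => fun _ => 0
  | N'.+1 => fun t => row_mx (t.1)%:M (rV_of t.2)
  end.

End lebesgue_measure_Rn.

Section bochner.
Context {R : realType} {d : measure_display} {T : measurableType d}.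
Variables (mu : {measure set T -> \bar R}) (E : lmodType R[i]).

(* E-valued simple function \sum_k 1_(A_k) c_k, mu A_k < +oo. *)
Record simple_fun := SimpleFun {
  sf_card : nat ;
  sf_set : 'I_sf_card -> set T ;
  sf_coef : 'I_sf_card -> E ;
  sf_measurable : forall k, measurable (sf_set k) ;
  sf_finite : forall k, (mu (sf_set k) < +oo)%E }.

Definition simple_eval (s : simple_fun) (t : T) : E :=
  \sum_(k < sf_card s) (\1_(sf_set k) t)%:C *: sf_coef k.

Definition simple_integral (s : simple_fun) : E :=
  \sum_(k < sf_card s) (fine (mu (sf_set k)))%:C *: sf_coef k.

(* g is (strongly) integrable with integral v: g is a pointwise limit of simple
   functions s_k with \int p_j (g - s_k) -> 0 for every seminorm p_j, and v is
   the limit of the integrals of the s_k. *)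
Definition is_integral (p : nat -> E -> R) (g : T -> E) (v : E) : Prop :=
  exists s : nat -> simple_fun,
    [/\ forall t, simple_eval (s k) t @[k --> \oo] `=>` seminorm_nbhs p (g t),
        forall j, (\int[mu]_t (p j (g t - simple_eval (s k) t))%:E)%E
                    @[k --> \oo] --> 0%E
      & simple_integral (s k) @[k --> \oo] `=>` seminorm_nbhs p v].

End bochner.

Definition is_lebesgue_integral (R : realType) (N : nat) (E : lmodType R[i])
    (p : nat -> E -> R) (g : 'rV[R]_N -> E) (v : E) : Prop :=
  is_integral (sfs_mu (lebesgue_space R N)) p (g \o @rV_of R N) v.

Section smooth.
Context {R : realType} {N : nat} {E : lmodType R[i]}.
Variable p : nat -> E -> R.

Definition is_pderiv (i : 'I_N) (g : 'rV[R]_N -> E) (y : 'rV[R]_N) (l : E) :=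
  (h^-1)%:C *: (g (y + h *: delta_mx 0 i) - g y) @[h --> 0^']
    `=>` seminorm_nbhs p l.

(* The partial derivative when it exists, 0 where it does not. *)
Definition pderiv (i : 'I_N) (g : 'rV[R]_N -> E) : 'rV[R]_N -> E :=
  fun y => xget 0 [set l | is_pderiv i g y l].

(* Existence and continuity of the iterated partial derivatives of all orders,
   [s] being the sequence of directions of derivation. *)
Definition smooth (g : 'rV[R]_N -> E) : Prop :=
  forall s : seq 'I_N, let h := foldr pderiv g s in
    (forall y, h @ y `=>` seminorm_nbhs p (h y)) /\
    (forall i y, exists l, is_pderiv i h y l).

(* D^alpha = D_0^(alpha 0) D_1^(alpha 1) ... *)
Definition Dmulti (alpha : {ffun 'I_N -> nat}) (g : 'rV[R]_N -> E) :
    'rV[R]_N -> E :=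
  foldr (fun i h => iter (alpha i) (pderiv i) h) g (enum 'I_N).

End smooth.

(* E-valued superfunctions on R^{N|n}, as families of components f_I. *)
Notation superfun R N n E := ({set 'I_n} -> 'rV[R]_N -> E).

Section superfunctions.
Context {R : realType} {N n : nat} {E : lmodType R[i]}.
Variable p : nat -> E -> R.
Implicit Types (f : superfun R N n E) (mu : 'rV[R]_N -> R).

Definition superD : set (superfun R N n E) :=
  [set f | forall I, smooth p (f I) /\
             compact (closure [set y | f I y != 0])].

Definition superB mu : set (superfun R N n E) :=
  [set f | (forall I, smooth p (f I)) /\
     forall alpha j I, exists C : R, 0 < C /\
       forall y, p j (Dmulti p alpha (f I) y) < C * mu y].

Definition Bseminorm mu (ja : nat * {ffun 'I_N -> nat}) f : R :=
  sup (range (fun y =>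
    (mu y)^-1 * \sum_(I : {set 'I_n}) p ja.1 (Dmulti p ja.2 (f I) y))).

Definition berezin f : 'rV[R]_N -> E := f [set: 'I_n]%SET.

Definition body_mul (c : 'rV[R]_N -> R[i]) f : superfun R N n E :=
  fun I y => c y *: f I y.

End superfunctions.

Section weights.
Context {R : realType} {N : nat}.
Implicit Types mu : 'rV[R]_N -> R.

(* A positive function mu with mu \in B^mu_C(BM); functions on the body are
   superfunctions in no odd variables. *)
Definition weight mu : Prop :=
  (forall y, 0 < mu y) /\
  superB (n := 0) absC mu (fun _ y => (mu y)%:C).

Definition poly_bounded mu : Prop :=
  exists P : seq (R * {ffun 'I_N -> nat}), forall y,
    mu y <= \sum_(t <- P) t.1 * \prod_(i < N) y 0 i ^+ t.2 i.

Definition norm_infty : set_system 'rV[R]_N :=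
  [set A | exists K : R, forall y, K < `|y| -> A y].

End weights.

Section oscillating.
Context {R : realType} {d n : nat} {E : lmodType R[i]}.
Variables (a0 : R) (p : nat -> E -> R).

(* Points of the body R^d * R^d are rows y = row_mx x w. *)
Definition omega0 (y : 'rV[R]_(d + d)) : R :=
  \sum_(i < d) lsubmx y 0 i * rsubmx y 0 i.

Definition phase (y : 'rV[R]_(d + d)) : R[i] :=
  cos (2 * a0 * omega0 y) +i* sin (2 * a0 * omega0 y).

Definition is_osc_integral (f : superfun R (d + d) n E) (v : E) : Prop :=
  is_lebesgue_integral p (berezin (body_mul phase f)) v.

(* L restricted to B^mu_E(M) is a linear extension of the oscillating integral
   on D_E(M); the values of L outside B^mu_E(M) are irrelevant. *)
Definition is_extension (mu : 'rV[R]_(d + d) -> R)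
    (L : superfun R (d + d) n E -> E) : Prop :=
  linear_on (superB p mu) L /\
  forall f, superD p f -> is_osc_integral f (L f).

Definition Bcontinuous (mu nu : 'rV[R]_(d + d) -> R)
    (L : superfun R (d + d) n E -> E) : Prop :=
  seminorm_continuous_on (Bseminorm p nu) (superB p mu) p L.

End oscillating.

(* Main.v *)
Require Import Defs.
From HB Require Import structures.
From mathcomp Require Import all_boot all_order all_algebra.
From mathcomp Require Import all_classical all_reals all_analysis.
From mathcomp Require Import measurable_realfun complex ring lra.

Set Implicit Arguments.
Unset Strict Implicit.
Unset Printing Implicit Defensive.

Import Order.TTheory GRing.Theory Num.Theory.
Import numFieldNormedType.Exports.

Local Open Scope classical_set_scope.
Local Open Scope complex_scope.
Local Open Scope ring_scope.

(* Write e = exp (2 i a0 x.w) for the phase and, for a coordinate y_k of the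
   body, y_k' for the conjugate one (x_j <-> w_j).  Since
   D_k e = 2 i a0 y_k' e, the operator
   T_k g = (1 + i y_k')^-1 (g - D_k g / (2 a0)) changes e g by a multiple of
   D_k (e (1 + i y_k')^-1 g), so that e g and e T_k g have the same integral when
   g has compact support.  Applying every T_k often enough yields a combination
   of derivatives of g with coefficients bounded by a power of
   prod_k (1 + y_k^2)^-1 as high as desired; the integral of e T g therefore
   converges absolutely on B^mu for polynomially bounded mu, and defines the
   extension.

   The integral of a dominated continuous function is the limit of its Riemann
   sums.  A shift of the grid shows that the Riemann sums of the difference
   quotients of a compactly supported h vanish, and the mean value inequality
   that their limit is the integral of D_k h, which is thus 0.

   For uniqueness, let X be smooth with compact support and X(0) = 1.  If mu/mu'
   tends to 0 at infinity, then X(y/k) f tends to f in the topology of B^mu' for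
   every f in B^mu, so compactly supported functions are dense. *)

(** The bounds that define B^mu concern the derivatives [Dmulti], taken in increasing order of the
    directions, and mixed derivatives are never exchanged. The T_k are therefore applied from the
    last direction to the first: each one prepends its derivations, so that every sequence that
    occurs is sorted. For the same reason Leibniz expansions are followed through subsequences.

    T_k brings in powers of (1 + i y_k')^-1. When D_k meets a power of (1 + i y_k)^-1 left by
    another operator, it only raises that power, so the decay already gained is never lost.

    The values lie in a Fréchet space, so every estimate concerns one real seminorm at a time. The
    functional is defined as a limit of Riemann sums: its linearity is then that of finite sums, and
    its agreement with the integral is a separate statement.

    For the second claim the number of applications of T_k is fitted to mu' and not to mu; the same
    functional is then continuous for both topologies. *)

Local Notation normc := Normc.normc.
Local Notation I := (0 +i* 1).

(** * Seminorms and convergence *)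

Section normc.
Context {R : realType}.
Implicit Types z w : R[i].

Lemma normc_ge0 z : 0 <= normc z.
Proof. by case: z => a b; exact: sqrtr_ge0. Qed.

Lemma normc_real (x : R) : normc x%:C = `|x|.
Proof. by rewrite /Normc.normc /= expr0n /= addr0 sqrtr_sqr. Qed.

Lemma normcX z k : normc (z ^+ k) = normc z ^+ k.
Proof.
elim: k => [|k IH]; first by rewrite !expr0 Normc.normc1.
by rewrite !exprS Normc.normcM IH.
Qed.

Lemma normc_prod (I : Type) (r : seq I) (P : pred I) (F : I -> R[i]) :
  normc (\prod_(i <- r | P i) F i) = \prod_(i <- r | P i) normc (F i).
Proof.
elim/big_rec2: _ => [|i x y _ <-]; first exact: Normc.normc1.
by rewrite Normc.normcM.
Qed.

End normc.

Section seminorms.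
Context {R : realType} {E : lmodType R[i]}.

(** The axioms of [frechet] without completeness. The differential calculus rests on these alone,
    and so applies equally to scalar functions with the seminorms [absC]. *)
Record seminorms (p : nat -> E -> R) : Prop := Seminorms {
  seminormD : forall j x y, p j (x + y) <= p j x + p j y ;
  seminormZ : forall j (a : R[i]) x, p j (a *: x) = normc a * p j x ;
  seminorm_separated : forall x, (forall j, p j x = 0) -> x = 0 }.

Lemma frechet_seminorms (p : nat -> E -> R) : frechet p -> seminorms p.
Proof. by case=> *; split. Qed.

Context {p : nat -> E -> R} (hp : seminorms p).

Lemma seminorm0 j : p j 0 = 0.
Proof. by rewrite -(scale0r (0 : E)) (seminormZ hp) Normc.normc0 mul0r. Qed.

Lemma seminormN j x : p j (- x) = p j x.
Proof.
by rewrite -scaleN1r (seminormZ hp) (normcN (1 : R[i])) Normc.normc1 mul1r.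
Qed.

Lemma seminorm_ge0 j x : 0 <= p j x.
Proof.
have := seminormD hp j x (- x); rewrite subrr seminorm0 seminormN.
lra.
Qed.

Lemma seminormB j x y : p j (x - y) <= p j x + p j y.
Proof. by rewrite -(seminormN j y) (seminormD hp). Qed.

Lemma seminorm_distC j x y : p j (x - y) = p j (y - x).
Proof. by rewrite -seminormN opprB. Qed.

Lemma seminorm_distD j y x z : p j (x - z) <= p j (x - y) + p j (y - z).
Proof. by rewrite -[x - z](subrKA y) (seminormD hp). Qed.

Lemma seminorm_leD j x y : p j x <= p j (x - y) + p j y.
Proof. by rewrite -{1}(subrK y x) (seminormD hp). Qed.

Lemma seminorm_dist j x y : `|p j x - p j y| <= p j (x - y).
Proof.
have := seminorm_leD j x y; have := seminorm_leD j y x.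
rewrite (seminorm_distC j y x) ler_norml; lra.
Qed.

Lemma seminorm_sum (I : Type) (r : seq I) (P : pred I) (F : I -> E) j :
  p j (\sum_(i <- r | P i) F i) <= \sum_(i <- r | P i) p j (F i).
Proof.
elim/big_rec2: _ => [|i y x _ le_xy]; first by rewrite seminorm0.
by apply: le_trans (seminormD hp _ _ _) _; rewrite lerD2l.
Qed.

Section convergence.
Context {T : Type} {F : set_system T} {FF : Filter F}.
Implicit Types f g : T -> E.

Lemma cvg_seminormP f x :
  f @ F `=>` seminorm_nbhs p x <->
  forall j, p j (f t - x) @[t --> F] --> (0 : R).
Proof.
split=> [fx j|fx A [s [e [e0 As]]]].
  apply/cvgrPdist_lt => e e0; apply: (fx [set y | `|0 - p j (y - x)| < e]).
  exists [:: j], e; split=> // y /(_ j (mem_head _ _)).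
  by rewrite /= sub0r normrN ger0_norm // seminorm_ge0.
suff: \forall t \near F, forall j, j \in s -> p j (f t - x) < e.
  by apply: filterS => t; exact: As.
elim: s {As} => [|j s IH]; first exact: filterE.
have /cvgrPdist_lt/(_ e e0) hj := fx j.
apply: filterS2 hj IH => t.
rewrite sub0r normrN ger0_norm ?seminorm_ge0 // => h1 h2 k.
by rewrite inE => /orP[/eqP->|/h2].
Qed.

Lemma cvg_seminorm_squeeze f x (b : nat -> T -> R) :
  (forall j, \forall t \near F, p j (f t - x) <= b j t) ->
  (forall j, b j t @[t --> F] --> (0 : R)) ->
  f @ F `=>` seminorm_nbhs p x.
Proof.
move=> fb b0; apply/cvg_seminormP => j.
apply: (squeeze_cvgr _ (cvg_cst (0 : R)) (b0 j)).
by apply: filterS (fb j) => t ->; rewrite seminorm_ge0.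
Qed.

Lemma cvg_seminorm_near f g x :
  (\forall t \near F, f t = g t) ->
  g @ F `=>` seminorm_nbhs p x -> f @ F `=>` seminorm_nbhs p x.
Proof.
move=> fg /cvg_seminormP gx.
apply: (@cvg_seminorm_squeeze _ _ (fun j t => p j (g t - x))) => // j.
by apply: filterS fg => t ->.
Qed.

Lemma cvg_seminorm_eq f g x y :
  (\forall t \near F, f t = g t) -> x = y ->
  g @ F `=>` seminorm_nbhs p y -> f @ F `=>` seminorm_nbhs p x.
Proof. by move=> fg ->; exact: cvg_seminorm_near. Qed.

Lemma cvg_seminorm_cst x : (fun _ : T => x) @ F `=>` seminorm_nbhs p x.
Proof.
apply/cvg_seminormP => j.
under eq_fun do rewrite subrr seminorm0.
exact: cvg_cst.
Qed.

Lemma cvg_seminormD f g x y :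
  f @ F `=>` seminorm_nbhs p x -> g @ F `=>` seminorm_nbhs p y ->
  (fun t => f t + g t) @ F `=>` seminorm_nbhs p (x + y).
Proof.
move=> /cvg_seminormP fx /cvg_seminormP gy.
apply: (@cvg_seminorm_squeeze _ _ (fun j t => p j (f t - x) + p j (g t - y))).
  by move=> j; apply: filterE => t; rewrite opprD addrACA (seminormD hp).
by move=> j; rewrite -[0 : R]addr0; exact: cvgD.
Qed.

Lemma cvg_seminormZ (c : T -> R[i]) f a x :
  normc (c t - a) @[t --> F] --> (0 : R) ->
  f @ F `=>` seminorm_nbhs p x ->
  (fun t => c t *: f t) @ F `=>` seminorm_nbhs p (a *: x).
Proof.
move=> ca /cvg_seminormP fx.
apply: (@cvg_seminorm_squeeze _ _ (fun j t => normc (c t - a) * p j (f t - x)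
   + normc a * p j (f t - x) + normc (c t - a) * p j x)).
  move=> j; apply: filterE => t; rewrite -!(seminormZ hp).
  (* Each of the three terms has a factor that tends to 0, so no local boundedness of [f] has to be
     extracted. *)
  have -> : c t *: f t - a *: x =
     (c t - a) *: (f t - x) + a *: (f t - x) + (c t - a) *: x.
    by rewrite -scalerDl subrK scalerBr scalerBl addrA subrK.
  by rewrite (le_trans (seminormD hp _ _ _)) // lerD2r (seminormD hp).
move=> j.
have -> : (0 : R) = 0 * 0 + normc a * 0 + 0 * p j x.
  by rewrite !mul0r mulr0 !addr0.
apply: cvgD; first apply: cvgD.
- exact: cvgM.
- by apply: cvgM => //; exact: cvg_cst.
- by apply: cvgM => //; exact: cvg_cst.
Qed.

Lemma cvg_seminormZr (a : R[i]) f x :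
  f @ F `=>` seminorm_nbhs p x ->
  (fun t => a *: f t) @ F `=>` seminorm_nbhs p (a *: x).
Proof.
apply: cvg_seminormZ; under eq_fun do rewrite subrr Normc.normc0.
exact: cvg_cst.
Qed.

End convergence.

Lemma cvg_seminorm_unique {T : Type} {F : set_system T} {FF : ProperFilter F}
    (f : T -> E) x y :
  f @ F `=>` seminorm_nbhs p x -> f @ F `=>` seminorm_nbhs p y -> x = y.
Proof.
move=> /cvg_seminormP fx /cvg_seminormP fy.
apply/eqP; rewrite -subr_eq0; apply/eqP/(seminorm_separated hp) => j.
have : (p j (x - y) : R) @[_ --> F] --> (0 : R).
  apply: (@squeeze_cvgr _ _ _ _ (fun=> 0) (fun t => p j (f t - x) + p j (f t - y))).
  - apply: filterE => t; rewrite seminorm_ge0 (seminorm_distC _ _ x).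
    exact: seminorm_distD.
  - exact: cvg_cst.
  - by rewrite -[0 : R]addr0; exact: cvgD.
move=> /(cvg_lim (@Rhausdorff _)) <-; rewrite lim_cst //; exact: Rhausdorff.
Qed.

Lemma cvg_seminorm_comp {T : Type} {F : set_system T} {FF : Filter F}
    (f : T -> E) x j :
  f @ F `=>` seminorm_nbhs p x -> p j (f t) @[t --> F] --> p j x.
Proof.
move=> /cvg_seminormP/(_ j) fx; apply/cvgrPdist_lt => e e0.
have /cvgrPdist_lt/(_ e e0) := fx.
apply: filterS => t; rewrite sub0r normrN ger0_norm ?seminorm_ge0 //.
by rewrite distrC; exact/le_lt_trans/seminorm_dist.
Qed.

End seminorms.

Lemma absC_seminorms (R : realType) : @seminorms R R[i] absC.
Proof.
split => [j x y|j a x|x /(_ 0)]; first exact: le_normcD.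
- exact: Normc.normcM.
- exact: Normc.eq0_normc.
Qed.

(* The conclusions unfold to products; the trailing underscores keep the
   variables of these products explicit. *)
Arguments cvg_seminorm_squeeze {R E p} hp {T F FF f x} b _ _ _ _.
Arguments cvg_seminorm_near {R E p} hp {T F FF f g x} _ _ _ _.
Arguments cvg_seminorm_eq {R E p} hp {T F FF f g x y} _ _ _ _ _.
Arguments cvg_seminorm_cst {R E p} hp {T F FF} x _ _.
Arguments cvg_seminormD {R E p} hp {T F FF f g x y} _ _ _ _.
Arguments cvg_seminormZ {R E p} hp {T F FF c f a x} _ _ _ _.
Arguments cvg_seminormZr {R E p} hp {T F FF} a {f x} _ _ _.
Arguments cvg_seminorm_unique {R E p} hp {T F FF f x y} _ _.
Arguments cvg_seminorm_comp {R E p} hp {T F FF f x} j _ _ _.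

(** * Partial derivatives and smoothness *)

Lemma cvg_dnbhs0 (R : realType) : (h : R) @[h --> (0 : R)^'] --> (0 : R).
Proof. exact: cvg_within. Qed.
Arguments cvg_dnbhs0 : clear implicits.

Section pderiv.
Context {R : realType} {N : nat} {E : lmodType R[i]}.
Context {p : nat -> E -> R} (hp : seminorms p).
Implicit Types (i : 'I_N) (g f : 'rV[R]_N -> E) (c : 'rV[R]_N -> R[i]).

Lemma is_pderiv_unique i g y l l' :
  is_pderiv p i g y l -> is_pderiv p i g y l' -> l = l'.
Proof. exact: (cvg_seminorm_unique hp). Qed.

Lemma pderivE i g y l : is_pderiv p i g y l -> pderiv p i g y = l.
Proof.
move=> gl; apply: (is_pderiv_unique (i := i) (g := g) (y := y)) => //.
exact: (@xgetPex _ 0 [set l | is_pderiv p i g y l] (ex_intro _ l gl)).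
Qed.

Lemma is_pderiv_cst i (a : E) y : is_pderiv p i (fun=> a) y 0.
Proof.
apply: (cvg_seminorm_near hp _ (cvg_seminorm_cst hp 0)).
by apply: filterE => h; rewrite subrr scaler0.
Qed.
Arguments is_pderiv_cst i a y _ _.

Lemma is_pderivD i f g y l l' :
  is_pderiv p i f y l -> is_pderiv p i g y l' ->
  is_pderiv p i (fun z => f z + g z) y (l + l').
Proof.
move=> fl gl; apply: (cvg_seminorm_near hp _ (cvg_seminormD hp fl gl)).
by apply: filterE => h; rewrite -scalerDr opprD addrACA.
Qed.
Arguments is_pderivD {i f g y l l'} _ _ _ _.

Lemma is_pderivZ i (a : R[i]) g y l :
  is_pderiv p i g y l -> is_pderiv p i (fun z => a *: g z) y (a *: l).
Proof.
move=> gl; apply: (cvg_seminorm_near hp _ (cvg_seminormZr hp a gl)).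
by apply: filterE => h; rewrite -scalerBr !scalerA mulrC.
Qed.

Lemma is_pderiv_sum i (I : Type) (r : seq I) (F : I -> 'rV[R]_N -> E) y
    (l : I -> E) :
  (forall k, is_pderiv p i (F k) y (l k)) ->
  is_pderiv p i (fun z => \sum_(k <- r) F k z) y (\sum_(k <- r) l k).
Proof.
move=> Fl; elim: r => [|k r IH].
  rewrite big_nil; under eq_fun do rewrite big_nil.
  exact: (is_pderiv_cst i 0 y).
rewrite big_cons; under eq_fun do rewrite big_cons.
exact: (is_pderivD (Fl k) IH).
Qed.

(** The increment is h times the difference quotient. Continuity along this one line is what the
    product rule asks of [g]. *)
Lemma is_pderiv_cvg_line i g y l : is_pderiv p i g y l ->
  g (y + h *: delta_mx 0 i) @[h --> 0^'] `=>` seminorm_nbhs p (g y).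
Proof.
move=> gl.
have h0 : normc ((h : R)%:C - 0) @[h --> 0^'] --> (0 : R).
  under eq_fun do rewrite subr0 normc_real.
  by have := cvg_norm (cvg_dnbhs0 R); rewrite normr0; apply.
apply: (cvg_seminorm_eq hp _ _ (cvg_seminormD hp (cvg_seminormZ hp h0 gl)
  (cvg_seminorm_cst hp (g y)))); last by rewrite scale0r add0r.
near=> h.
have h_neq0 : h != 0 by near: h; exact: nbhs_dnbhs_neq.
by rewrite scalerA -rmorphM /= mulfV // scale1r subrK.
Unshelve. all: by end_near. Qed.
Arguments is_pderiv_cvg_line {i g y l} _ _ _.

Lemma is_pderiv_near i f g y l :
  (\forall z \near y, f z = g z) -> is_pderiv p i g y l -> is_pderiv p i f y l.
Proof.
move=> fg gl; apply: (cvg_seminorm_near hp _ gl).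
have yE : y + (0 : R) *: delta_mx 0 i = y by rewrite scale0r addr0.
have line : {for (0 : R), continuous (fun h : R => y + h *: delta_mx 0 i)}.
  apply: (@continuousD R); first exact: cvg_cst.
  exact: scalel_continuous.
have : \forall h \near (0 : R)^', f (y + h *: delta_mx 0 i) = g (y + h *: delta_mx 0 i).
  have line' : (fun h : R => y + h *: delta_mx 0 i) @ 0^' --> y.
    by rewrite -[X in _ --> X]yE; apply: cvg_within_filter; exact: line.
  exact: (line' _ fg).
by apply: filterS => h ->; rewrite (nbhs_singleton fg).
Qed.
Arguments is_pderiv_near {i f g y l} _ _ _ _.

Lemma pderiv_near0 i g y : (\forall z \near y, g z = 0) -> pderiv p i g y = 0.
Proof.
move=> g0; apply: pderivE; exact: (is_pderiv_near g0 (is_pderiv_cst i 0 y)).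
Qed.

Lemma is_pderivM i c g y lc l :
  is_pderiv absC i c y lc -> is_pderiv p i g y l ->
  is_pderiv p i (fun z => c z *: g z) y (lc *: g y + c y *: l).
Proof.
move=> cl gl.
have cl' : normc ((h^-1)%:C *: (c (y + h *: delta_mx 0 i) - c y) - lc)
    @[h --> 0^'] --> (0 : R).
  exact: ((cvg_seminormP (@absC_seminorms R) _ _).1 cl 0).
apply: (cvg_seminorm_near hp _ (cvg_seminormD hp
  (cvg_seminormZ hp cl' (is_pderiv_cvg_line gl)) (cvg_seminormZr hp (c y) gl))).
apply: filterE => h /=.
have -> : (h^-1)%:C *: (c (y + h *: delta_mx 0 i) - c y) =
  (h^-1)%:C * (c (y + h *: delta_mx 0 i) - c y) by [].
rewrite -scalerA [c y *: (_ *: _)]scalerA mulrC -scalerA -scalerDr.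
by congr (_ *: _); rewrite scalerBl scalerBr addrA subrK.
Qed.

Lemma is_pderiv_dilate i (a : R) g y l : a != 0 ->
  is_pderiv p i g (a *: y) l ->
  is_pderiv p i (fun z => g (a *: z)) y (a%:C *: l).
Proof.
move=> a0 gl.
have ha : (fun h : R => a * h) @ 0^' --> 0^'.
  rewrite -[X in _ --> X^'](mulr0 a).
  apply: continuous_injective_withinNx; first exact: mulrl_continuous.
  by move=> z /eqP; rewrite mulr0 mulf_eq0 (negPf a0) => /eqP.
have gla : (fun h => ((a * h)^-1)%:C *: (g (a *: y + (a * h) *: delta_mx 0 i)
    - g (a *: y))) @ 0^' `=>` seminorm_nbhs p l.
  by move=> A /gl /ha.
apply: (cvg_seminorm_near hp _ (cvg_seminormZr hp a%:C gla)).
near=> h.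
rewrite scalerA -rmorphM /= invfM mulrA mulfV // mul1r.
by rewrite [a *: (y + _)]scalerDr [a *: (_ *: _)]scalerA.
Unshelve. all: by end_near. Qed.

End pderiv.

Arguments is_pderiv_cst {R N E p} hp i a y _ _.
Arguments is_pderivD {R N E p} hp {i f g y l l'} _ _ _ _.
Arguments is_pderivZ {R N E p} hp {i} a {g y l} _ _ _.
Arguments is_pderiv_sum {R N E p} hp {i I} r {F y l} _ _ _.
Arguments is_pderiv_cvg_line {R N E p} hp {i g y l} _ _ _.
Arguments is_pderiv_near {R N E p} hp {i f g y l} _ _ _ _.
Arguments is_pderivM {R N E p} hp {i c g y lc l} _ _ _ _.
Arguments is_pderiv_dilate {R N E p} hp {i a g y l} _ _ _ _.

(** * Smooth functions *)

Section smooth.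
Context {R : realType} {N : nat} {E : lmodType R[i]}.
Context {p : nat -> E -> R} (hp : seminorms p).
Implicit Types (i : 'I_N) (g f : 'rV[R]_N -> E) (c : 'rV[R]_N -> R[i]).

Definition seminorm_continuous g :=
  forall y, g @ y `=>` seminorm_nbhs p (g y).

Lemma seminorm_continuous_cst (a : E) : seminorm_continuous (fun=> a).
Proof. by move=> y; exact (cvg_seminorm_cst (FF := nbhs_filter y) hp a). Qed.

Lemma seminorm_continuousD f g : seminorm_continuous f ->
  seminorm_continuous g -> seminorm_continuous (fun y => f y + g y).
Proof.
move=> cf cg y.
exact (cvg_seminormD (FF := nbhs_filter y) hp (cf y) (cg y)).
Qed.

Lemma seminorm_continuousZ (a : R[i]) g :
  seminorm_continuous g -> seminorm_continuous (fun y => a *: g y).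
Proof.
move=> cg y; exact (cvg_seminormZr (FF := nbhs_filter y) hp a (cg y)).
Qed.

(** A coinduction principle: iterated derivatives never leave a family stable under derivation, so
    checking continuity and one derivative on the family settles all orders. The closure properties
    of smoothness below choose such an [S]. *)
Lemma smooth_coind (S : set ('rV[R]_N -> E)) :
  (forall g, S g -> seminorm_continuous g /\ forall i, exists2 g', S g' &
     forall y, is_pderiv p i g y (g' y)) ->
  forall g, S g -> smooth p g.
Proof.
move=> HS g Sg s.
have {Sg} : S (foldr (pderiv p) g s).
  elim: s => [//|i s /HS[_ /(_ i)[g' Sg' gg']] /=].
  rewrite [X in S X](_ : _ = g') //.
  by apply/funext => y; apply: (pderivE hp).
move=> /HS[ch dh] /=; split=> // i y.
by have [g' _ hg'] := dh i; exists (g' y).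
Qed.

Lemma smooth_ext f g : f =1 g -> smooth p g -> smooth p f.
Proof. by move=> /funext ->. Qed.

Lemma smooth_continuous g : smooth p g -> seminorm_continuous g.
Proof. by move=> /(_ [::])[]. Qed.

Lemma smooth_foldr g s : smooth p g -> smooth p (foldr (pderiv p) g s).
Proof. by move=> sg s'; rewrite /= -foldr_cat; exact: sg. Qed.

Lemma smooth_is_pderiv i g y :
  smooth p g -> is_pderiv p i g y (pderiv p i g y).
Proof.
move=> /(_ [::])[_ /(_ i y)[l gl]].
have {}gl : is_pderiv p i g y l := gl.
by rewrite (pderivE hp gl).
Qed.
Arguments smooth_is_pderiv i {g} y _ _ _.

Lemma smooth_cst (a : E) : smooth p (fun _ : 'rV[R]_N => a).
Proof.
apply: (@smooth_coind [set g | exists a, g = fun=> a]); last by exists a.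
move=> _ [b ->]; split; first exact: seminorm_continuous_cst.
move=> i; exists (fun=> 0); first by exists 0.
by move=> y; exact (is_pderiv_cst hp i b y).
Qed.

Lemma smooth_lin (a : R[i]) f g : smooth p f -> smooth p g ->
  smooth p (fun y => a *: f y + g y).
Proof.
move=> sf sg.
apply: (@smooth_coind [set h | exists f g, [/\ smooth p f, smooth p g &
   h = fun y => a *: f y + g y]]); last by exists f, g.
move=> _ [{sf}f [{sg}g [sf sg ->]]]; split.
  by apply: seminorm_continuousD; first apply: seminorm_continuousZ;
    exact: smooth_continuous.
move=> i; exists (fun y => a *: pderiv p i f y + pderiv p i g y).
  exists (pderiv p i f), (pderiv p i g); split => //.
  - exact: (smooth_foldr [:: i]).
  - exact: (smooth_foldr [:: i]).
move=> y; exact (is_pderivD hp (is_pderivZ hp a (smooth_is_pderiv i y sf))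
  (smooth_is_pderiv i y sg)).
Qed.

Lemma smoothZ (a : R[i]) g : smooth p g -> smooth p (fun y => a *: g y).
Proof.
move=> sg; rewrite (_ : (fun _ => _) = fun y => a *: g y + 0).
  exact (smooth_lin a sg (smooth_cst 0)).
by apply/funext => y; rewrite addr0.
Qed.

Lemma smoothD f g : smooth p f -> smooth p g -> smooth p (fun y => f y + g y).
Proof.
move=> sf sg; rewrite (_ : (fun _ => _) = fun y => 1 *: f y + g y).
  exact (smooth_lin 1 sf sg).
by apply/funext => y; rewrite scale1r.
Qed.

Lemma foldr_pderiv_lin (a : R[i]) f g s y : smooth p f -> smooth p g ->
  foldr (pderiv p) (fun y => a *: f y + g y) s y =
  a *: foldr (pderiv p) f s y + foldr (pderiv p) g s y.
Proof.
move=> sf sg; elim: s y => [//|i s IH] y.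
rewrite /= (funext IH); apply: (pderivE hp).
exact (is_pderivD hp
  (is_pderivZ hp a (smooth_is_pderiv i y (smooth_foldr s sf)))
  (smooth_is_pderiv i y (smooth_foldr s sg))).
Qed.

Lemma foldr_pderiv_near0 g s (U : set 'rV[R]_N) : open U ->
  (forall y, U y -> g y = 0) -> forall y, U y -> foldr (pderiv p) g s y = 0.
Proof.
move=> oU g0; elim: s => [//|i s IH] y Uy.
apply: (pderiv_near0 hp); apply: filterS (open_nbhs_nbhs (conj oU Uy)) => z.
exact: IH.
Qed.

End smooth.

Arguments seminorm_continuous {R N E} p g.

Arguments smooth_is_pderiv {R N E p} hp i {g} y _ _ _.

Section product.
Context {R : realType} {N : nat} {E : lmodType R[i]}.
Context {p : nat -> E -> R} (hp : seminorms p).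
Implicit Types (i : 'I_N) (g f : 'rV[R]_N -> E) (c : 'rV[R]_N -> R[i]).

(** Sums of products of smooth functions: a family that contains the products and is stable under
    derivation, as [smooth_coind] requires. *)
Inductive product_span : ('rV[R]_N -> E) -> Prop :=
| product_span_mul c g : smooth absC c -> smooth p g ->
    product_span (fun y => c y *: g y)
| product_span_add f g : product_span f -> product_span g ->
    product_span (fun y => f y + g y).

Lemma seminorm_continuousM c g :
  seminorm_continuous absC c -> seminorm_continuous p g ->
  seminorm_continuous p (fun y => c y *: g y).
Proof.
move=> cc cg y; refine (cvg_seminormZ (FF := nbhs_filter y) hp _ (cg y)).
by have /(cvg_seminormP (@absC_seminorms R) _ _)/(_ 0) := cc y.
Qed.

Lemma smoothM c g : smooth absC c -> smooth p g ->
  smooth p (fun y => c y *: g y).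
Proof.
move=> sc sg; apply: (smooth_coind hp (S := product_span)); last first.
  exact: product_span_mul.
move=> {sc sg c g} h Sh; elim: h / Sh => [c g sc sg|f g sf [cf df] sg [cg dg]]; split.
- exact: (seminorm_continuousM (smooth_continuous sc) (smooth_continuous sg)).
- move=> i; exists (fun y => pderiv absC i c y *: g y + c y *: pderiv p i g y).
    exact (product_span_add
      (product_span_mul (smooth_foldr [:: i] sc) sg)
      (product_span_mul sc (smooth_foldr [:: i] sg))).
  move=> y; exact (is_pderivM hp
    (smooth_is_pderiv (@absC_seminorms R) i y sc)
    (smooth_is_pderiv hp i y sg)).
- exact: (seminorm_continuousD hp).
- move=> i; have [f' Sf' ff'] := df i; have [g' Sg' gg'] := dg i.
  exists (fun y => f' y + g' y); first exact: product_span_add.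
  by move=> y; exact (is_pderivD hp (ff' y) (gg' y)).
Qed.

End product.

(** * The Leibniz rule for iterated derivatives *)

Section Leibniz.
Context {R : realType} {N : nat} {E : lmodType R[i]}.
Context {p : nat -> E -> R} (hp : seminorms p).
Implicit Types (i : 'I_N) (g f : 'rV[R]_N -> E) (c : 'rV[R]_N -> R[i]).

(* The ways of distributing a sequence of derivations over two factors. *)
Fixpoint splits (T : Type) (s : seq T) : seq (seq T * seq T) :=
  if s is i :: s' then
    [seq (i :: a.1, a.2) | a <- splits s'] ++
    [seq (a.1, i :: a.2) | a <- splits s']
  else [:: ([::], [::])].

(** The second components are the derivations that fall on a function of B^mu. Being subsequences of
    a sorted sequence they are sorted again, so that the bounds of B^mu apply to them. *)
Lemma splits_subseq (T : eqType) (s : seq T) a :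
  a \in splits s -> subseq a.2 s.
Proof.
elim: s a => [|i s IH] a; first by rewrite inE => /eqP ->.
rewrite mem_cat => /orP[] /mapP[b /IH bs ->] /=.
  exact: subseq_trans bs (subseq_cons _ _).
by rewrite eqxx.
Qed.

(** Repetitions in [splits s] stand for the binomial coefficients. *)
Lemma foldr_pderivM c g s y : smooth absC c -> smooth p g ->
  foldr (pderiv p) (fun y => c y *: g y) s y =
  \sum_(a <- splits s) foldr (pderiv absC) c a.1 y *: foldr (pderiv p) g a.2 y.
Proof.
move=> sc sg; elim: s y => [|i s IH] y; first by rewrite big_seq1.
rewrite /= (funext IH) big_cat !big_map /= -big_split /=; apply: (pderivE hp).
refine (is_pderiv_sum hp (splits s) _) => a.
exact (is_pderivM hp
  (smooth_is_pderiv (@absC_seminorms R) i y (smooth_foldr a.1 sc))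
  (smooth_is_pderiv hp i y (smooth_foldr a.2 sg))).
Qed.

End Leibniz.

(** * Multi-indices as sorted sequences of directions *)

Section multi_index.
Context {R : realType} {N : nat} {E : lmodType R[i]} (p : nat -> E -> R).

Local Notation le_ord := (fun i j : 'I_N => (i <= j)%N).

Definition multi_seq (alpha : {ffun 'I_N -> nat}) : seq 'I_N :=
  flatten [seq nseq (alpha i) i | i <- enum 'I_N].

Lemma DmultiE alpha (g : 'rV[R]_N -> E) :
  Dmulti p alpha g = foldr (pderiv p) g (multi_seq alpha).
Proof.
rewrite /Dmulti /multi_seq; elim: (enum _) => [//|i s IH] /=.
by rewrite foldr_cat -IH; elim: (alpha i) => [//|k /= ->].
Qed.

Lemma le_ord_trans : transitive le_ord.
Proof. by move=> ? ? ?; exact: leq_trans. Qed.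

Lemma pairwise_enum_ord : pairwise le_ord (enum 'I_N).
Proof.
rewrite -(sorted_pairwise le_ord_trans) -(sorted_map (f := val) (e' := leq)).
by rewrite val_enum_ord; exact: iota_sorted.
Qed.

Lemma pairwise_nseq_cat i k s : all (le_ord i) s -> pairwise le_ord s ->
  pairwise le_ord (nseq k i ++ s).
Proof.
move=> /allP is_ ss; rewrite pairwise_cat ss andbT; apply/andP; split.
  by apply/allrelP => a b /nseqP[-> _]; exact: is_.
by apply/(pairwiseP i) => a b; rewrite !inE size_nseq => ha hb _; rewrite !nth_nseq ha hb.
Qed.

Lemma multi_seq_sorted alpha : sorted le_ord (multi_seq alpha).
Proof.
rewrite (sorted_pairwise le_ord_trans) /multi_seq.
elim: (enum _) pairwise_enum_ord => [//|i s IH] /= /andP[/allP is_ /IH{}IH].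
apply: pairwise_nseq_cat => //; apply/allP => b.
by move=> /flattenP[_ /mapP[k ks ->]] /nseqP[-> _]; exact: is_.
Qed.

(** A sorted sequence is determined by its multiplicities; this is how a sorted iterated derivative
    is recognized as some [Dmulti]. *)
Lemma sorted_multi_seq (s : seq 'I_N) : sorted le_ord s ->
  s = multi_seq [ffun i => count_mem i s].
Proof.
move=> ss; apply: (sorted_eq (leT := le_ord)) => //.
- exact: le_ord_trans.
- by move=> a b; rewrite -eqn_leq => /eqP/val_inj.
- exact: multi_seq_sorted.
apply/allP => a _ /=; apply/eqP.
rewrite /multi_seq count_flatten -map_comp sumnE big_map big_enum /=.
rewrite (bigD1 a) //= big1 => [|b ba].
  by rewrite count_nseq /= eqxx mul1n ffunE addn0.
by rewrite count_nseq /= (negPf ba) mul0n.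
Qed.

Lemma multi_seq_subseq alpha (s : seq 'I_N) : subseq s (multi_seq alpha) ->
  s = multi_seq [ffun i => count_mem i s].
Proof.
move=> sub; apply/sorted_multi_seq/(subseq_sorted _ sub)/multi_seq_sorted.
exact: le_ord_trans.
Qed.

End multi_index.

Section coordinates.
Context {R : realType} {N : nat}.
Implicit Types (i j : 'I_N) (y : 'rV[R]_N).

Lemma normc_le (a b : R) : normc (a +i* b) <= `|a| + `|b|.
Proof.
rewrite /Normc.normc -(@ler_pXn2r _ 2) ?nnegrE ?sqrtr_ge0 ?addr_ge0 //.
rewrite sqr_sqrtr ?addr_ge0 ?sqr_ge0 // sqrrD !real_normK ?num_real //.
by rewrite addrAC lerDl mulrn_wge0 // mulr_ge0.
Qed.

Lemma line_coord i j y (h : R) :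
  (y + h *: delta_mx 0 i) 0 j = y 0 j + h *+ (j == i).
Proof. by rewrite !mxE eqxx /= mulr_natr. Qed.

(** The passage from one-variable real derivatives along a coordinate line to [is_pderiv]; the
    derivatives of the phase and of the cutoff come through it. *)
Lemma is_pderiv_complex (f g : 'rV[R]_N -> R) i y (a b : R) :
  is_derive (0 : R) 1 (fun h => f (y + h *: delta_mx 0 i)) a ->
  is_derive (0 : R) 1 (fun h => g (y + h *: delta_mx 0 i)) b ->
  is_pderiv absC i (fun z => f z +i* g z) y (a +i* b).
Proof.
have quot (f' : 'rV[R]_N -> R) (l : R) :
    is_derive (0 : R) 1 (fun h => f' (y + h *: delta_mx 0 i)) l ->
    `|h^-1 * (f' (y + h *: delta_mx 0 i) - f' y) - l| @[h --> 0^'] --> (0 : R).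
  move=> [df <-]; have := df; rewrite /derivable => /cvg_ex[k].
  rewrite /derive => dk; rewrite (cvg_lim _ dk) //.
  have ek : h^-1 * (f' (y + h *: delta_mx 0 i) - f' y) @[h --> 0^'] --> k.
    set F := (fun h : R => f' (y + h *: delta_mx 0 i)) in dk *.
    rewrite (_ : (fun h => _) =
      fun h => h^-1 *: ((F \o shift 0) (h *: (1 : R)) - F 0)) //.
    apply/funext => h; rewrite /F /= scale0r !addr0 /shift /=.
    by rewrite [h *: 1]mulr1.
  have := cvg_norm (cvgB ek (cvg_cst k)).
  by rewrite subrr normr0; apply.
move=> /quot fa /quot gb.
apply: (cvg_seminorm_squeeze (@absC_seminorms R)
  (fun _ h => `|h^-1 * (f (y + h *: delta_mx 0 i) - f y) - a| +
              `|h^-1 * (g (y + h *: delta_mx 0 i) - g y) - b|)).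
  move=> j; apply: filterE => h; rewrite /absC.
  set u := f _ - f y; set v := g _ - g y.
  have -> : (h^-1)%:C *: ((f (y + h *: delta_mx 0 i) +i* g (y + h *: delta_mx 0 i))
      - (f y +i* g y)) - (a +i* b) = (h^-1 * u - a) +i* (h^-1 * v - b).
    apply/eqP; rewrite eq_complex /= !mul0r subr0 addr0.
    by rewrite !eqxx.
  exact: normc_le.
by move=> _; have := cvgD fa gb; rewrite addr0; apply.
Qed.

End coordinates.

(** * Scalar factors *)

Section scalars.
Context {R : realType} {N : nat}.
Implicit Types (i j : 'I_N) (y : 'rV[R]_N) (c : 'rV[R]_N -> R[i]).

Lemma is_derive_affine (a c : R) (x : R) : is_derive x 1 (fun h => a + h * c) c.
Proof.
have dc : is_derive x 1 (c *: (id : R -> R)) (c *: (1 : R)).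
  by apply: is_deriveZ.
have da : is_derive x 1 (cst a : R -> R) 0 by exact: is_derive_cst.
have /is_derive_eq := is_deriveD da dc.
rewrite (_ : cst a + (c *: id) = fun h => a + h * c); last first.
  by apply/funext => h; congr (a + _); exact: mulrC.
by apply; rewrite add0r; exact: mulr1.
Qed.

Lemma seminorm_continuous_real (f : 'rV[R]_N -> R) :
  continuous f -> seminorm_continuous absC (fun y => (f y)%:C).
Proof.
move=> cf y.
apply: (proj2 (@cvg_seminormP _ _ _ (@absC_seminorms R) _ _ (nbhs_filter y) _ _)).
move=> j; rewrite /absC.
under eq_fun do rewrite -rmorphB normc_real.
have := cvg_norm (cvgB (cf y) (cvg_cst (f y))).
by rewrite subrr normr0; apply.
Qed.

Lemma smooth_mulr c c' : smooth absC c -> smooth absC c' ->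
  smooth absC (fun y => c y * c' y).
Proof. move=> sc sc'; exact (smoothM (@absC_seminorms R) sc sc'). Qed.

Lemma smooth_prod (T : Type) (r : seq T) (F : T -> 'rV[R]_N -> R[i]) :
  (forall k, smooth absC (F k)) -> smooth absC (fun y => \prod_(k <- r) F k y).
Proof.
move=> sF; elim: r => [|k r IH].
  apply: smooth_ext (smooth_cst (@absC_seminorms R) 1) => y.
  by rewrite big_nil.
by apply: smooth_ext (smooth_mulr (sF k) IH) => y; rewrite big_cons.
Qed.

Lemma smooth_exp c k : smooth absC c -> smooth absC (fun y => c y ^+ k).
Proof.
move=> sc; apply: smooth_ext (smooth_prod (enum 'I_k) (fun=> sc)) => y.
by rewrite big_enum prodr_const card_ord.
Qed.

(** Derivatives are written in logarithmic form [d k * F k y], so that the [d k] simply add up and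
    no product with a factor left out appears. *)
Lemma is_pderiv_prod (T : Type) (r : seq T) (F : T -> 'rV[R]_N -> R[i])
    (d : T -> R[i]) i y :
  (forall k, is_pderiv absC i (F k) y (d k * F k y)) ->
  is_pderiv absC i (fun z => \prod_(k <- r) F k z) y
    ((\sum_(k <- r) d k) * \prod_(k <- r) F k y).
Proof.
move=> dF; elim: r => [|k r IH].
  rewrite !big_nil mul0r; under eq_fun do rewrite big_nil.
  exact (is_pderiv_cst (@absC_seminorms R) i 1 y).
rewrite !big_cons; under eq_fun do rewrite big_cons.
rewrite (_ : _ * _ = (d k * F k y) *: (\prod_(k <- r) F k y) +
  F k y *: ((\sum_(k <- r) d k) * \prod_(k <- r) F k y)).
  exact (is_pderivM (@absC_seminorms R) (dF k) IH).
by rewrite /GRing.scale /=; ring.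
Qed.
Arguments is_pderiv_prod [T] r [F d i y] _ _ _.

Lemma is_pderiv_exp c (d : R[i]) k i y :
  is_pderiv absC i c y (d * c y) ->
  is_pderiv absC i (fun z => c z ^+ k) y (d *+ k * c y ^+ k).
Proof.
move=> dc; elim: k => [|k IH].
  under eq_fun do rewrite expr0; rewrite mulr0n mul0r.
  exact (is_pderiv_cst (@absC_seminorms R) i 1 y).
under eq_fun do rewrite exprS.
rewrite (_ : _ * _ = (d * c y) *: (c y ^+ k) + c y *: (d *+ k * c y ^+ k)).
  exact (is_pderivM (@absC_seminorms R) dc IH).
by rewrite /GRing.scale /= exprS mulrS; ring.
Qed.
Arguments is_pderiv_exp [c d] k [i y] _ _ _.

(* The phase e satisfies (1 + D_k / (2 a0)) e = (1 + i y_j) e for j conjugate to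
   k, and 1 + i y_j never vanishes. *)
Definition osc_inv j y : R[i] := (1 +i* y 0 j)^-1.

Lemma normc_oneDi (t : R) : normc (1 +i* t) = Num.sqrt (1 + t ^+ 2).
Proof. by rewrite /Normc.normc expr1n. Qed.

Lemma oneDi_neq0 (t : R) : (1 +i* t) != 0 :> R[i].
Proof. by rewrite eq_complex /= oner_eq0. Qed.

(** Differentiating the phase produces the unbounded factor i y_j; multiplied by [osc_inv j] it
    becomes bounded again. *)
Lemma osc_invE j y : I * (y 0 j)%:C * osc_inv j y = 1 - osc_inv j y.
Proof.
have qu : (1 +i* y 0 j) * osc_inv j y = 1 by exact/divff/oneDi_neq0.
apply/(mulfI (oneDi_neq0 (y 0 j))).
rewrite mulrBr qu mulr1 mulrCA qu mulr1.
by apply/eqP; rewrite eq_complex /=; apply/andP; split; apply/eqP; ring.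
Qed.

Lemma normc_osc_inv_sqr j y : normc (osc_inv j y) ^+ 2 = (1 + y 0 j ^+ 2)^-1.
Proof.
rewrite Normc.normcV normc_oneDi exprVn sqr_sqrtr //.
by rewrite addr_ge0 // sqr_ge0.
Qed.

Lemma normc_osc_inv_le1 j y : normc (osc_inv j y) <= 1.
Proof.
rewrite -(@ler_pXn2r _ 2) ?nnegrE ?normc_ge0 // expr1n normc_osc_inv_sqr.
by rewrite invf_le1 ?lerDl ?sqr_ge0 // ltr_pwDl // sqr_ge0.
Qed.

(** The resolvent identity. It yields both the Lipschitz bound and the derivative of [osc_inv]. *)
Lemma osc_inv_diff j y z :
  osc_inv j z - osc_inv j y = osc_inv j z * osc_inv j y * (I * (y 0 j - z 0 j)%:C).
Proof.
have -> : I * (y 0 j - z 0 j)%:C = (1 +i* y 0 j) - (1 +i* z 0 j).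
  by apply/eqP; rewrite eq_complex /=; apply/andP; split; apply/eqP; ring.
rewrite mulrBr -mulrA /osc_inv mulVf ?oneDi_neq0 // mulr1.
by rewrite mulrAC mulVf ?oneDi_neq0 // mul1r.
Qed.

Lemma normcI : normc (I : R[i]) = 1.
Proof. by rewrite /Normc.normc expr0n expr1n add0r sqrtr1. Qed.

Lemma normc_osc_inv_diff j y z :
  normc (osc_inv j z - osc_inv j y) <= `|z 0 j - y 0 j|.
Proof.
rewrite osc_inv_diff !Normc.normcM normcI mul1r normc_real distrC ler_piMl //.
by rewrite mulr_ile1 ?normc_ge0 ?normc_osc_inv_le1.
Qed.

Lemma seminorm_continuous_osc_inv j : seminorm_continuous absC (osc_inv j).
Proof.
move=> y.
apply: (cvg_seminorm_squeeze (FF := nbhs_filter y) (@absC_seminorms R)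
   (fun _ (z : 'rV[R]_N) => `|z 0 j - y 0 j|)) => k.
  by apply: filterE => z; exact: normc_osc_inv_diff.
have := cvg_norm (cvgB (@coord_continuous R _ _ 0 j y) (cvg_cst (y 0 j))).
by rewrite subrr normr0; apply.
Qed.

Lemma is_pderiv_osc_inv i j y :
  is_pderiv absC i (osc_inv j) y
    ((if j == i then - I * osc_inv j y else 0) * osc_inv j y).
Proof.
(* For j = i the error of the difference quotient is, by the resolvent identity, -i [osc_inv j y]
   times the increment of [osc_inv j], which is at most |h|. *)
apply: (cvg_seminorm_squeeze (@absC_seminorms R)
   (fun _ (h : R) => `|h|)) => k; last first.
  by have := cvg_norm (cvg_dnbhs0 R); rewrite normr0; apply.
near=> h.
have h0 : h != 0 by near: h; exact: nbhs_dnbhs_neq.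
set z := y + _.
have zj : y 0 j - z 0 j = - (h *+ (j == i)) by rewrite line_coord; ring.
rewrite osc_inv_diff zj; have [ji|ji] := eqVneq j i; last first.
  by rewrite mulr0n oppr0 /absC mulr0 mulr0 scaler0 mul0r subr0 Normc.normc0.
rewrite mulr1n.
have -> : (h^-1)%:C *: (osc_inv j z * osc_inv j y * (I * (- h)%:C)) -
   - I * osc_inv j y * osc_inv j y =
   - I * osc_inv j y * (osc_inv j z - osc_inv j y).
  rewrite rmorphN /= /GRing.scale /=.
  have hh : (h^-1)%:C * h%:C = 1 :> R[i] by rewrite -rmorphM /= mulVf.
  transitivity (- I * osc_inv j y * (((h^-1)%:C * h%:C) * osc_inv j z - osc_inv j y)).
    by ring.
  by rewrite hh mul1r.
rewrite /absC !Normc.normcM (normcN (I : R[i])) normcI mul1r.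
apply: le_trans (_ : 1 * `|z 0 j - y 0 j| <= _).
  by rewrite ler_pM ?normc_ge0 ?normc_osc_inv_le1 ?normc_osc_inv_diff.
by rewrite -normrN opprB zj ji eqxx mulr1n normrN mul1r.
Unshelve. all: by end_near. Qed.
Arguments is_pderiv_osc_inv i j y _ _ : clear implicits.

(** Multiples of powers of [osc_inv j] are stable under derivation. *)
Lemma smooth_osc_inv j : smooth absC (osc_inv j).
Proof.
apply: (smooth_coind (@absC_seminorms R)
  (S := [set c | exists a k, c = fun y => a *: (osc_inv j y ^+ k)])).
  move=> _ [a [k ->]]; split.
    apply: (seminorm_continuousZ (@absC_seminorms R)).
    elim: k => [|k IH].
      rewrite (_ : (fun y => _) = fun=> 1).
        exact: (seminorm_continuous_cst (@absC_seminorms R)).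
      by apply/funext => y; rewrite expr0.
    rewrite (_ : (fun y => _) = fun y => osc_inv j y *: osc_inv j y ^+ k).
      exact (seminorm_continuousM (@absC_seminorms R)
        (@seminorm_continuous_osc_inv j) IH).
    by apply/funext => y; rewrite exprS.
  move=> i; exists (fun y => a *: ((if j == i then - I * osc_inv j y else 0) *+ k *
     osc_inv j y ^+ k)).
    case: (j == i).
      exists (a * - I *+ k), k.+1; apply/funext => y.
      by rewrite /GRing.scale /= exprS -mulrnAl; ring.
    exists 0, 0%N; apply/funext => y.
    by rewrite mul0rn mul0r scaler0 scale0r.
  move=> y; exact (is_pderivZ (@absC_seminorms R) a
    (is_pderiv_exp k (is_pderiv_osc_inv i j y))).
by exists 1, 1%N; apply/funext => y; rewrite expr1 scale1r.
Qed.

Definition osc_mon (e : {ffun 'I_N -> nat}) y : R[i] :=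
  \prod_(j < N) osc_inv j y ^+ e j.

Lemma smooth_osc_mon e : smooth absC (osc_mon e).
Proof.
apply: smooth_ext (smooth_prod (enum 'I_N)
  (fun j => smooth_exp (e j) (smooth_osc_inv j))) => y.
by rewrite big_enum.
Qed.

Lemma is_pderiv_osc_mon e i y :
  is_pderiv absC i (osc_mon e) y (- I *+ e i * osc_inv i y * osc_mon e y).
Proof.
have -> : - I *+ e i * osc_inv i y = \sum_(j <- enum 'I_N)
   (if j == i then - I * osc_inv j y else 0) *+ e j.
  rewrite big_enum /= (bigD1 i) //= eqxx big1 ?addr0 ?mulrnAl //.
  by move=> j /negPf ->; rewrite mul0rn.
rewrite /osc_mon -big_enum /=; under eq_fun do rewrite -big_enum /=.
exact (is_pderiv_prod (enum 'I_N)
  (fun j => is_pderiv_exp (e j) (is_pderiv_osc_inv i j y))).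
Qed.
Arguments is_pderiv_osc_mon e i y _ _ : clear implicits.

End scalars.

Arguments is_pderiv_prod {R N} [T] r [F d i y] _ _ _.
Arguments is_pderiv_exp {R N} [c d] k [i y] _ _ _.
Arguments is_pderiv_osc_inv {R N} i j y _ _.
Arguments is_pderiv_osc_mon {R N} e i y _ _.

(** * The phase and conjugate coordinates *)

Section phase.
Context {R : realType} {d : nat} (a0 : R).
Implicit Types (i : 'I_(d + d)) (y : 'rV[R]_(d + d)).

Definition conj_index i : 'I_(d + d) :=
  match fintype.split i with inl j => rshift d j | inr j => lshift d j end.

Lemma conj_index_lshift (j : 'I_d) : conj_index (lshift d j) = rshift d j.
Proof. by rewrite /conj_index (unsplitK (inl j)). Qed.

Lemma conj_index_rshift (j : 'I_d) : conj_index (rshift d j) = lshift d j.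
Proof. by rewrite /conj_index (unsplitK (inr j)). Qed.

(** Consequently D_i does not act on the factor [osc_inv (conj_index i)]. *)
Lemma conj_index_neq i : (conj_index i == i) = false.
Proof.
by case: (split_ordP i) => j ->;
  rewrite ?conj_index_lshift ?conj_index_rshift ?eq_lrshift ?eq_rlshift.
Qed.

Lemma conj_indexK : involutive conj_index.
Proof.
by move=> i; case: (split_ordP i) => j ->;
  rewrite ?conj_index_lshift ?conj_index_rshift ?conj_index_lshift.
Qed.

Lemma omega0E y : omega0 y = \sum_(j < d) y 0 (lshift d j) * y 0 (rshift d j).
Proof. by apply: eq_bigr => j _; rewrite !mxE. Qed.

Lemma omega0_line i y (h : R) :
  omega0 (y + h *: delta_mx 0 i) = omega0 y + h * y 0 (conj_index i).
Proof.
rewrite !omega0E; under eq_bigr do rewrite !line_coord.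
case: (split_ordP i) => k ->.
  rewrite conj_index_lshift (bigD1 k) //= [in RHS](bigD1 k) //=.
  rewrite eqxx eq_rlshift mulr1n mulr0n addr0 mulrDl addrAC; congr (_ + _ + _).
  apply: eq_bigr => j /negPf jk.
  by rewrite eq_lshift jk eq_rlshift !mulr0n !addr0.
rewrite conj_index_rshift (bigD1 k) //= [in RHS](bigD1 k) //=.
rewrite eqxx eq_lrshift mulr1n mulr0n addr0 mulrDr addrAC mulrC.
rewrite [_ * h]mulrC; congr (_ + _ + _).
apply: eq_bigr => j /negPf jk.
by rewrite eq_rshift jk eq_lrshift !mulr0n !addr0.
Qed.

Lemma continuous_omega0 : continuous (@omega0 R d).
Proof.
rewrite (_ : @omega0 R d = \sum_(j < d)
  (fun y : 'rV[R]_(d + d) => y 0 (lshift d j) * y 0 (rshift d j))); last first.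
  by apply/funext => y; rewrite omega0E fct_sumE.
elim/big_rec: _ => [|j f _ cf]; first exact: cst_continuous.
move=> y; apply: continuousD; last exact: cf.
by apply: continuousM; exact: coord_continuous.
Qed.

Lemma seminorm_continuous_phase : seminorm_continuous absC (@phase R d a0).
Proof.
have cont (f : R -> R) : continuous f ->
    continuous (fun y => f (2 * a0 * @omega0 R d y)).
  move=> cf y; apply: (@continuous_comp _ _ _ (fun y => 2 * a0 * omega0 y) f).
    apply: continuousM; first exact: cst_continuous.
    exact: continuous_omega0.
  exact: cf.
rewrite (_ : phase a0 = fun y => (cos (2 * a0 * @omega0 R d y))%:C +
   I *: (sin (2 * a0 * @omega0 R d y))%:C); last first.
  apply/funext => y; apply/eqP; rewrite eq_complex /=.
  by apply/andP; split; apply/eqP; ring.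
apply: (seminorm_continuousD (@absC_seminorms R)).
  exact/seminorm_continuous_real/cont/continuous_cos.
apply: (seminorm_continuousZ (@absC_seminorms R)).
exact/seminorm_continuous_real/cont/continuous_sin.
Qed.

Lemma is_pderiv_phase i y : is_pderiv absC i (phase a0) y
  ((2 * a0)%:C * I * (y 0 (conj_index i))%:C * phase a0 y).
Proof.
set b := y 0 _.
have der (f : R -> R) l : is_derive (2 * a0 * omega0 y) 1 f l ->
    is_derive (0 : R) 1
      (fun h => f (2 * a0 * omega0 (y + h *: delta_mx 0 i))) (l * (2 * a0 * b)).
  move=> df.
  rewrite (_ : (fun h => _) = f \o (fun h => 2 * a0 * omega0 y + h * (2 * a0 * b))).
    apply: is_derive1_comp; last exact: is_derive_affine.
    by rewrite mul0r addr0.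
  by apply/funext => h /=; rewrite omega0_line -/b; congr f; ring.
rewrite (_ : _ * _ = (- sin (2 * a0 * omega0 y) * (2 * a0 * b)) +i*
   (cos (2 * a0 * omega0 y) * (2 * a0 * b))).
  exact (is_pderiv_complex (der _ _ (is_derive_cos _)) (der _ _ (is_derive_sin _))).
by apply/eqP; rewrite eq_complex /=; apply/andP; split; apply/eqP; ring.
Qed.
Arguments is_pderiv_phase i y _ _ : clear implicits.

Lemma normc_phase y : normc (phase a0 y) = 1.
Proof. by rewrite /Normc.normc /phase cos2Dsin2 sqrtr1. Qed.

End phase.

Arguments is_pderiv_phase {R d} a0 i y _ _.

(** * The integral *)

Section simple_functions.
Context {R : realType} {d : measure_display} {T : measurableType d}.
Context {mu : {measure set T -> \bar R}} {E : lmodType R[i]}.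
Implicit Types s : simple_fun mu E.

(** The sets of a simple function may overlap. Recording which of them contain [t] splits the space
    into disjoint atoms on which the function is constant. *)
Definition pattern s (t : T) : {ffun 'I_(sf_card s) -> bool} :=
  [ffun k => t \in sf_set k].

Definition atom s (b : {ffun 'I_(sf_card s) -> bool}) : set T :=
  [set t | pattern s t = b].

Definition atom_value s (b : {ffun 'I_(sf_card s) -> bool}) : E :=
  \sum_k (b k)%:R%:C *: sf_coef k.

Lemma measurable_atom s b : measurable (@atom s b).
Proof.
rewrite (_ : atom b = \bigcap_(k in [set: 'I_(sf_card s)])
    (if b k then sf_set k else ~` sf_set k)).
  apply: fin_bigcap_measurable; first exact: finite_finset.
  move=> k _; have := @sf_measurable _ _ _ _ _ s k.
  by case: (b k) => // ?; exact: measurableC.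
apply/seteqP; split=> [t <- k _|t tb].
  by rewrite ffunE; case: ifPn => [/set_mem//|/negP h] /mem_set.
apply/ffunP => k; rewrite ffunE; have := tb k Logic.I.
by case: (b k) => [/mem_set ->//|h]; apply/negbTE/negP => /set_mem.
Qed.

Lemma simple_eval_pattern s t : simple_eval s t = atom_value (pattern s t).
Proof. by apply: eq_bigr => k _; rewrite ffunE indicE. Qed.

Lemma atom_partition s t (A : nmodType) (F : {ffun 'I_(sf_card s) -> bool} -> A) :
  \sum_b (F b *+ (t \in atom b)) = F (pattern s t).
Proof.
rewrite (bigD1 (pattern s t)) //= mem_set // mulr1n big1 ?addr0 // => b bt.
by rewrite memNset ?mulr0n // => tb; rewrite -tb eqxx in bt.
Qed.

Lemma simple_eval_indic s (F : E -> R) t :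
  F (simple_eval s t) = \sum_b F (atom_value b) * \1_(@atom s b) t.
Proof.
rewrite simple_eval_pattern -(atom_partition t (fun b => F (atom_value b))).
by apply: eq_bigr => b _; rewrite indicE mulr_natr.
Qed.

Lemma measurable_simple_eval s (F : E -> R) :
  measurable_fun setT (fun t => F (simple_eval s t)).
Proof.
under eq_fun do rewrite simple_eval_indic.
apply: measurable_sum => b; apply: measurable_funM => //.
exact/measurable_indic/measurable_atom.
Qed.

Lemma integral_indic_sum (I : Type) (r : seq I) (A : I -> set T) (c : I -> R) :
  (forall i, measurable (A i)) -> (forall i, 0 <= c i) ->
  (\int[mu]_t (\sum_(i <- r) c i * \1_(A i) t)%:E =
   \sum_(i <- r) (c i)%:E * mu (A i))%E.
Proof.
move=> mA c0; under eq_integral do rewrite -sumEFin.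
rewrite ge0_integral_sum //; last 2 first.
- by move=> i; apply/measurable_EFinP/measurable_funM => //; exact: measurable_indic.
- by move=> i t _; rewrite lee_fin mulr_ge0 // indicE.
apply: eq_bigr => i _.
under eq_integral do rewrite EFinM.
rewrite ge0_integralZl_EFin //.
- by rewrite integral_indic // setIT.
- exact/measurable_EFinP/measurable_indic.
Qed.

Lemma sf_set_atoms s k : (mu (sf_set k) =
  \sum_(b : {ffun 'I_(sf_card s) -> bool} | b k) mu (atom b))%E.
Proof.
rewrite -[sf_set k]setIT -integral_indic //; last exact: sf_measurable.
transitivity (\int[mu]_t
    (\sum_(b : {ffun 'I_(sf_card s) -> bool}) (b k)%:R * \1_(atom b) t)%:E)%E.
  apply: eq_integral => t _; congr EFin.
  rewrite indicE -(ffunE (fun k => t \in sf_set k)).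
  rewrite -(atom_partition t (fun b : {ffun _ -> bool} => (b k)%:R)).
  by apply: eq_bigr => b _; rewrite indicE mulr_natr.
rewrite integral_indic_sum //; last by move=> b; exact: measurable_atom.
rewrite [RHS]big_mkcond /=; apply: eq_bigr => b _.
by case: (b k); rewrite ?mul1e ?mul0e.
Qed.

(** The atom with no true entry is the complement of all the sets and may have infinite measure; any
    other atom lies in some [sf_set k]. *)
Lemma atom_fin_num s (b : {ffun 'I_(sf_card s) -> bool}) k : b k -> mu (@atom s b) \is a fin_num.
Proof.
move=> bk; rewrite ge0_fin_numE //.
apply: le_lt_trans (@sf_finite _ _ _ _ _ s k).
by rewrite sf_set_atoms (bigD1 b) //= leeDl // sume_ge0.
Qed.

Lemma simple_integral_atoms s :
  simple_integral s = \sum_b (fine (mu (@atom s b)))%:C *: atom_value b.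
Proof.
rewrite /atom_value; under [RHS]eq_bigr do rewrite scaler_sumr.
rewrite exchange_big /=; apply: eq_bigr => k _.
rewrite sf_set_atoms -sum_fine; last by move=> b; exact: atom_fin_num.
rewrite rmorph_sum scaler_suml big_mkcond /=; apply: eq_bigr => b _.
by case: (b k); rewrite ?scale1r // scale0r scaler0.
Qed.

Context {p : nat -> E -> R} (hp : seminorms p).

(** On disjoint atoms this is the triangle inequality, since the seminorm of the function is then a
    simple function with values [p j (atom_value b)]. *)
Lemma seminorm_simple_integral s j :
  ((p j (simple_integral s))%:E <= \int[mu]_t (p j (simple_eval s t))%:E)%E.
Proof.
under eq_integral do rewrite simple_eval_indic.
rewrite integral_indic_sum; last 2 first.
- by move=> b; exact: measurable_atom.
- by move=> b; exact: (seminorm_ge0 hp).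
apply: (@le_trans _ _ (\sum_b (p j (atom_value b) * fine (mu (@atom s b)))%:E)%E).
  rewrite sumEFin lee_fin simple_integral_atoms.
  apply: le_trans (seminorm_sum hp _ _ _ _) _; apply: ler_sum => b _.
  by rewrite (seminormZ hp) normc_real ger0_norm ?fine_ge0 // mulrC.
apply: lee_sum => b _; rewrite EFinM.
(* On the atom of possibly infinite measure the value is 0, and both sides vanish. *)
have [/existsP[k bk]|/existsPn b0] := boolP [exists k, b k].
  by rewrite fineK //; exact: (atom_fin_num bk).
rewrite /atom_value big1 ?(seminorm0 hp) ?mul0e // => k _.
by rewrite (negPf (b0 k)) scale0r.
Qed.

Definition simple_sub_set s s' (k : 'I_(sf_card s + sf_card s')) : set T :=
  match fintype.split k with inl a => sf_set a | inr b => sf_set b end.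

Definition simple_sub_coef s s' (k : 'I_(sf_card s + sf_card s')) : E :=
  match fintype.split k with inl a => sf_coef a | inr b => - sf_coef b end.

Lemma measurable_simple_sub s s' k : measurable (@simple_sub_set s s' k).
Proof.
by rewrite /simple_sub_set; case: fintype.split => a; exact: sf_measurable.
Qed.

Lemma simple_sub_finite s s' k : (mu (@simple_sub_set s s' k) < +oo)%E.
Proof.
by rewrite /simple_sub_set; case: fintype.split => a; exact: sf_finite.
Qed.

Definition simple_sub s s' : simple_fun mu E :=
  SimpleFun (@simple_sub_coef s s') (@measurable_simple_sub s s')
    (@simple_sub_finite s s').

Lemma simple_eval_sub s s' t :
  simple_eval (simple_sub s s') t = simple_eval s t - simple_eval s' t.
Proof.
rewrite /simple_eval /= big_split_ord -sumrN /=; congr (_ + _);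
  apply: eq_bigr => k _; rewrite /simple_sub_set /simple_sub_coef.
  by rewrite (unsplitK (inl k)).
by rewrite (unsplitK (inr k)) scalerN.
Qed.

Lemma simple_integral_sub s s' :
  simple_integral (simple_sub s s') = simple_integral s - simple_integral s'.
Proof.
rewrite /simple_integral /= big_split_ord -sumrN /=; congr (_ + _);
  apply: eq_bigr => k _; rewrite /simple_sub_set /simple_sub_coef.
  by rewrite (unsplitK (inl k)).
by rewrite (unsplitK (inr k)) scalerN.
Qed.

End simple_functions.

(** * The integral of limits of simple functions *)

Section integral.
Context {R : realType} {d : measure_display} {T : measurableType d}.
Context {mu : {measure set T -> \bar R}} {E : lmodType R[i]}.
Context {p : nat -> E -> R} (hp : seminorms p).
Implicit Types (g : T -> E) (s : nat -> simple_fun mu E) (q : simple_fun mu E).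

(** [E] carries no sigma-algebra: measurability is a property of the real functions p_j (g - v),
    which are limits of the corresponding functions of the [s k]. *)
Lemma measurable_seminorm_limit s g (v : E) j :
  (forall t, simple_eval (s k) t @[k --> \oo] `=>` seminorm_nbhs p (g t)) ->
  measurable_fun setT (fun t => p j (g t - v)).
Proof.
move=> sg.
apply: (@measurable_fun_cvg _ _ _ setT (fun k t => p j (simple_eval (s k) t - v))).
  move=> k; exact: (measurable_simple_eval (s k) (fun x => p j (x - v))).
move=> t _.
exact: (cvg_seminorm_comp hp j (cvg_seminormD hp (sg t) (cvg_seminorm_cst hp (- v)))).
Qed.

Lemma measurable_seminorm_dist s g q j :
  (forall t, simple_eval (s k) t @[k --> \oo] `=>` seminorm_nbhs p (g t)) ->
  measurable_fun setT (fun t => p j (g t - simple_eval q t)).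
Proof.
move=> sg.
apply: (@measurable_fun_cvg _ _ _ setT
    (fun k t => p j (simple_eval (simple_sub (s k) q) t))).
  by move=> k; exact: (measurable_simple_eval _ (p j)).
move=> t _; under eq_fun do rewrite simple_eval_sub.
exact: (cvg_seminorm_comp hp j (cvg_seminormD hp (sg t)
  (cvg_seminorm_cst hp (- simple_eval q t)))).
Qed.

Lemma le_integral_seminorm (f g h : T -> R) :
  (forall t, 0 <= f t) -> (forall t, 0 <= g t) -> (forall t, 0 <= h t) ->
  measurable_fun setT f -> measurable_fun setT g -> measurable_fun setT h ->
  (forall t, f t <= g t + h t) ->
  (\int[mu]_t (f t)%:E <= \int[mu]_t (g t)%:E + \int[mu]_t (h t)%:E)%E.
Proof.
move=> f0 g0 h0 mf mg mh fgh; rewrite -ge0_integralD //; last 4 first.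
- by move=> t _; rewrite lee_fin.
- exact/measurable_EFinP.
- by move=> t _; rewrite lee_fin.
- exact/measurable_EFinP.
apply: ge0_le_integral => //.
- by move=> t _; rewrite lee_fin.
- exact/measurable_EFinP.
- by apply: emeasurable_funD; exact/measurable_EFinP.
- by move=> t _; rewrite -EFinD lee_fin.
Qed.

(** The difference of two simple functions is simple, and its seminorm is at most the sum of the
    distances to [g]. The sequence [s] provides the measurability of these distances. *)
Lemma simple_integral_dist s g j q q' :
  (forall t, simple_eval (s k) t @[k --> \oo] `=>` seminorm_nbhs p (g t)) ->
  ((p j (simple_integral q - simple_integral q'))%:E <=
   \int[mu]_t (p j (g t - simple_eval q t))%:E +
   \int[mu]_t (p j (g t - simple_eval q' t))%:E)%E.
Proof.
move=> sg; rewrite -simple_integral_sub.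
apply: le_trans (seminorm_simple_integral hp _ _) _.
apply: le_integral_seminorm => [t|t|t||||t]; try exact: (seminorm_ge0 hp).
- exact: (measurable_simple_eval _ (p j)).
- exact: measurable_seminorm_dist sg.
- exact: measurable_seminorm_dist sg.
- rewrite simple_eval_sub (seminorm_distC hp _ (g t) (simple_eval q t)).
  exact: (seminorm_distD hp).
Qed.

Lemma cvg_EFin_seminorm (u : nat -> E) v j :
  u @ \oo `=>` seminorm_nbhs p v -> (p j (u k - v))%:E @[k --> \oo] --> 0%E.
Proof.
move=> /(cvg_seminormP hp)/(_ j) uv; apply: cvg_EFin => //.
exact: nearW.
Qed.

Lemma is_integral_unique g v v' :
  is_integral mu p g v -> is_integral mu p g v' -> v = v'.
Proof.
move=> [s [sg s0 sv]] [s' [sg' s'0 sv']].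
apply/eqP; rewrite -subr_eq0; apply/eqP/(seminorm_separated hp) => j.
apply/eqP; rewrite eq_le (seminorm_ge0 hp) andbT -lee_fin.
have h1 := cvg_EFin_seminorm j sv; have h2 := cvg_EFin_seminorm j sv'.
have lim0 : ((p j (simple_integral (s k) - v))%:E +
    (p j (simple_integral (s' k) - v'))%:E +
    (\int[mu]_t (p j (g t - simple_eval (s k) t))%:E +
     \int[mu]_t (p j (g t - simple_eval (s' k) t))%:E))%E @[k --> \oo]
      --> (0 + 0 + (0 + 0))%E.
  by apply: cvgeD => //; [apply: cvgeD|apply: cvgeD; [|exact: s0|exact: s'0]].
rewrite !adde0 in lim0; apply: cvge_ge lim0; apply: nearW => k.
have /(leeD2l _) := simple_integral_dist j (s k) (s' k) sg.
move=> /(_ (p j (simple_integral (s k) - v) + p j (simple_integral (s' k) - v'))%:E).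
apply: le_trans.
rewrite -!EFinD lee_fin.
rewrite (seminorm_distC hp _ _ v) -addrA (addrC (p j (_ - v'))) addrA.
apply: le_trans (seminorm_distD hp j (simple_integral (s' k)) v v') _.
by rewrite lerD2r (seminorm_distD hp).
Qed.

(** The integrals of the [s k] form a Cauchy sequence by [simple_integral_dist]; this is where the
    completeness of [E] enters. *)
Lemma is_integral_simple s g : frechet p ->
  (forall t, simple_eval (s k) t @[k --> \oo] `=>` seminorm_nbhs p (g t)) ->
  (forall j, (\int[mu]_t (p j (g t - simple_eval (s k) t))%:E)%E
               @[k --> \oo] --> 0%E) ->
  exists2 v, is_integral mu p g v &
    simple_integral (s k) @[k --> \oo] `=>` seminorm_nbhs p v.
Proof.
move=> fp sg s0.
have [v sv] : exists v, (fun k => simple_integral (s k)) @ \oo `=>` seminorm_nbhs p v.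
  apply: (frechet_complete fp) => j e e0.
  have e2 : (0 < (e / 2)%:E)%E by rewrite lte_fin divr_gt0.
  have [N _ sN] : \forall k \near \oo,
      (\int[mu]_t (p j (g t - simple_eval (s k) t))%:E < (e / 2)%:E)%E.
    have /fine_cvgP[fin /cvgrPdist_lt/(_ (e / 2))] := s0 j.
    rewrite divr_gt0 // => /(_ isT); apply: filterS2 fin => k /fineK fk.
    by rewrite /= sub0r normrN -[in X in _ -> X]fk lte_fin; exact/le_lt_trans/ler_norm.
  exists N => k l Nk Nl; rewrite -lte_fin.
  apply: le_lt_trans (simple_integral_dist j (s k) (s l) sg) _.
  rewrite [e]splitr EFinD lteD //; exact: sN.
by exists v => //; exists s; split.
Qed.

Lemma is_integral_bound g v j (M : R) : is_integral mu p g v ->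
  (\int[mu]_t (p j (g t))%:E <= M%:E)%E -> p j v <= M.
Proof.
move=> [s [sg s0 sv]] gM; rewrite -lee_fin.
have h1 := cvg_EFin_seminorm j sv.
have lim0 : ((p j (simple_integral (s k) - v))%:E +
    (\int[mu]_t (p j (g t - simple_eval (s k) t))%:E + M%:E))%E @[k --> \oo]
      --> (0 + (0 + M%:E))%E.
  apply: cvgeD => //; apply: cvgeD; [|exact: s0|exact: cvg_cst].
  by rewrite fin_num_adde_defl.
rewrite !add0e in lim0; apply: cvge_ge lim0; apply: nearW => k.
apply: (@le_trans _ _ ((p j (v - simple_integral (s k)))%:E +
   (p j (simple_integral (s k)))%:E)%E).
  by rewrite -EFinD lee_fin (seminorm_leD hp).
rewrite (seminorm_distC hp) leeD //.
apply: le_trans (seminorm_simple_integral hp _ _) _.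
have /(leeD2l (\int[mu]_t (p j (g t - simple_eval (s k) t))%:E)%E) := gM.
apply: le_trans.
apply: le_integral_seminorm => [t|t|t||||t]; try exact: (seminorm_ge0 hp).
- exact: (measurable_simple_eval _ (p j)).
- exact: measurable_seminorm_dist sg.
- have := measurable_seminorm_limit 0 j sg.
  by under [X in measurable_fun _ X -> _]eq_fun do rewrite subr0.
- by rewrite (seminorm_distC hp) (seminorm_leD hp).
Qed.

End integral.

(** * Lebesgue measure on R^N and an integrable majorant *)

Section lebesgue_space.
Context {R : realType}.
Local Notation T := (fun N => sfs_type (lebesgue_space R N)).
Local Notation leb := (fun N => sfs_mu (lebesgue_space R N)).

Lemma rV_of_ord0 N (t : T N.+1) : rV_of t 0 ord0 = t.1.
Proof.
have <- : row_mx (t.1)%:M (rV_of t.2) 0 (lshift N (ord0 : 'I_1)) = t.1.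
  by rewrite row_mxEl mxE eqxx mulr1n.
by apply/congr1/val_inj.
Qed.

Lemma rV_of_lift N (t : T N.+1) i : rV_of t 0 (lift ord0 i) = rV_of t.2 0 i.
Proof.
have <- : row_mx (t.1)%:M (rV_of t.2) 0 (rshift 1 i) = rV_of t.2 0 i.
  by rewrite row_mxEr.
by apply/congr1/val_inj.
Qed.

Lemma measurable_rV_of N i : measurable_fun setT (fun t : T N => rV_of t 0 i).
Proof.
elim: N i => [[]//|N IH] i; case: (unliftP ord0 i) => [j ->|->].
  under eq_fun do rewrite rV_of_lift.
  exact: (measurableT_comp (IH j) measurable_snd).
under eq_fun do rewrite rV_of_ord0.
exact: measurable_fst.
Qed.

(** Half-open, so that the cells of a grid are disjoint. *)
Definition box N (a b : 'I_N -> R) : set (T N) :=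
  [set t | forall i, a i <= rV_of t 0 i < b i].

Lemma boxS N (a b : 'I_N.+1 -> R) :
  box a b = `[a ord0, b ord0[%classic `*`
    box (fun i => a (lift ord0 i)) (fun i => b (lift ord0 i)).
Proof.
apply/seteqP; split=> [t tab|t [t1 t2] i].
  split; first by have := tab ord0; rewrite rV_of_ord0 /= in_itv.
  by move=> i; have := tab (lift ord0 i); rewrite rV_of_lift.
case: (unliftP ord0 i) => [j ->|->]; first by rewrite rV_of_lift; exact: t2.
by move: t1; rewrite rV_of_ord0 /= in_itv.
Qed.

Lemma measurable_box N (a b : 'I_N -> R) : measurable (box a b).
Proof.
elim: N a b => [|N IH] a b.
  rewrite (_ : box a b = setT); first exact: measurableT.
  by apply/seteqP; split => // t _ [].
by rewrite boxS; exact: measurableX.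
Qed.

Lemma lebesgue_box N (a b : 'I_N -> R) : (forall i, a i <= b i) ->
  leb N (box a b) = (\prod_i (b i - a i))%:E.
Proof.
elim: N a b => [|N IH] a b ab.
  rewrite big_ord0 (_ : box a b = setT) /= ?diracT //.
  by apply/seteqP; split => // t _ [].
rewrite boxS /= /sf_product product_measure1E //; last exact: measurable_box.
rewrite IH => [|i]; last exact: ab.
rewrite big_ord_recl EFinM; congr (_ * _)%E.
apply: (etrans (lebesgue_measure_itv _)); rewrite /= lte_fin; case: ltP => // ba.
by rewrite (@le_anti _ _ (a ord0) (b ord0)) ?ab // subrr.
Qed.

(** The common majorant of all integrands. As a product of one-variable functions it is integrable
    by Tonelli, and its factors are the squared moduli of the [osc_inv i]. *)
Definition dominator N (y : 'rV[R]_N) : R := \prod_i (1 + y 0 i ^+ 2)^-1.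

Lemma oneDsqr_gt0 (x : R) : 0 < 1 + x ^+ 2.
Proof. by rewrite ltr_pwDl ?sqr_ge0. Qed.

Lemma dominator_gt0 N (y : 'rV[R]_N) : 0 < dominator y.
Proof. by apply: prodr_gt0 => i _; rewrite invr_gt0 oneDsqr_gt0. Qed.

Lemma measurable_dominator N :
  measurable_fun setT (fun t : T N => dominator (rV_of t)).
Proof.
apply: measurable_prod => i _.
have mV : measurable_fun setT (fun x : R => (1 + x ^+ 2)^-1).
  by apply: continuous_measurable_fun; exact: continuous_oneDsqrV.
exact: (measurableT_comp mV (measurable_rV_of i)).
Qed.

Lemma integral_oneDsqrV :
  (\int[lebesgue_measure]_x ((1 + x ^+ 2 : R)^-1)%:E < +oo)%E.
Proof.
rewrite (@ge0_symfun_integralT R (fun x => (1 + x ^+ 2)^-1)).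
- rewrite (_ : [set x : R | 0 <= x] = `[0, +oo[%classic); last first.
    by apply/seteqP; split => x; rewrite /= in_itv /= andbT.
  by rewrite (integral0y_oneDsqr R) -EFinM ltry.
- by move=> x; rewrite invr_ge0 ltW // oneDsqr_gt0.
- exact: continuous_oneDsqrV.
- by move=> x; rewrite /= sqrrN.
Qed.

Lemma dominatorS N (t : T N.+1) :
  dominator (rV_of t) = (1 + t.1 ^+ 2)^-1 * dominator (rV_of t.2).
Proof.
rewrite /dominator big_ord_recl rV_of_ord0; congr (_ * _).
by apply: eq_bigr => i _; rewrite rV_of_lift.
Qed.

Lemma integral_dominator N :
  (\int[leb N]_t (dominator (rV_of t))%:E < +oo)%E.
Proof.
elim: N => [|N IH].
  under eq_integral do rewrite /dominator big_ord0.
  by rewrite integral_cst //= diracT mule1 ltry.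
(* The measure is restated as a plain product measure, the form to which Tonelli's theorem
   applies. *)
have -> : (\int[leb N.+1]_t (dominator (rV_of t))%:E =
   \int[lebesgue_measure \x leb N]_t (dominator (@rV_of R N.+1 t))%:E)%E by [].
rewrite fubini_tonelli1; last 2 first.
- exact (proj2 (measurable_EFinP _ _) (@measurable_dominator N.+1)).
- by move=> t; rewrite lee_fin ltW // dominator_gt0.
under eq_integral => x _.
  rewrite /fubini_F.
  under eq_integral do rewrite dominatorS EFinM /=.
  rewrite ge0_integralZl_EFin //; last 3 first.
  - by move=> t _; rewrite lee_fin ltW // dominator_gt0.
  - exact/measurable_EFinP/measurable_dominator.
  - by rewrite invr_ge0 ltW // oneDsqr_gt0.
  over.
have fin : (\int[leb N]_t (dominator (rV_of t))%:E)%E \is a fin_num.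
  rewrite ge0_fin_numE // integral_ge0 // => t _.
  by rewrite lee_fin ltW // dominator_gt0.
rewrite -(fineK fin) ge0_integralZr //; last 3 first.
- apply/measurable_EFinP; apply: continuous_measurable_fun.
  exact: continuous_oneDsqrV.
- by move=> x _; rewrite lee_fin invr_ge0 ltW // oneDsqr_gt0.
- rewrite lee_fin fine_ge0 // integral_ge0 // => t _.
  by rewrite lee_fin ltW // dominator_gt0.
rewrite muleC lte_mul_pinfty ?integral_oneDsqrV // lee_fin fine_ge0 //.
by rewrite integral_ge0 // => t _; rewrite lee_fin ltW // dominator_gt0.
Qed.

End lebesgue_space.

(** * Riemann sums *)

Section row_vectors.
Context {R : realType} {N : nat}.
Implicit Types y z : 'rV[R]_N.

Lemma nbhs_rowP y (A : set 'rV[R]_N) : nbhs y A <->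
  exists2 e : R, 0 < e & forall z, (forall i, `|z 0 i - y 0 i| < e) -> A z.
Proof.
split=> [/nbhs_ballP[e e0 yA]|[e e0 yA]].
  exists e => // z zy; apply: yA; split=> // i j.
  by rewrite (ord1 i) /ball /= distrC; exact: zy.
apply/nbhs_ballP; exists e => // z [_ zy]; apply: yA => i.
by have := zy 0 i; rewrite /ball /= distrC.
Qed.

Lemma dominator_le y z : (forall i, `|z 0 i - y 0 i| <= 1) ->
  dominator z <= 3 ^+ N * dominator y.
Proof.
move=> yz; have -> : 3 ^+ N = \prod_(i < N) (3 : R).
  by rewrite prodr_const card_ord.
rewrite /dominator -big_split /=; apply: ler_prod => i _.
rewrite invr_ge0 ltW ?oneDsqr_gt0 //=.
rewrite -[_^-1]mul1r ler_pdivrMr ?oneDsqr_gt0 // mulrAC ler_pdivlMr ?oneDsqr_gt0 //.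
have := yz i; rewrite ler_norml => /andP[h1 h2]; rewrite mul1r.
set a := z 0 i in h1 h2 *; set b := y 0 i in h1 h2 *.
(* The constant 3 comes from 3 (1 + a^2) - (1 + b^2) = 2 (1 - (a - b)^2) + (2 a - b)^2 + a^2. *)
have h3 : 0 <= (a - b + 1) * (1 - (a - b)) by apply: mulr_ge0; lra.
have := sqr_ge0 (2 * a - b); rewrite !expr2; nra.
Qed.

End row_vectors.

(** * Grids and the convergence of Riemann sums *)

Section grid.
Context {R : realType} {N : nat}.
Local Notation T := (sfs_type (lebesgue_space R N)).
Local Notation leb := (sfs_mu (lebesgue_space R N)).

(** The number of cells of mesh 1/(k+1) along one edge of the cube [-(k+1), k+1)^N: the cube
    exhausts the space while the mesh tends to 0. *)
Definition grid_card k := (2 * (k.+1 * k.+1))%N.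

Local Notation grid k := {ffun 'I_N -> 'I_(grid_card k)}.

Definition corner k (q : grid k) : 'rV[R]_N :=
  \row_i ((q i)%:R / k.+1%:R - k.+1%:R).

Definition cell k (q : grid k) : set T :=
  box (corner q 0) (fun i => corner q 0 i + k.+1%:R^-1).

Lemma measurable_cell k (q : grid k) : measurable (cell q).
Proof. exact: measurable_box. Qed.

Lemma lebesgue_cell k (q : grid k) : leb (cell q) = (k.+1%:R^-1 ^+ N)%:E.
Proof.
rewrite lebesgue_box => [|i]; last by rewrite lerDl invr_ge0.
congr EFin; rewrite -[N in _ ^+ N]card_ord -prodr_const.
by apply: eq_bigr => i _; rewrite addrAC subrr add0r.
Qed.

Lemma cell_coord k (q : grid k) t i : cell q t ->
  (q i)%:R <= (rV_of t 0 i + k.+1%:R) * k.+1%:R < (q i).+1%:R.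
Proof.
move=> /(_ i); rewrite /= !mxE => /andP[h1 h2].
have K0 : (0 : R) < k.+1%:R by [].
rewrite -ler_pdivrMr // -ltr_pdivlMr // -[(q i).+1%:R]natr1 mulrDl mul1r.
by rewrite -lerBlDr h1 /= -ltrBrDr addrAC.
Qed.

(** The point determines the cell by integer parts, which makes the cells disjoint. *)
Lemma cell_truncn k (q : grid k) t i : cell q t ->
  q i = Num.truncn ((rV_of t 0 i + k.+1%:R) * k.+1%:R) :> nat.
Proof. by move=> /(cell_coord i) h; rewrite (truncn_def h). Qed.

Lemma cell_inj k (q q' : grid k) t : cell q t -> cell q' t -> q = q'.
Proof.
by move=> qt q't; apply/ffunP => i; apply/val_inj; rewrite /= !(@cell_truncn _ _ t).
Qed.

Lemma cell_dist k (q : grid k) t i : cell q t ->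
  `|corner q 0 i - rV_of t 0 i| <= k.+1%:R^-1.
Proof.
move=> /(_ i) /andP[h1 h2]; rewrite distrC ger0_norm ?subr_ge0 //.
by rewrite lerBlDl ltW.
Qed.

Lemma cell_exists k (t : T) :
  (forall i, `|rV_of t 0 i| < k.+1%:R) -> exists q : grid k, cell q t.
Proof.
move=> tk; have K0 : (0 : R) < k.+1%:R by [].
pose x i : R := (rV_of t 0 i + k.+1%:R) * k.+1%:R.
have x0 i : 0 <= x i.
  by apply: mulr_ge0 => //; have := tk i; rewrite ltr_norml => /andP[]; lra.
have xk i : (Num.truncn (x i) < grid_card k)%N.
  rewrite truncn_lt_nat // /grid_card natrM natrM mulrA ltr_pM2r //.
  by have := tk i; rewrite ltr_norml => /andP[]; lra.
exists [ffun i => Ordinal (xk i)] => i.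
have /andP[h1 h2] := truncn_itv (x0 i).
rewrite mxE ffunE /=; apply/andP; split.
  by rewrite lerBlDr ler_pdivrMr.
move: h2; rewrite -[(Num.truncn _).+1%:R]natr1 /x -ltr_pdivlMr // mulrDl mul1r.
by rewrite -ltrBrDr addrAC.
Qed.

Section grid_simple.
Context {E : lmodType R[i]}.

Lemma cell_finite k (q : grid k) : (leb (cell q) < +oo)%E.
Proof. by rewrite lebesgue_cell ltry. Qed.

Definition grid_simple k (G : 'rV[R]_N -> E) : simple_fun leb E :=
  SimpleFun (fun r : 'I_#|{: grid k}| => G (corner (enum_val r)))
    (fun r => measurable_cell (enum_val r))
    (fun r => cell_finite (enum_val r)).

Definition riemann k (G : 'rV[R]_N -> E) : E :=
  (k.+1%:R^-1 ^+ N)%:C *: \sum_(q : grid k) G (corner q).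

Lemma grid_simple_integral k G : simple_integral (grid_simple k G) = riemann k G.
Proof.
rewrite /simple_integral /= /riemann scaler_sumr [RHS]big_enum_val /=.
by apply: eq_bigr => r _; rewrite lebesgue_cell.
Qed.

Lemma grid_simple_eval k G t : simple_eval (grid_simple k G) t =
  \sum_(q : grid k) (\1_(cell q) t : R)%:C *: G (corner q).
Proof. by rewrite [RHS]big_enum_val. Qed.

Lemma grid_simple_cell k G q t : @cell k q t ->
  simple_eval (grid_simple k G) t = G (corner q).
Proof.
move=> qt; rewrite grid_simple_eval (bigD1 q) //= big1.
  by rewrite indicE mem_set // scale1r addr0.
move=> q' qq'; rewrite indicE memNset ?scale0r // => q't.
by move/eqP: qq'; apply; exact: cell_inj q't qt.
Qed.

Lemma grid_simple_out k G t : (forall q, ~ @cell k q t) ->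
  simple_eval (grid_simple k G) t = 0.
Proof.
move=> nt; rewrite grid_simple_eval big1 // => q _.
by rewrite indicE memNset ?scale0r.
Qed.

Context {p : nat -> E -> R} (fp : frechet p).
Let hp := frechet_seminorms fp.

Definition dominated (g : 'rV[R]_N -> E) :=
  forall j, exists C, forall y, p j (g y) <= C * dominator y.

(* G is constant for the Riemann sums of g, and the difference quotient with the
   mesh as increment when g is a derivative. *)
Variables (G : nat -> 'rV[R]_N -> E) (g : 'rV[R]_N -> E).
(** Convergence is asked along points that move within one mesh width of [y], because the step
    functions evaluate [G k] at the corner of the cell of [y]. *)
Hypothesis Gg : forall (y : 'rV[R]_N) (c : nat -> 'rV[R]_N),
  (forall k i, `|c k 0 i - y 0 i| <= k.+1%:R^-1) ->
  G k (c k) @[k --> \oo] `=>` seminorm_nbhs p (g y).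
Hypothesis domG : forall j, exists C, forall k y, p j (G k y) <= C * dominator y.
Hypothesis domg : dominated g.

Lemma grid_simple_cvg t :
  simple_eval (grid_simple k (G k)) t @[k --> \oo] `=>`
    seminorm_nbhs p (g (rV_of t)).
Proof.
(* Outside the grid the point itself serves as a default, so that [c k] always stays within one mesh
   of [t]; eventually the grid covers [t]. *)
pose c k := match pselect (exists q : grid k, cell q t) with
  | left h => corner (projT1 (cid h)) | right _ => rV_of t end.
apply: (cvg_seminorm_near hp (g := fun k => G k (c k))); last first.
  apply: Gg => k i; rewrite /c; case: pselect => [h|_].
    by case: cid => q /= qt; exact: cell_dist.
  by rewrite subrr normr0 invr_ge0.
have : \forall k \near \oo, forall i, `|rV_of t 0 i| < k.+1%:R.
  exists (Num.truncn (\sum_i `|rV_of t 0 i|)) => // k /= tk i.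
  apply: le_lt_trans (_ : \sum_i `|rV_of t 0 i| < _).
    by rewrite (bigD1 i) //= lerDl sumr_ge0.
  by rewrite -truncn_le_nat.
apply: filterS => k /cell_exists tk; rewrite /c; case: pselect => // h.
by case: cid => q /= qt; exact: grid_simple_cell.
Qed.

Lemma grid_simple_dist_cvg j :
  (\int[leb]_t (p j (g (rV_of t) - simple_eval (grid_simple k (G k)) t))%:E)%E
    @[k --> \oo] --> 0%E.
Proof.
have [C hC] := domG j; have [C' hC'] := domg j.
have C0 : 0 <= C.
  have := le_trans (seminorm_ge0 hp j _) (hC 0%N 0).
  by rewrite pmulr_lge0 // dominator_gt0.
(* The step function is bounded by the dominator at a corner. The corner is at distance at most 1
   from the point in each coordinate, and moving there costs the factor 3^N of [dominator_le]. *)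
pose D := C' + C * 3 ^+ N.
have dom k t : p j (g (rV_of t) - simple_eval (grid_simple k (G k)) t) <=
    D * dominator (rV_of t).
  apply: le_trans (seminormB hp _ _ _) _; rewrite mulrDl lerD // -mulrA.
  have [[q qt]|nq] := pselect (exists q : grid k, cell q t).
    rewrite (grid_simple_cell _ qt); apply: le_trans (hC _ _) _.
    apply: ler_wpM2l => //; apply: dominator_le => i.
    by apply: le_trans (cell_dist i qt) _; rewrite invf_le1 // ler1n.
  rewrite grid_simple_out => [|q qt]; last by apply: nq; exists q.
  by rewrite (seminorm0 hp) mulr_ge0 // mulr_ge0 // ?exprn_ge0 // ltW // dominator_gt0.
rewrite -[X in _ --> X](@integral0 _ _ _ leb setT).
apply: (@dominated_cvg _ _ _ leb setT measurableT _ _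
    (fun t => (D * dominator (rV_of t))%:E)).
- move=> k; apply/measurable_EFinP.
  exact: (measurable_seminorm_dist hp _ j grid_simple_cvg).
- move=> t _; have /(cvg_EFin_seminorm hp j) := @grid_simple_cvg t.
  by under eq_fun do rewrite (seminorm_distC hp).
- by [].
- have -> : (fun t => (D * dominator (rV_of t))%:E) =
      (fun t : T => D%:E * (dominator (rV_of t))%:E)%E.
    by apply/funext => t; rewrite EFinM.
  apply: integrableZl => //; apply/integrableP; split.
    exact/measurable_EFinP/measurable_dominator.
  under eq_integral do rewrite abse_EFin ger0_norm ?ltW ?dominator_gt0 //.
  exact: integral_dominator.
- by move=> k t _; rewrite abse_EFin lee_fin ger0_norm ?(seminorm_ge0 hp).
Qed.

Lemma grid_integral : exists2 v, is_lebesgue_integral p g v &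
  riemann k (G k) @[k --> \oo] `=>` seminorm_nbhs p v.
Proof.
have [v gv sv] := is_integral_simple hp fp grid_simple_cvg grid_simple_dist_cvg.
exists v => //; move: sv; under eq_fun do rewrite grid_simple_integral.
by [].
Qed.

End grid_simple.

Arguments dominated {E} p g.

Section riemann.
Context {E : lmodType R[i]} {p : nat -> E -> R} (fp : frechet p).
Let hp := frechet_seminorms fp.
Implicit Types g : 'rV[R]_N -> E.

Lemma cvg_corner (y : 'rV[R]_N) (c : nat -> 'rV[R]_N) :
  (forall k i, `|c k 0 i - y 0 i| <= k.+1%:R^-1) -> c @ \oo --> y.
Proof.
move=> cy A /nbhs_rowP[e e0 yA].
have /cvgrPdist_lt/(_ e e0) := @cvg_harmonic R.
apply: filterS => k; rewrite sub0r normrN ger0_norm ?invr_ge0 // => ke.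
by apply: yA => i; apply: le_lt_trans ke.
Qed.

Lemma riemann_integral g : seminorm_continuous p g -> dominated p g ->
  exists2 v, is_lebesgue_integral p g v &
    riemann k g @[k --> \oo] `=>` seminorm_nbhs p v.
Proof.
move=> cg dg; apply: (grid_integral fp (G := fun=> g)) => // [y c cy|j].
  by move=> A /cg /(cvg_corner cy).
by have [C gC] := dg j; exists C.
Qed.

Lemma riemann_cvg g v : seminorm_continuous p g -> dominated p g ->
  is_lebesgue_integral p g v ->
  riemann k g @[k --> \oo] `=>` seminorm_nbhs p v.
Proof.
move=> cg dg gv; have [w gw rw] := riemann_integral cg dg.
by rewrite (is_integral_unique hp gv gw).
Qed.

Lemma riemann_lin k (a : R[i]) f g :
  riemann k (fun y => a *: f y + g y) = a *: riemann k f + riemann k g.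
Proof.
by rewrite /riemann big_split /= -scaler_sumr scalerDr !scalerA mulrC.
Qed.

Lemma lebesgue_integral_bound g v j C :
  is_lebesgue_integral p g v ->
  (forall y, p j (g y) <= C * dominator y) ->
  p j v <= C * fine (\int[leb]_t (dominator (rV_of t))%:E)%E.
Proof.
move=> gv gC; apply: (is_integral_bound hp gv).
have [s [sg _ _]] := gv.
have C0 : 0 <= C.
  have := le_trans (seminorm_ge0 hp j _) (gC 0).
  by rewrite pmulr_lge0 // dominator_gt0.
have d0 (t : T) : (0 <= (dominator (rV_of t))%:E)%E.
  by rewrite lee_fin ltW // dominator_gt0.
have md : measurable_fun setT (fun t : T => (dominator (rV_of t))%:E).
  exact (proj2 (measurable_EFinP _ _) (@measurable_dominator R N)).
rewrite EFinM fineK; last first.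
  by rewrite ge0_fin_numE ?integral_dominator // integral_ge0.
rewrite -ge0_integralZl_EFin //.
apply: ge0_le_integral => //.
- by move=> t _; rewrite lee_fin (seminorm_ge0 hp).
- apply/measurable_EFinP; have := measurable_seminorm_limit hp 0 j sg.
  by under [X in measurable_fun _ X -> _]eq_fun do rewrite subr0.
- exact: measurable_funeM.
- by move=> t _; rewrite -EFinM lee_fin; exact: gC.
Qed.

End riemann.
End grid.

Arguments dominated {R N E} p g.
Arguments riemann {R N E} k G.

(** * Integration by parts *)

Section mean_value.
Context {R : realType}.

(* By the supremum of the points up to which the bound holds. *)
Lemma interval_subadditive_le (Q : R -> R -> R) (a b M : R) : a <= b ->
  (forall x y z, a <= x -> x <= y -> y <= z -> z <= b ->
     Q x z <= Q x y + Q y z) ->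
  (forall c, a <= c <= b -> exists2 e, 0 < e & forall s t,
     a <= s -> s <= c -> c <= t -> t <= b -> c - e < s -> t < c + e ->
     Q s t <= M * (t - s)) ->
  Q a b <= M * (b - a).
Proof.
move=> ab Qadd Qloc.
pose S := [set t | a <= t <= b /\ Q a t <= M * (t - a)].
have Sa : S a.
  split; first by rewrite lexx.
  have [|e e0 he] := Qloc a; first by rewrite lexx.
  by apply: he => //; rewrite ?ltrBlDr ltrDl.
have ubS : ubound S b by move=> t [/andP[]].
have supS : has_sup S by split; [exists a | exists b].
have ac : a <= sup S by apply: ub_le_sup => //; exists b.
have cb : sup S <= b by apply: ge_sup => //; exists a.
have [|e e0 he] := Qloc (sup S); first by rewrite ac.
have [s [/andP[as_ sb] Qs] cs] := sup_adherent e0 supS.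
have sc : s <= sup S.
  by apply: ub_le_sup; [exists b | split => //; rewrite as_].
pose t := Num.min b (sup S + e / 2).
have e2 : 0 < e / 2 by rewrite divr_gt0.
have ct : sup S <= t by rewrite le_min cb lerDl ltW.
have tb : t <= b by rewrite ge_min lexx.
have St : S t.
  split; first by rewrite tb (le_trans ac ct).
  apply: le_trans (Qadd a s t _ _ _ _) _ => //; first exact: le_trans ct.
  have -> : M * (t - a) = M * (s - a) + M * (t - s) by ring.
  apply: lerD => //; apply: he => //.
  rewrite gt_min; apply/orP; right; rewrite ltrD2l; lra.
have tc : t <= sup S by apply: ub_le_sup => //; exists b.
suff tE : t = b by move: St => []; rewrite tE.
apply/eqP; rewrite eq_le tb /=; move: tc; rewrite /t ge_min => /orP[bc|]; last lra.
by rewrite le_min lexx /= (le_trans bc) // lerDl ltW.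
Qed.

Context {N : nat} {E : lmodType R[i]} {p : nat -> E -> R} (hp : seminorms p).

Lemma line_lineD (y : 'rV[R]_N) i (s t : R) :
  y + s *: delta_mx 0 i + (t - s) *: delta_mx 0 i = y + t *: delta_mx 0 i.
Proof. by rewrite -addrA -scalerDl [s + _]addrC subrK. Qed.

(** The seminorm of the increment of g - t l is subadditive in the interval, which replaces a mean
    value equality. The free vector [l] serves twice: with the value of the derivative at a point
    for the convergence of difference quotients, and with 0 for their boundedness. *)
Lemma mean_value_le (g g' : 'rV[R]_N -> E) (i : 'I_N) y j l (M b : R) : 0 <= b ->
  (forall z, is_pderiv p i g z (g' z)) ->
  (forall t, 0 <= t <= b -> p j (g' (y + t *: delta_mx 0 i) - l) <= M) ->
  p j (g (y + b *: delta_mx 0 i) - g y - b%:C *: l) <= M * b.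
Proof.
move=> b0 gg' gM; apply/ler_addgt0Pr => e e0.
pose z t := y + t *: delta_mx 0 i.
pose Q s t := p j (g (z t) - g (z s) - (t - s)%:C *: l).
(* The slack in the slope is chosen so that over length [b] it adds up to at most [e]. *)
pose e' := e / (b + 1).
have e'0 : 0 < e' by rewrite divr_gt0 // ltr_wpDl.
have zz s t : z s + (t - s) *: delta_mx 0 i = z t by exact: line_lineD.
have : Q 0 b <= (M + e') * (b - 0).
  apply: interval_subadditive_le => // [x1 x2 x3 _ _ _ _|c cb].
    rewrite /Q; apply: le_trans (seminormD hp _ _ _).
    rewrite le_eqVlt; apply/orP; left; apply/eqP; congr (p j _).
    have -> : x3 - x1 = (x2 - x1) + (x3 - x2) by ring.
    rewrite rmorphD /= scalerDl opprD [RHS]addrACA; congr (_ + _).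
    by rewrite [RHS]addrC subrKA.
  (* The derivative controls increments that start at [c], on either side; an interval around [c] is
     cut there. *)
  have [d d0 hd] : exists2 d, 0 < d & forall h, `|h| < d ->
      p j (g (z c + h *: delta_mx 0 i) - g (z c) - h%:C *: l) <= (M + e') * `|h|.
    have /(cvg_seminormP hp)/(_ j)/cvgrPdist_lt/(_ e' e'0) := gg' (z c).
    rewrite /dnbhs /within /= => /nbhs_ballP[d d0 hd]; exists d => // h hh.
    have [->|h0] := eqVneq h 0.
      by rewrite scale0r addr0 subrr scale0r subr0 (seminorm0 hp) normr0 mulr0.
    have := hd h; rewrite /ball /= !sub0r !normrN => /(_ hh h0).
    rewrite ger0_norm ?(seminorm_ge0 hp) // => hq.
    have -> : g (z c + h *: delta_mx 0 i) - g (z c) - h%:C *: l =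
       h%:C *: ((h^-1)%:C *: (g (z c + h *: delta_mx 0 i) - g (z c)) - g' (z c))
       + h%:C *: (g' (z c) - l).
      rewrite [_ *: (_ - g' (z c))]scalerBr [_ *: (g' (z c) - l)]scalerBr subrKA.
      by rewrite scalerA -rmorphM /= mulfV // scale1r.
    apply: le_trans (seminormD hp _ _ _) _.
    rewrite !(seminormZ hp) normc_real -mulrDr mulrC ler_wpM2r // addrC.
    by apply: lerD; [exact: gM|exact: ltW].
  exists d => // s t s0 sc ct tb ds td.
  apply: le_trans (_ : (M + e') * (c - s) + (M + e') * (t - c) <= _); last first.
    by rewrite -mulrDr (addrC (c - s)) subrKA.
  apply: le_trans (_ : Q s c + Q c t <= _).
    rewrite /Q; apply: le_trans (seminormD hp _ _ _).
    rewrite le_eqVlt; apply/orP; left; apply/eqP; congr (p j _).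
    have -> : t - s = (c - s) + (t - c) by ring.
    rewrite rmorphD /= scalerDl opprD [RHS]addrACA; congr (_ + _).
    by rewrite [RHS]addrC subrKA.
  apply: lerD; rewrite /Q.
    have := hd (s - c); rewrite zz ler0_norm ?subr_le0 // opprB.
    have -> : (s - c)%:C = - (c - s)%:C :> R[i] by rewrite -rmorphN opprB.
    rewrite scaleNr opprK -(seminormN hp) opprD opprB; apply; lra.
  have := hd (t - c); rewrite zz ger0_norm ?subr_ge0 //; apply; lra.
rewrite /Q /z scale0r addr0 subr0 => /le_trans; apply.
rewrite mulrDl lerD2l /e' mulrAC ler_pdivrMr ?ltr_wpDl //.
by rewrite mulrDr mulr1 lerDl ltW.
Qed.

End mean_value.

Section integral_of_derivative.
Context {R : realType} {N : nat} {E : lmodType R[i]}.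
Context {p : nat -> E -> R} (fp : frechet p).
Let hp := frechet_seminorms fp.
Implicit Types (i l : 'I_N) (y : 'rV[R]_N).

(** On the cube of half-side [r] the dominator is at least (1 + r^2)^-N. *)
Lemma dominated_bounded_support (g : 'rV[R]_N -> E) j (B r : R) y :
  p j (g y) <= B -> (forall i, r < `|y 0 i| -> g y = 0) ->
  p j (g y) <= B * (1 + r ^+ 2) ^+ N * dominator y.
Proof.
move=> gB g0.
have B0 : 0 <= B := le_trans (seminorm_ge0 hp j _) gB.
have [/existsP[i ri]|/existsPn yr] := boolP [exists i, r < `|y 0 i|].
  rewrite (g0 i ri) (seminorm0 hp) !mulr_ge0 //.
    by rewrite exprn_ge0 // ltW // oneDsqr_gt0.
  by rewrite ltW // dominator_gt0.
apply: le_trans gB _; rewrite -mulrA ler_peMr //.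
rewrite -[N in _ ^+ N]card_ord -prodr_const /dominator -big_split /=.
rewrite -[X in X <= _](_ : \prod_(i < N) (1 : R) = 1); last by rewrite big1.
apply: ler_prod => i _; rewrite ler01 /= ler_pdivlMr ?oneDsqr_gt0 // mul1r lerD2l.
have := yr i; rewrite -leNgt => ri.
by rewrite -[y 0 i ^+ 2]real_normK ?num_real // lerXn2r ?nnegrE // (le_trans _ ri).
Qed.

Lemma line_dist (y : 'rV[R]_N) i (t : R) k :
  `|(y + t *: delta_mx 0 i) 0 k - y 0 k| <= `|t|.
Proof.
rewrite line_coord addrAC subrr add0r.
by case: (k == i); rewrite ?mulr1n // mulr0n normr0.
Qed.

Local Notation grid k := {ffun 'I_N -> 'I_(grid_card k)}.

(** Cyclic, so that a translation by one mesh becomes a permutation of the cells. *)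
Definition grid_rot k (i : 'I_N) (q : grid k) : grid k :=
  [ffun l => if l == i then ordS (q l) else q l].

Lemma grid_rot_inj k i : injective (@grid_rot k i).
Proof.
move=> q q' qq'; apply/ffunP => l; move/ffunP/(_ l): qq'; rewrite !ffunE.
by case: (l == i) => // /ordS_inj.
Qed.

(** When the index wraps around, the translated corner and the permuted one lie on opposite faces of
    the cube; a function supported in the interior vanishes at both. *)
Lemma corner_rot k i (q : grid k) :
  corner q + k.+1%:R^-1 *: delta_mx 0 i = corner (grid_rot i q) :> 'rV[R]_N \/
  (corner q + k.+1%:R^-1 *: delta_mx 0 i) 0 i = k.+1%:R :> R /\
  corner (grid_rot i q) 0 i = - k.+1%:R :> R.
Proof.
have K0 : (k.+1%:R : R) != 0 by [].
have [qi|qi] := eqVneq (q i).+1 (grid_card k).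
  right; split; last by rewrite mxE ffunE eqxx /= qi modnn mul0r sub0r.
  rewrite line_coord mxE eqxx mulr1n addrAC -[X in _ + X - _]mul1r -mulrDl natr1 qi.
  by rewrite /grid_card natrM natrM mulrA mulfK //; ring.
left; apply/rowP => l; rewrite line_coord !mxE ffunE.
case: eqP => [->|_]; last by rewrite mulr0n addr0.
rewrite mulr1n /= modn_small; last by rewrite ltn_neqAle qi ltn_ord.
by rewrite -[(q i).+1%:R]natr1 mulrDl mul1r addrAC.
Qed.

Lemma riemann_shift k i (g : 'rV[R]_N -> E) (r : R) : r < k.+1%:R ->
  (forall y l, r < `|y 0 l| -> g y = 0) ->
  riemann k (fun y => g (y + k.+1%:R^-1 *: delta_mx 0 i)) = riemann k g.
Proof.
move=> rk g0; rewrite /riemann; congr (_ *: _).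
rewrite [RHS](reindex_inj (@grid_rot_inj k i)) /=; apply: eq_bigr => q _.
have [->//|[h1 h2]] := corner_rot i q.
by rewrite !(g0 _ i) // ?h1 ?h2 ?normrN ger0_norm.
Qed.

Lemma integral_pderiv (g g' : 'rV[R]_N -> E) i (r : R) : 0 <= r ->
  (forall y, is_pderiv p i g y (g' y)) -> seminorm_continuous p g' ->
  (forall y l, r < `|y 0 l| -> g y = 0) ->
  (forall y l, r < `|y 0 l| -> g' y = 0) ->
  (forall j, exists B, forall y, p j (g' y) <= B) ->
  is_lebesgue_integral p g' 0.
Proof.
move=> r0 gg' cg' g0 g'0 bg'.
pose G k y := (k.+1%:R)%:C *: (g (y + k.+1%:R^-1 *: delta_mx 0 i) - g y).
have mv k y j x (M : R) :
    (forall t, 0 <= t <= k.+1%:R^-1 -> p j (g' (y + t *: delta_mx 0 i) - x) <= M) ->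
    p j (G k y - x) <= M.
  move=> hM.
  have K0 : (k.+1%:R : R) != 0 by [].
  have -> : G k y - x = (k.+1%:R)%:C *:
      (g (y + k.+1%:R^-1 *: delta_mx 0 i) - g y - (k.+1%:R^-1)%:C *: x).
    by rewrite scalerBr scalerA -rmorphM /= mulfV // scale1r.
  rewrite (seminormZ hp) normc_real ger0_norm // mulrC -ler_pdivlMr //.
  by apply: (mean_value_le hp) => //; rewrite invr_ge0.
have [v g'v Gv] : exists2 v, is_lebesgue_integral p g' v &
    riemann k (G k) @[k --> \oo] `=>` seminorm_nbhs p v.
  apply: (grid_integral fp).
  - move=> y c cy; apply/(cvg_seminormP hp) => j; apply/cvgrPdist_le => e e0.
    have := proj1 (cvg_seminormP (FF := nbhs_filter y) hp _ _) (cg' y) j.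
    move=> /cvgrPdist_le/(_ e e0)/nbhs_rowP[d d0 hd].
    (* Half of [d] pays for the distance from [y] to the corner, the other half for the increment
       along the line. *)
    have /cvgrPdist_lt/(_ (d / 2)) := @cvg_harmonic R.
    rewrite divr_gt0 // => /(_ isT); apply: filterS => k.
    rewrite sub0r normrN ger0_norm ?invr_ge0 // => kd.
    rewrite sub0r normrN ger0_norm ?(seminorm_ge0 hp) //.
    apply: mv => t /andP[t0 tk].
    have := hd (c k + t *: delta_mx 0 i).
    rewrite sub0r normrN ger0_norm ?(seminorm_ge0 hp) //; apply => l.
    have -> : (c k + t *: delta_mx 0 i) 0 l - y 0 l =
      ((c k + t *: delta_mx 0 i) 0 l - c k 0 l) + (c k 0 l - y 0 l).
      by rewrite subrKA.
    apply: le_lt_trans (ler_normD _ _) _.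
    rewrite [d]splitr; apply: ler_ltD; last exact: le_lt_trans (cy k l) kd.
    apply: le_trans (line_dist _ _ _ _) _; rewrite ger0_norm //.
    exact/(le_trans tk)/ltW.
  (* The difference quotient enlarges the support by one mesh, hence by at most 1. *)
  - move=> j; have [B gB] := bg' j; exists (B * (1 + (r + 1) ^+ 2) ^+ N) => k y.
    apply: dominated_bounded_support.
      rewrite -[G k y]subr0; apply: mv => t _; rewrite subr0; exact: gB.
    move=> l ry; rewrite /G (g0 y l) ?(g0 _ l) ?subrr ?scaler0 //.
      have := line_dist y i k.+1%:R^-1 l.
      rewrite [`|_^-1|]ger0_norm ?invr_ge0 // distrC => yl.
      have k1 : k.+1%:R^-1 <= 1 :> R by rewrite invf_le1 // ler1n.
      have {yl k1} := le_trans yl k1.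
      have := ler_normD (y 0 l - (y + k.+1%:R^-1 *: delta_mx 0 i) 0 l)
        ((y + k.+1%:R^-1 *: delta_mx 0 i) 0 l).
      rewrite subrK; move: ry; set a := `|_|; set b := `|_|; set c := `|_|; lra.
    by apply: lt_trans ry; rewrite ltrDl.
  - move=> j; have [B gB] := bg' j; exists (B * (1 + r ^+ 2) ^+ N) => y.
    by apply: dominated_bounded_support => // l; exact: g'0.
suff v0 : v = 0 by rewrite -v0.
apply: (cvg_seminorm_unique hp Gv).
apply: (cvg_seminorm_near hp _ (cvg_seminorm_cst hp 0)).
(* As soon as r < k+1 the Riemann sums are exactly 0. *)
exists (Num.truncn r) => // k /= rk.
rewrite /riemann -scaler_sumr sumrB scalerA mulrC -scalerA scalerBr.
have := riemann_shift i _ g0; rewrite /riemann => ->; last by rewrite -truncn_le_nat.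
by rewrite subrr scaler0.
Qed.

End integral_of_derivative.

(** * Oscillation operators *)

Section oscillation_operators.
Context {R : realType} {d : nat} (a0 : R) (a0_neq0 : a0 != 0).
Context {E : lmodType R[i]} {p : nat -> E -> R} (hp : seminorms p).
Local Notation N := (d + d)%N.
Implicit Types (i j : 'I_N) (y : 'rV[R]_N) (f g : 'rV[R]_N -> E).

(** The triple [(c, e, s)] stands for the operator [c * osc_mon e] times the derivative along [s].
    Operators are kept as lists of such triples so that exponents and sequences can be followed by
    induction. *)
Definition osc_term : Type := R[i] * {ffun 'I_N -> nat} * seq 'I_N.
Implicit Types (t : osc_term) (l : seq osc_term).

Definition osc_op l f y : E :=
  \sum_(t <- l) (t.1.1 * osc_mon t.1.2 y) *: foldr (pderiv p) f t.2 y.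

Definition incr (e : {ffun 'I_N -> nat}) i : {ffun 'I_N -> nat} :=
  [ffun j => (e j + (j == i))%N].

Let b : R[i] := (2 * a0)%:C^-1.

(* The term-by-term expansion of g |-> u (g - b D_i g), where u is
   (1 + i y_(conj_index i))^-1. *)
Definition osc_step_term i t : seq osc_term :=
  let: (c, e, s) := t in let e' := incr e (conj_index i) in
  [:: (c, e', s); (b * I * (e i)%:R * c, incr e' i, s); (- b * c, e', i :: s)].

Definition osc_step i l : seq osc_term := flatten (map (osc_step_term i) l).

Lemma osc_mon_incr e i y : osc_mon (incr e i) y = osc_inv i y * osc_mon e y.
Proof.
rewrite /osc_mon (bigD1 i) //= [in RHS](bigD1 i) //= ffunE eqxx addn1 exprS.
rewrite mulrA; congr (_ * _); apply: eq_bigr => j /negPf ji.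
by rewrite ffunE ji addn0.
Qed.

Lemma smooth_osc_op l f : smooth p f -> smooth p (osc_op l f).
Proof.
move=> sf; elim: l => [|t l IH].
  by apply: smooth_ext (smooth_cst hp 0) => y; rewrite /osc_op big_nil.
apply: (smooth_ext (g := fun y => (t.1.1 * osc_mon t.1.2 y) *:
   foldr (pderiv p) f t.2 y + osc_op l f y)).
  by move=> y; rewrite /osc_op big_cons.
apply: (smoothD hp _ IH); apply: (smoothM hp); last exact (smooth_foldr t.2 sf).
exact (smoothZ (@absC_seminorms R) t.1.1 (smooth_osc_mon t.1.2)).
Qed.

Lemma osc_op_lin l (a : R[i]) f g y : smooth p f -> smooth p g ->
  osc_op l (fun y => a *: f y + g y) y = a *: osc_op l f y + osc_op l g y.
Proof.
move=> sf sg; rewrite /osc_op scaler_sumr -big_split /=; apply: eq_bigr => t _.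
by rewrite (foldr_pderiv_lin hp) // scalerDr !scalerA (mulrC a).
Qed.

Lemma osc_op_seminorm l f y (j : nat) : p j (osc_op l f y) <=
  \sum_(t <- l) normc t.1.1 * normc (osc_mon t.1.2 y) *
                p j (foldr (pderiv p) f t.2 y).
Proof.
apply: le_trans (seminorm_sum hp _ _ _ _) _; apply: ler_sum => t _.
by rewrite (seminormZ hp) Normc.normcM.
Qed.

Lemma osc_op_step_term i t f y : osc_op (osc_step_term i t) f y =
  osc_inv (conj_index i) y *: ((t.1.1 * osc_mon t.1.2 y) *:
     (foldr (pderiv p) f t.2 y - b *: foldr (pderiv p) f (i :: t.2) y)
   + (b * I * (t.1.2 i)%:R * osc_inv i y * t.1.1 * osc_mon t.1.2 y) *:
       foldr (pderiv p) f t.2 y).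
Proof.
case: t => [[c e] s]; rewrite /osc_op /osc_step_term !big_cons big_nil /=.
rewrite !osc_mon_incr scalerDr scalerBr scalerBr !scalerA addr0 addrA addrAC.
rewrite -scaleNr; congr (_ *: _ + _ *: _ + _ *: _); ring.
Qed.

Lemma osc_op_step i l f y : osc_op (osc_step i l) f y =
  \sum_(t <- l) osc_op (osc_step_term i t) f y.
Proof. by rewrite /osc_op /osc_step big_flatten big_map. Qed.

Let b_neq0 : b != 0.
Proof.
by rewrite invr_eq0 eq_complex /= eqxx andbT mulf_neq0 // pnatr_eq0.
Qed.

Let bK : b^-1 = (2 * a0)%:C.
Proof. exact: invrK. Qed.

(** The phase contributes b^-1 i y' u, with u the factor [osc_inv (conj_index i)] and y' the
    conjugate coordinate; by [osc_invE] this is b^-1 (1 - u). The 1 gives the term itself, and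
    everything else is collected in [osc_step_term]. *)
Lemma is_pderiv_osc_term i t f y : smooth p f ->
  is_pderiv p i
    (fun z => (phase a0 z * osc_inv (conj_index i) z) *:
      ((t.1.1 * osc_mon t.1.2 z) *: foldr (pderiv p) f t.2 z)) y
    (b^-1 *: (phase a0 y *: ((t.1.1 * osc_mon t.1.2 y) *: foldr (pderiv p) f t.2 y
       - osc_op (osc_step_term i t) f y))).
Proof.
move=> sf.
set u := osc_inv (conj_index i); set m := osc_mon t.1.2; set c := t.1.1.
pose C z := phase a0 z * u z * (c * m z).
(* The logarithmic derivative of the coefficient: one summand from the phase, one from [osc_mon],
   none from [osc_inv (conj_index i)]. *)
pose lam := (2 * a0)%:C * I * (y 0 (conj_index i))%:C - I *+ t.1.2 i * osc_inv i y.
have dC : is_pderiv absC i C y (lam * C y).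
  have du := is_pderiv_osc_inv i (conj_index i) y.
  rewrite conj_index_neq mul0r in du.
  have dpu := is_pderivM (@absC_seminorms R) (is_pderiv_phase a0 i y) du.
  have dm := is_pderivZ (@absC_seminorms R) c (is_pderiv_osc_mon t.1.2 i y).
  rewrite (_ : lam * C y =
    (((2 * a0)%:C * I * (y 0 (conj_index i))%:C * phase a0 y) *: u y +
      phase a0 y *: 0) *: (c *: m y) +
    (phase a0 y * u y) *: (c *: (- I *+ t.1.2 i * osc_inv i y * m y))).
    exact (is_pderivM (@absC_seminorms R) dpu dm).
  by rewrite /GRing.scale /= /lam /C mulNrn; ring.
under eq_fun do rewrite scalerA -/(C _).
set Df := foldr (pderiv p) f t.2.
rewrite (_ : b^-1 *: _ = (lam * C y) *: Df y + C y *: pderiv p i Df y).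
  exact (is_pderivM hp dC (smooth_is_pderiv hp i y (smooth_foldr t.2 sf))).
rewrite osc_op_step_term -/u -/m -/c -/Df /=.
rewrite (_ : _ *: Df y - _ = (c * m y * (1 - u y) - u y * (b * I * (t.1.2 i)%:R *
    osc_inv i y * c * m y)) *: Df y + (u y * (c * m y) * b) *: pderiv p i Df y).
  have bb : b^-1 * b = 1 by rewrite mulVf.
  rewrite scalerDr scalerDr !scalerA; congr (_ *: _ + _ *: _).
    rewrite -osc_invE -/u /lam /C -[I *+ _]mulr_natr.
    transitivity (b^-1 * (phase a0 y * (c * m y * (I * (y 0 (conj_index i))%:C * u y)))
      - (b^-1 * b) * (phase a0 y * u y * I * (t.1.2 i)%:R * osc_inv i y * c * m y)).
      by ring.
    by rewrite bb bK; ring.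
  transitivity ((b^-1 * b) * (phase a0 y * u y * (c * m y))).
    by ring.
  by rewrite bb /C mul1r.
rewrite [u y *: _]scalerDr [(c * m y) *: (_ - _)]scalerBr [u y *: (_ - _)]scalerBr.
rewrite !scalerA !opprD !opprK addrA addrA addrAC -scalerBl -scalerBl.
congr (_ *: _ + _ *: _); ring.
Qed.

Arguments is_pderiv_osc_term i t [f] y _ _ _.

Lemma is_pderiv_osc_op i l f y : smooth p f ->
  is_pderiv p i
    (fun z => (phase a0 z * osc_inv (conj_index i) z) *: osc_op l f z) y
    (b^-1 *: (phase a0 y *: osc_op l f y - phase a0 y *: osc_op (osc_step i l) f y)).
Proof.
move=> sf; rewrite osc_op_step -scalerBr -[X in X - _]/(\sum_(t <- l) _) -sumrB.
rewrite !scaler_sumr.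
under eq_fun do rewrite scaler_sumr.
exact (is_pderiv_sum hp l (fun t => is_pderiv_osc_term i t y sf)).
Qed.

(** Of a step only two facts are retained: the exponent of the conjugate coordinate grows while none
    decreases, and at most one derivation is put in front. *)
Lemma osc_step_mem i l t' : t' \in osc_step i l -> exists2 t, t \in l &
  (forall j, (t.1.2 j + (j == conj_index i) <= t'.1.2 j)%N) /\
  (t'.2 = t.2 \/ t'.2 = i :: t.2).
Proof.
move=> /flattenP[_ /mapP[t tl ->]] t't; exists t => //.
case: t t't {tl} => [[c e] s]; rewrite !inE => /or3P[] /eqP -> /=.
- by split=> [j|]; [rewrite ffunE|left].
- by split=> [j|]; [rewrite !ffunE leq_addr|left].
- by split=> [j|]; [rewrite ffunE|right].
Qed.

Lemma osc_iter_mem K i l t' : t' \in iter K (osc_step i) l ->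
  exists2 t, t \in l &
  (forall j, (t.1.2 j + K * (j == conj_index i) <= t'.1.2 j)%N) /\
  exists m, t'.2 = nseq m i ++ t.2.
Proof.
elim: K t' => [|K IH] t' /=.
  by exists t' => //; split=> [j|]; [rewrite mul0n addn0|exists 0%N].
move=> /osc_step_mem[t1 /IH[t tl [te [m tm]]] [t1e t1s]]; exists t => //.
split=> [j|].
  by apply: leq_trans (t1e j); rewrite mulSn addnCA addnC leq_add2r.
case: t1s => ->; rewrite tm; first by exists m.
by exists m.+1.
Qed.

(** [foldr] lets the largest index act first, so that later steps prepend smaller ones and the
    sequences stay sorted. *)
Definition osc_terms K : seq osc_term :=
  foldr (fun i => iter K (osc_step i)) [:: (1, [ffun=> 0%N], [::])] (enum 'I_N).

(** Every exponent is reached because [conj_index] is an involution: the [K] steps in direction i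
    raise the exponent of the conjugate coordinate. *)
Lemma osc_terms_mem K t : t \in osc_terms K ->
  (forall j, (K <= t.1.2 j)%N) /\ t.2 = multi_seq [ffun i => count_mem i t.2].
Proof.
move=> tK.
(* Strengthened for an induction on the list of directions: that the derivations occurring are among
   those already treated is what keeps the sequence sorted when a smaller index is prepended. *)
suff [ht [ss _]] : (forall j, j \in enum 'I_N -> (K <= t.1.2 (conj_index j))%N) /\
    pairwise (fun i j : 'I_N => (i <= j)%N) t.2 /\ {subset t.2 <= enum 'I_N}.
  split=> [j|]; first by rewrite -[j]conj_indexK ht ?mem_enum.
  by apply/sorted_multi_seq; rewrite (sorted_pairwise (@le_ord_trans N)).
have := @pairwise_enum_ord N.
move: t tK; rewrite /osc_terms; elim: (enum _) => [|i r IH] t /=.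
  by rewrite inE => /eqP ->.
move=> /osc_iter_mem[t' /IH{}IH [te [m tm]]] /andP[/allP ir /IH[h1 [h2 h3]]].
split=> [j|].
  rewrite inE => /orP[/eqP ->|/h1 jr].
    by apply: leq_trans (te _); rewrite eqxx muln1 leq_addl.
  by apply: leq_trans (te _); rewrite (leq_trans jr) // leq_addr.
rewrite tm; split=> [|j]; last first.
  by rewrite mem_cat inE => /orP[/nseqP[-> _]|/h3 ->]; rewrite ?eqxx ?orbT.
by apply: pairwise_nseq_cat => //; apply/allP => j /h3; exact: ir.
Qed.

End oscillation_operators.

Arguments osc_op {R d E} p l f y.
Arguments osc_terms {R d} a0 K.

(** * The extended functional *)

Section weights.
Context {R : realType} {N : nat}.
Implicit Types (y : 'rV[R]_N) (mu : 'rV[R]_N -> R).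

Definition bracket y D : R := \prod_(j < N) (1 + y 0 j ^+ 2) ^+ D.

Lemma bracket_ge1 y D : 1 <= bracket y D.
Proof.
rewrite -[X in X <= _](_ : \prod_(i < N) (1 : R) = 1); last by rewrite big1.
by apply: ler_prod => i _; rewrite ler01 exprn_ege1 // lerDl sqr_ge0.
Qed.

Lemma bracketD y D D' : bracket y (D + D') = bracket y D * bracket y D'.
Proof. by rewrite -big_split /=; apply: eq_bigr => j _; rewrite exprD. Qed.

(** D of the factors absorb polynomial growth, and one is left for integrability. *)
Lemma bracket_dominator y D :
  dominator y ^+ D.+1 * bracket y D = dominator y.
Proof.
rewrite /dominator /bracket -prodrXl -big_split /=; apply: eq_bigr => j _.
rewrite exprSr mulrAC -exprMn mulVf ?expr1n ?mul1r //.
by rewrite gt_eqF // oneDsqr_gt0.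
Qed.

(** Since |x| <= 1 + x^2, a monomial is at most the bracket whose exponent is its total degree;
    adding exponents is harmless because brackets are at least 1. *)
Lemma poly_bounded_bracket mu : poly_bounded mu ->
  exists C D, 0 <= C /\ forall y, mu y <= C * bracket y D.
Proof.
move=> [P muP].
suff [C [D [C0 CP]]] : exists C D, 0 <= C /\ forall y,
    \sum_(t <- P) t.1 * \prod_(i < N) y 0 i ^+ t.2 i <= C * bracket y D.
  by exists C, D; split => // y; exact: le_trans (muP y) (CP y).
elim: P {muP} => [|[c a] P [C [D [C0 IH]]]].
  by exists 0, 0%N; split => // y; rewrite big_nil mul0r.
exists (`|c| + C), ((\sum_i a i) + D)%N; split; first exact: addr_ge0.
move=> y; rewrite big_cons bracketD mulrDl /=; apply: lerD.
  apply: le_trans (ler_norm _) _; rewrite normrM; apply: ler_wpM2l => //.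
  rewrite normr_prod -[X in X <= _]mulr1; apply: ler_pM => //.
  - exact: prodr_ge0.
  - apply: ler_prod => i _; rewrite normr_ge0 normrX /=.
    apply: le_trans (_ : (1 + y 0 i ^+ 2) ^+ a i <= _).
      apply: lerXn2r; rewrite ?nnegrE ?(ltW (oneDsqr_gt0 _)) //.
      rewrite -[y 0 i ^+ 2]real_normK ?num_real //.
      have := sqr_ge0 (`|y 0 i| - 1); rewrite sqrrB expr1n mulr1.
      have := normr_ge0 (y 0 i); set x := `|_|; rewrite mulr2n; lra.
    by rewrite ler_weXn2l ?lerDl ?sqr_ge0 // (bigD1 i) //= leq_addr.
  - exact: bracket_ge1.
apply: le_trans (IH y) _; apply: ler_wpM2l => //.
by rewrite ler_peMl ?bracket_ge1 // (le_trans ler01) ?bracket_ge1.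
Qed.

(** |[osc_inv j]|^2 = (1 + y_j^2)^-1, so each power of the dominator costs two powers of every
    [osc_inv j]. *)
Lemma normc_osc_mon_le (e : {ffun 'I_N -> nat}) K y :
  (forall j, 2 * K <= e j)%N -> normc (osc_mon e y) <= dominator y ^+ K.
Proof.
move=> eK; rewrite /osc_mon normc_prod /dominator -prodrXl.
apply: ler_prod => j _; rewrite normc_ge0 normcX /=.
rewrite -normc_osc_inv_sqr -exprM.
by rewrite ler_wiXn2l ?normc_ge0 ?normc_osc_inv_le1.
Qed.

Lemma normc_osc_mon_le1 (e : {ffun 'I_N -> nat}) y : normc (osc_mon e y) <= 1.
Proof.
rewrite /osc_mon normc_prod -[X in _ <= X](_ : \prod_(i < N) (1 : R) = 1).
  apply: ler_prod => j _; rewrite normc_ge0 normcX /=.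
  by rewrite exprn_ile1 ?normc_ge0 ?normc_osc_inv_le1.
by rewrite big1.
Qed.

End weights.

(** * The spaces B^mu and their seminorms *)

Section superB.
Context {R : realType} {N n : nat} {E : lmodType R[i]}.
Context {p : nat -> E -> R} (hp : seminorms p).
Implicit Types (f g : superfun R N n E) (mu : 'rV[R]_N -> R).

Lemma superB_lin mu (a : R[i]) f g :
  superB p mu f -> superB p mu g -> superB p mu (a *: f + g).
Proof.
move=> [sf bf] [sg bg]; split=> [J|alpha j J].
  exact (smooth_lin hp a (sf J) (sg J)).
have [C [C0 fC]] := bf alpha j J; have [C' [C'0 gC']] := bg alpha j J.
exists (normc a * C + C'); split; first by rewrite ltr_wpDl // mulr_ge0 ?normc_ge0 ?ltW.
move=> y; rewrite DmultiE.
have -> : foldr (pderiv p) ((a *: f + g) J) (multi_seq alpha) y =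
    a *: Dmulti p alpha (f J) y + Dmulti p alpha (g J) y.
  by rewrite !DmultiE -(foldr_pderiv_lin hp).
apply: le_lt_trans (seminormD hp _ _ _) _; rewrite (seminormZ hp) mulrDl.
apply: ler_ltD; last exact: gC'.
by rewrite -mulrA ler_wpM2l ?normc_ge0 // ltW // fC.
Qed.

Lemma superB_sub mu f g :
  superB p mu f -> superB p mu g -> superB p mu (g - f).
Proof. by move=> Bf Bg; rewrite addrC -scaleN1r; exact: superB_lin. Qed.

Lemma superB_le mu mu' f : (forall y, mu y <= mu' y) ->
  superB p mu f -> superB p mu' f.
Proof.
move=> mm [sf bf]; split=> // alpha j J; have [C [C0 fC]] := bf alpha j J.
exists C; split=> // y; apply: lt_le_trans (fC y) _.
by rewrite ler_wpM2l // ltW.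
Qed.

Let Bratio mu ja f y :=
  (mu y)^-1 * \sum_(J : {set 'I_n}) p ja.1 (Dmulti p ja.2 (f J) y).

(** Membership in B^mu bounds the set whose [sup] is taken, so that the real supremum is an upper
    bound. *)
Lemma Bseminorm_ub mu ja f y : (forall y, 0 < mu y) -> superB p mu f ->
  Bratio mu ja f y <= Bseminorm p mu ja f.
Proof.
move=> mu0 [sf bf].
have /choice[C hC] : forall J, exists C, forall y,
    p ja.1 (Dmulti p ja.2 (f J) y) <= C * mu y.
  by move=> J; have [C [_ h]] := bf ja.2 ja.1 J; exists C => z; exact: ltW.
apply: ub_le_sup; last by exists y.
exists (\sum_J C J) => _ [z _ <-]; rewrite mulrC ler_pdivrMr // mulr_suml.
exact: ler_sum.
Qed.

Lemma Bseminorm_le mu ja f (c : R) : (forall y, Bratio mu ja f y <= c) ->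
  Bseminorm p mu ja f <= c.
Proof.
move=> hc; apply: ge_sup; first by exists (Bratio mu ja f 0), 0.
by move=> _ [z _ <-]; exact: hc.
Qed.

Lemma Dmulti_Bseminorm mu j alpha f J y : (forall y, 0 < mu y) ->
  superB p mu f ->
  p j (Dmulti p alpha (f J) y) <= Bseminorm p mu (j, alpha) f * mu y.
Proof.
move=> mu0 Bf; have := Bseminorm_ub (j, alpha) y mu0 Bf.
rewrite /Bratio mulrC ler_pdivrMr //= => /(le_trans _); apply.
by rewrite (bigD1 J) //= lerDl sumr_ge0 // => J' _; exact: (seminorm_ge0 hp).
Qed.

Lemma Bseminorm_ge0 mu ja f : (forall y, 0 < mu y) -> superB p mu f ->
  0 <= Bseminorm p mu ja f.
Proof.
move=> mu0 Bf; apply: le_trans (Bseminorm_ub ja 0 mu0 Bf).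
apply: mulr_ge0; first by rewrite invr_ge0 ltW.
by apply: sumr_ge0 => J _; exact: (seminorm_ge0 hp).
Qed.

Lemma Bseminorm_mono mu mu' ja f : (forall y, 0 < mu y) ->
  (forall y, mu y <= mu' y) -> superB p mu f ->
  Bseminorm p mu' ja f <= Bseminorm p mu ja f.
Proof.
move=> mu0 mm Bf; apply: Bseminorm_le => y.
apply: le_trans (Bseminorm_ub ja y mu0 Bf); apply: ler_wpM2r.
  by rewrite sumr_ge0 // => J _; exact: (seminorm_ge0 hp).
by rewrite lef_pV2 ?posrE // (lt_le_trans (mu0 y)).
Qed.

End superB.

Section functional.
Context {R : realType} {d n : nat} (a0 : R) (a0_neq0 : a0 != 0).
Context {E : lmodType R[i]} {p : nat -> E -> R} (fp : frechet p).
Let hp := frechet_seminorms fp.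
Local Notation N := (d + d)%N.
Implicit Types (f g : superfun R N n E) (mu : 'rV[R]_N -> R).

Definition osc_integrand K f : 'rV[R]_N -> E :=
  fun y => phase a0 y *: osc_op p (osc_terms a0 K) (f [set: 'I_n]%SET) y.

(** A limit of Riemann sums, with default value 0 where they have no limit. Only [K] refers to the
    weight, so one functional serves for several weights. *)
Definition osc_functional K f : E :=
  xget 0 [set v | riemann k (osc_integrand K f) @[k --> \oo]
                    `=>` seminorm_nbhs p v].

Definition osc_bound K mu j f : R := \sum_(t <- osc_terms a0 K)
  normc t.1.1 * Bseminorm p mu (j, [ffun i => count_mem i t.2]) f.

Context (mu : 'rV[R]_N -> R) (C : R) (D : nat).
Hypothesis (mu0 : forall y, 0 < mu y).
Hypothesis (muC : forall y, mu y <= C * bracket y D).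
(** Two powers of [osc_inv] for each of the D+1 powers of the dominator: D against the growth of the
    weight, one for integrability. *)
Let K := (2 * D.+1)%N.

Lemma osc_integrand_bound f j y : superB p mu f ->
  p j (osc_integrand K f y) <= osc_bound K mu j f * C * dominator y.
Proof.
move=> Bf; rewrite (seminormZ hp) normc_phase mul1r.
apply: le_trans (osc_op_seminorm hp _ _ _ _) _.
rewrite -mulrA mulr_suml big_seq [leRHS]big_seq; apply: ler_sum => t tK.
have [te ts] := osc_terms_mem tK.
set ff := f _; have -> : foldr (pderiv p) ff t.2 y =
    Dmulti p [ffun i => count_mem i t.2] ff y by rewrite DmultiE -ts.
rewrite -!mulrA; apply: ler_wpM2l; first exact: normc_ge0.
apply: le_trans (_ : dominator y ^+ D.+1 * (Bseminorm p mu
    (j, [ffun i => count_mem i t.2]) f * mu y) <= _).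
  apply: ler_pM; rewrite ?normc_ge0 ?(seminorm_ge0 hp) ?normc_osc_mon_le //.
  exact: Dmulti_Bseminorm.
rewrite mulrCA; apply: ler_wpM2l; first exact: Bseminorm_ge0.
rewrite -[X in C * X](bracket_dominator y D) mulrCA ler_wpM2l //.
by rewrite exprn_ge0 // ltW // dominator_gt0.
Qed.

Lemma osc_integrand_lin (a : R[i]) f g y :
  superB p mu f -> superB p mu g ->
  osc_integrand K (a *: f + g) y = a *: osc_integrand K f y + osc_integrand K g y.
Proof.
move=> [sf _] [sg _]; rewrite /osc_integrand.
have -> : osc_op p (osc_terms a0 K) ((a *: f + g) [set: 'I_n]%SET) y =
  a *: osc_op p (osc_terms a0 K) (f [set: 'I_n]%SET) y +
  osc_op p (osc_terms a0 K) (g [set: 'I_n]%SET) y by rewrite -(osc_op_lin hp).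
by rewrite scalerDr !scalerA mulrC.
Qed.

Lemma seminorm_continuous_integrand f : superB p mu f ->
  seminorm_continuous p (osc_integrand K f).
Proof.
move=> [sf _]; apply: (seminorm_continuousM hp).
  exact: seminorm_continuous_phase.
exact/smooth_continuous/(smooth_osc_op hp).
Qed.

Lemma dominated_integrand f : superB p mu f -> dominated p (osc_integrand K f).
Proof.
move=> Bf j; exists (osc_bound K mu j f * C) => y.
exact: osc_integrand_bound.
Qed.

Lemma osc_functionalP f : superB p mu f ->
  riemann k (osc_integrand K f) @[k --> \oo]
    `=>` seminorm_nbhs p (osc_functional K f).
Proof.
move=> Bf; have [v _ rv] := riemann_integral fp
  (seminorm_continuous_integrand Bf) (dominated_integrand Bf).
exact: (@xgetPex _ 0 [set v | riemann k (osc_integrand K f) @[k --> \oo]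
                    `=>` seminorm_nbhs p v] (ex_intro _ v rv)).
Qed.

Lemma osc_functional_integral f : superB p mu f ->
  is_lebesgue_integral p (osc_integrand K f) (osc_functional K f).
Proof.
move=> Bf; have [v iv rv] := riemann_integral fp
  (seminorm_continuous_integrand Bf) (dominated_integrand Bf).
by rewrite (cvg_seminorm_unique hp (osc_functionalP Bf) rv).
Qed.

Lemma osc_functional_lin : linear_on (superB p mu) (osc_functional K).
Proof.
move=> a f g Bf Bg.
apply: (cvg_seminorm_unique hp (osc_functionalP (superB_lin hp a Bf Bg))).
apply: (cvg_seminorm_near hp _ (cvg_seminormD hp
  (cvg_seminormZr hp a (osc_functionalP Bf)) (osc_functionalP Bg))).
apply: filterE => k; rewrite -riemann_lin; congr (riemann k _).
by apply/funext => y; exact: osc_integrand_lin.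
Qed.

Lemma osc_functional_bound f j : superB p mu f ->
  p j (osc_functional K f) <= osc_bound K mu j f * C *
    fine (\int[sfs_mu (lebesgue_space R N)]_t (dominator (rV_of t))%:E)%E.
Proof.
move=> Bf; apply: (lebesgue_integral_bound fp (osc_functional_integral Bf)).
by move=> y; exact: osc_integrand_bound.
Qed.

End functional.

Arguments osc_integrand {R d n} a0 {E} p K f y.
Arguments osc_functional {R d n} a0 {E} p K f.
Arguments osc_bound {R d n} a0 {E} p K mu j f.

(** * Compactly supported functions *)

Section compact_support.
Context {R : realType} {N : nat} {E : lmodType R[i]}.
Context {p : nat -> E -> R} (hp : seminorms p).
Implicit Types (y : 'rV[R]_N) (l : 'I_N).

Lemma coord_norm_le y l : `|y 0 l| <= `|y|.
Proof.
rewrite [leRHS]mx_normrE.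
exact: (le_bigmax _ (fun ij : 'I_1 * 'I_N => `|y ij.1 ij.2|) (0, l)).
Qed.

Lemma compact_support (g : 'rV[R]_N -> E) : smooth p g ->
  compact (closure [set y | g y != 0]) ->
  (exists2 r : R, 0 <= r &
     forall s y l, r < `|y 0 l| -> foldr (pderiv p) g s y = 0) /\
  (forall s j, exists B, forall y, p j (foldr (pderiv p) g s y) <= B).
Proof.
set K := closure _ => sg cK.
have zero s y : ~ K y -> foldr (pderiv p) g s y = 0.
  have oK : open (~` K) by exact/closed_openC/closed_closure.
  apply: (foldr_pderiv_near0 hp s oK).
  by move=> z Kz; apply/eqP; apply: contrapT => /negP gz; apply/Kz/subset_closure.
split.
  have [M [_ hM]] := compact_bounded cK.
  (* Every number above [M] is a bound; |M| + 1 is one that is also nonnegative. *)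
  have r0 : 0 <= `|M| + 1 by rewrite addr_ge0.
  exists (`|M| + 1) => // s y l ry; apply: zero => Ky.
  have : `|y| <= `|M| + 1.
    by apply: hM => //; rewrite (le_lt_trans (ler_norm M)) // ltrDl.
  by move=> /(le_trans (coord_norm_le y l)); rewrite leNgt ry.
move=> s j; pose h y := p j (foldr (pderiv p) g s y).
have ch : continuous h.
  move=> y; have := smooth_continuous (smooth_foldr s sg) (y := y).
  exact (@cvg_seminorm_comp _ _ _ hp _ _ (nbhs_filter y) _ _ j).
have [M [_ hM]] : bounded_set (h @` K).
  apply: compact_bounded; apply: continuous_compact => //.
  exact: continuous_subspaceT.
exists (`|M| + 1) => y; have [Ky|/(zero s) ->] := pselect (K y).
  have := hM (`|M| + 1); rewrite (le_lt_trans (ler_norm M)) ?ltrDl // => /(_ isT).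
  move=> /(_ (h y)); rewrite /= => /(_ (ex_intro2 _ _ y Ky erefl)).
  exact/le_trans/ler_norm.
by rewrite (seminorm0 hp) addr_ge0.
Qed.

End compact_support.

(** * Extension and continuity *)

Section extension.
Context {R : realType} {d n : nat} (a0 : R) (a0_neq0 : a0 != 0).
Context {E : lmodType R[i]} {p : nat -> E -> R} (fp : frechet p).
Let hp := frechet_seminorms fp.
Local Notation N := (d + d)%N.

Implicit Types (y : 'rV[R]_N) (k : 'I_N).

Section integration_by_parts.
Context (g : 'rV[R]_N -> E) (r : R) (sg : smooth p g) (r0 : 0 <= r).
Hypothesis (g0 : forall s y k, r < `|y 0 k| -> foldr (pderiv p) g s y = 0).
Hypothesis (bg : forall s j, exists B, forall y, p j (foldr (pderiv p) g s y) <= B).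

Let F (l : seq (@osc_term R d)) y : E := phase a0 y *: osc_op p l g y.

Lemma osc_op_out l y k : r < `|y 0 k| -> osc_op p l g y = 0.
Proof.
by move=> ry; rewrite /osc_op big1 // => t _; rewrite (g0 _ ry) scaler0.
Qed.

Lemma phase_osc_op_bound l j : exists B, forall y, p j (F l y) <= B.
Proof.
have /choice[B hB] : forall s, exists B, forall y,
    p j (foldr (pderiv p) g s y) <= B by move=> s; exact: bg.
exists (\sum_(t <- l) normc t.1.1 * B t.2) => y.
rewrite (seminormZ hp) normc_phase mul1r.
apply: le_trans (osc_op_seminorm hp _ _ _ _) _; apply: ler_sum => t _.
rewrite -mulrA; apply: ler_wpM2l; first exact: normc_ge0.
rewrite -[leRHS]mul1r; apply: ler_pM; rewrite ?normc_ge0 ?(seminorm_ge0 hp) //.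
exact: normc_osc_mon_le1.
Qed.

Lemma phase_osc_op_continuous l : seminorm_continuous p (F l).
Proof.
apply: (seminorm_continuousM hp); first exact: seminorm_continuous_phase.
exact/smooth_continuous/(smooth_osc_op hp).
Qed.

Lemma phase_osc_op_dominated l : dominated p (F l).
Proof.
move=> j; have [B hB] := phase_osc_op_bound l j.
exists (B * (1 + r ^+ 2) ^+ N) => y.
apply: (dominated_bounded_support fp) => // k rk.
by rewrite /F (osc_op_out _ rk) scaler0.
Qed.

(** The two integrands differ by [b] times the derivative of a function of bounded support, whose
    Riemann sums tend to 0. The implication goes from the transformed integrand to the original one,
    since the operators are to be removed one by one. *)
Lemma riemann_osc_step i l v :
  riemann m (F (osc_step a0 i l)) @[m --> \oo] `=>` seminorm_nbhs p v ->
  riemann m (F l) @[m --> \oo] `=>` seminorm_nbhs p v.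
Proof.
move=> hv; pose b : R[i] := (2 * a0)%:C^-1.
have b0 : b != 0 by rewrite invr_eq0 eq_complex /= eqxx andbT mulf_neq0 // pnatr_eq0.
pose h' y := b^-1 *: (F l y - F (osc_step a0 i l) y).
have h'E : h' = fun y => b^-1 *: F l y + (- b^-1) *: F (osc_step a0 i l) y.
  by apply/funext => y; rewrite /h' scalerBr scaleNr.
have ch' : seminorm_continuous p h'.
  rewrite h'E; apply: (seminorm_continuousD hp);
    apply: (seminorm_continuousZ hp); exact: phase_osc_op_continuous.
have bh' j : exists B, forall y, p j (h' y) <= B.
  have [B hB] := phase_osc_op_bound l j.
  have [B' hB'] := phase_osc_op_bound (osc_step a0 i l) j.
  exists (normc b^-1 * (B + B')) => y; rewrite (seminormZ hp).
  apply: ler_wpM2l; first exact: normc_ge0.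
  by apply: le_trans (seminormB hp _ _ _) _; exact: lerD.
have out y k : r < `|y 0 k| -> h' y = 0.
  by move=> ry; rewrite /h' /F !(osc_op_out _ ry) !scaler0 subrr scaler0.
have ih' : is_lebesgue_integral p h' 0.
  apply: (integral_pderiv fp r0 (g := fun z =>
    (phase a0 z * osc_inv (conj_index i) z) *: osc_op p l g z) (i := i)) => //.
    by move=> y; exact (@is_pderiv_osc_op _ _ _ a0_neq0 _ _ hp i l _ y sg).
  by move=> y k ry; rewrite (osc_op_out _ ry) scaler0.
have dh' : dominated p h'.
  move=> j; have [B hB] := bh' j; exists (B * (1 + r ^+ 2) ^+ N) => y.
  by apply: (dominated_bounded_support fp) => // k; exact: out.
have rh' := riemann_cvg fp ch' dh' ih'.
apply: (cvg_seminorm_eq hp _ _ (cvg_seminormD hp (cvg_seminormZr hp b rh') hv)).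
  apply: filterE => m; rewrite -riemann_lin; congr (riemann m _).
  by apply/funext => y; rewrite /h' scalerA divff // scale1r subrK.
by rewrite scaler0 add0r.
Qed.

Lemma riemann_osc_terms K v :
  riemann m (F (osc_terms a0 K)) @[m --> \oo] `=>` seminorm_nbhs p v ->
  riemann m (fun y => phase a0 y *: g y) @[m --> \oo] `=>` seminorm_nbhs p v.
Proof.
(* The single term with coefficient 1 and no derivation is the identity operator, from which
   [osc_terms] is built up. *)
have -> : (fun y => phase a0 y *: g y) = F [:: (1, [ffun=> 0%N], [::])].
  apply/funext => y; rewrite /F /osc_op big_seq1 /= mul1r /osc_mon.
  by rewrite big1 ?scale1r // => j _; rewrite ffunE expr0.
rewrite /osc_terms; elim: (enum 'I_N) => [//|i s IH] /= h; apply: IH.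
move: (foldr _ _ s) h => l0 h.
elim: K h => [//|K IH] /= h; exact (IH (@riemann_osc_step _ _ _ h)).
Qed.

Lemma is_lebesgue_integral_osc K v :
  riemann m (F (osc_terms a0 K)) @[m --> \oo] `=>` seminorm_nbhs p v ->
  is_lebesgue_integral p (fun y => phase a0 y *: g y) v.
Proof.
move=> /riemann_osc_terms hv.
pose l0 : seq (@osc_term R d) := [:: (1, [ffun=> 0%N], [::])].
have gE : (fun y => phase a0 y *: g y) = F l0.
  apply/funext => y; rewrite /F /osc_op big_seq1 /= mul1r /osc_mon.
  by rewrite big1 ?scale1r // => j _; rewrite ffunE expr0.
rewrite gE in hv *.
have [w iw rw] := riemann_integral fp (phase_osc_op_continuous (l := l0))
  (phase_osc_op_dominated l0).
by rewrite (cvg_seminorm_unique hp hv rw).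
Qed.

End integration_by_parts.

Implicit Types f : superfun R N n E.

Lemma osc_functional_superD K f : superD p f ->
  is_osc_integral a0 p f (osc_functional a0 p K f).
Proof.
move=> /(_ [set: 'I_n]%SET)[sf cf].
have [[r r0 g0] bg] := compact_support hp sf cf.
apply: (is_lebesgue_integral_osc sf r0 g0 bg (K := K)).
have [v _ rv] := riemann_integral fp
  (phase_osc_op_continuous sf (l := osc_terms a0 K))
  (phase_osc_op_dominated g0 bg (osc_terms a0 K)).
exact: (@xgetPex _ 0 [set v | riemann m (osc_integrand a0 p K f) @[m --> \oo]
                    `=>` seminorm_nbhs p v] (ex_intro _ v rv)).
Qed.

(** The functional acts on B^mu while [K] is fitted to the larger weight [mu']. The existence claim
    is the case mu' = mu. *)
Context (mu mu' : 'rV[R]_N -> R) (C : R) (D : nat).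
Hypotheses (mu0 : forall y, 0 < mu y) (C0 : 0 <= C).
Hypothesis (mu_mu' : forall y, mu y <= mu' y).
Hypothesis (mu'C : forall y, mu' y <= C * bracket y D).
Let K := (2 * D.+1)%N.

Let mu'0 y : 0 < mu' y. Proof. exact: lt_le_trans (mu0 y) (mu_mu' y). Qed.

Lemma osc_functional_extension :
  is_extension a0 p mu (osc_functional a0 p K (n := n)).
Proof.
split=> [a f g Bf Bg|f]; last exact: osc_functional_superD.
exact (osc_functional_lin a0 fp mu'0 mu'C a (superB_le mu_mu' Bf)
  (superB_le mu_mu' Bg)).
Qed.

(** The estimate is in the seminorms of [mu']. The weight [nu] covers both topologies: it is
    instantiated with [mu'] itself and, through [Bseminorm_mono], with [mu]. *)
Lemma osc_functional_continuous (nu : 'rV[R]_N -> R) :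
  (forall ja f, superB p mu f -> Bseminorm p mu' ja f <= Bseminorm p nu ja f) ->
  Bcontinuous p mu nu (osc_functional a0 p K (n := n)).
Proof.
move=> munu f Bf A [s [e [e0 As]]].
pose H := fine (\int[sfs_mu (lebesgue_space R N)]_t (dominator (rV_of t))%:E)%E.
have H0 : 0 <= H.
  by rewrite fine_ge0 // integral_ge0 // => t _; rewrite lee_fin ltW // dominator_gt0.
pose al (t : @osc_term R d) : {ffun 'I_N -> nat} := [ffun i => count_mem i t.2].
pose S := \sum_(t <- @osc_terms R d a0 K) normc t.1.1.
have S0 : 0 <= S by apply: sumr_ge0 => t _; exact: normc_ge0.
(* The 1 keeps the divisor positive and the final inequality strict even when S C H = 0. *)
have M0 : 0 < S * C * H + 1 by rewrite ltr_wpDl // !mulr_ge0.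
pose e' := e / (S * C * H + 1).
have e'0 : 0 < e' by rewrite divr_gt0.
(* The finitely many seminorms that [osc_bound] involves for the given [j]. *)
exists [seq (j, al t) | j <- s, t <- osc_terms a0 K], e'; split => // g gf Bg.
apply: As => j js.
have Bgf := superB_sub hp Bf Bg; have Bgf' := superB_le mu_mu' Bgf.
have -> : osc_functional a0 p K g - osc_functional a0 p K f =
    osc_functional a0 p K (g - f).
  have <- : -1 *: f + g = g - f by rewrite scaleN1r addrC.
  rewrite (osc_functional_lin a0 fp mu'0 mu'C (-1) (superB_le mu_mu' Bf)
    (superB_le mu_mu' Bg)).
  by rewrite scaleN1r addrC.
apply: le_lt_trans (osc_functional_bound a0 fp mu'0 mu'C j Bgf') _.
apply: le_lt_trans (_ : S * e' * C * H < _).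
  rewrite -/H !ler_wpM2r // /S mulr_suml /osc_bound big_seq [leRHS]big_seq.
  apply: ler_sum => t tK; apply: ler_wpM2l; first exact: normc_ge0.
  apply: le_trans (munu _ _ Bgf) _; apply/ltW/gf.
  by apply/allpairsP; exists (j, t).
rewrite (_ : S * e' * C * H = e * (S * C * H / (S * C * H + 1))).
  rewrite -[ltRHS]mulr1 ltr_pM2l // ltr_pdivrMr // mul1r; lra.
by rewrite /e'; ring.
Qed.

End extension.

(** * Cutoff functions *)

Section bump.
Context {R : realType}.

(* The linear span of the flat k is stable under derivation, and t^-k e^(-1/t) is
   bounded, so these functions and all their derivatives are bounded. *)
Definition flat k (t : R) : R := if 0 < t then t^-1 ^+ k * expR (- t^-1) else 0.

Lemma flat_ge0 k t : 0 <= flat k t.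
Proof.
rewrite /flat; case: ifP => // t0.
by rewrite mulr_ge0 ?expR_ge0 // exprn_ge0 // invr_ge0 ltW.
Qed.

(** From x^k / k! <= e^x with x = 1/t; the constant is not sharp. *)
Lemma flat_le k t : flat k t <= k.+1`!%:R.
Proof.
rewrite /flat; case: ifP => // t0.
have s0 : 0 <= t^-1 by rewrite invr_ge0 ltW.
rewrite expRN ler_pdivrMr ?expR_gt0 //.
have fk : (1 : R) <= k.+1`!%:R by rewrite ler1n fact_gt0.
case: k => [|k] in fk *.
  by rewrite expr0 mul1r -expR0 ler_expR.
apply: le_trans (_ : k.+1`!%:R * expR t^-1 <= _).
  have := expR_ge1Dxn k s0; rewrite -ler_pdivrMl ?ltr0n ?fact_gt0 // mulrC.
  by apply: le_trans; rewrite lerDr.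
by rewrite ler_wpM2r ?expR_ge0 // ler_nat leq_pmull.
Qed.

(** For t > 0, [flat k t] is t times [flat k.+1 t], and the second factor is bounded. *)
Lemma flat_le_linear k t : `|flat k t| <= k.+2`!%:R * `|t|.
Proof.
rewrite ger0_norm ?flat_ge0 //; have := flat_le k.+1 t; rewrite /flat.
case: ifP => t0; last by rewrite mulr_ge0.
rewrite (gtr0_norm t0) -ler_pdivrMr // => /(le_trans _); apply.
by rewrite exprS mulrC mulrA.
Qed.

Lemma is_derive_flat k (t : R) :
  is_derive t 1 (flat k) (flat k.+2 t - k%:R * flat k.+1 t).
Proof.
have [t0|t0|->] := ltgtP t 0.
- have -> : flat k.+2 t - k%:R * flat k.+1 t = 0.
    by rewrite /flat ltNge ltW //= mulr0 subr0.
  apply: (near_eq_is_derive (f := cst (0 : R))).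
  near=> s; rewrite /flat ifF //; apply/negbTE; rewrite -leNgt ltW //.
  by near: s; exact: lt_nbhsl.
(* For t > 0 the function is differentiated through the substitution s = 1/t. *)
- pose h (s : R) := s ^+ k * expR (- s).
  apply: (near_eq_is_derive (f := h \o (fun s => s^-1))).
    near=> s; rewrite /flat ifT //.
    by near: s; exact: lt_nbhsr.
  have dV : is_derive t 1 (fun s : R => s^-1) (- t ^- 2 *: (1 : R)).
    by apply: (@is_deriveV _ id); rewrite ?gt_eqF.
  have dE : is_derive t^-1 1 (expR \o -%R) (expR (- t^-1) * -1).
    by apply: is_derive1_comp.
  have dX : is_derive t^-1 1 ((id : R -> R) ^+ k) ((k%:R * t^-1 ^+ k.-1) *: (1 : R)).
    by apply: is_deriveX.
  have dh := is_deriveM dX dE.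
  have dh' : is_derive t^-1 1 h (k%:R * t^-1 ^+ k.-1 * expR (- t^-1) -
      t^-1 ^+ k * expR (- t^-1)).
    have -> : h = (id ^+ k) * (expR \o -%R).
      by apply/funext => s; rewrite exprfctE.
    apply: (is_derive_eq dh); rewrite exprfctE /= /GRing.scale /= mulr1.
    ring.
  apply: (is_derive_eq (is_derive1_comp dh' dV)).
  rewrite /flat t0 /GRing.scale /= mulr1 -exprVn.
  set e := expR _; set s := t^-1.
  by case: (k) => [|k'] /=; rewrite ?mulr0n ?exprS ?expr0; ring.
rewrite /flat ltxx mulr0 subr0.
(* At 0 the difference quotient is [flat k.+1 h] for h > 0 and 0 for h < 0, hence bounded by a
   multiple of |h|. *)
have cv : h^-1 *: ((flat k \o shift (0 : R)) (h *: (1 : R)) - flat k 0)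
    @[h --> 0^'] --> (0 : R).
  apply: (@cvg_to_0_linear _ _ k.+3`!%:R 1) => // h /andP[h0 _].
  rewrite /= addr0 [h *: 1]mulr1 [_ *: _]mulrC.
  have -> : flat k 0 = 0 by rewrite /flat ltxx.
  rewrite subr0 normrM.
  apply: le_trans (flat_le_linear k.+1 h).
  rewrite /flat; case: ifP => hh; last by rewrite normr0 mul0r.
  by rewrite -normrM exprS mulrC mulrA.
by split; [apply/cvg_ex; exists 0|apply/cvg_lim].
Unshelve. all: by end_near. Qed.

End bump.

Section smooth_bounded.
Context {R : realType} {N : nat}.
Implicit Types (i j : 'I_N) (y : 'rV[R]_N) (c : 'rV[R]_N -> R[i]).
Let hC := @absC_seminorms R.

Definition smooth_bounded c := smooth absC c /\
  forall s, exists B, forall y, normc (foldr (pderiv absC) c s y) <= B.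

Lemma foldr_pderiv_cst (a : R[i]) i s y :
  foldr (pderiv absC) (fun _ : 'rV[R]_N => a) (i :: s) y = 0.
Proof.
elim: s i y => [|k s IH] i y /=; first exact (pderivE hC (is_pderiv_cst hC i a y)).
have -> : pderiv absC k (foldr (pderiv absC) (fun=> a) s) = fun=> 0.
  by apply/funext => z; exact: IH.
exact (pderivE hC (is_pderiv_cst hC i 0 y)).
Qed.

Lemma smooth_bounded_cst (a : R[i]) : smooth_bounded (fun=> a).
Proof.
split; first exact: smooth_cst.
case=> [|i s]; first by exists (normc a).
by exists 0 => y; rewrite foldr_pderiv_cst Normc.normc0.
Qed.

Lemma smooth_boundedM c c' : smooth_bounded c -> smooth_bounded c' ->
  smooth_bounded (fun y => c y * c' y).
Proof.
move=> [sc bc] [sc' bc']; split=> [|s]; first exact: smooth_mulr.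
have [B hB] := choice bc; have [B' hB'] := choice bc'.
exists (\sum_(a <- splits s) B a.1 * B' a.2) => y.
rewrite (foldr_pderivM hC s y sc sc').
apply: le_trans (seminorm_sum hC _ _ _ 0) _; apply: ler_sum => a _.
by rewrite /absC Normc.normcM; apply: ler_pM; rewrite ?normc_ge0.
Qed.

Lemma smooth_bounded_prod (T : Type) (r : seq T) (F : T -> 'rV[R]_N -> R[i]) :
  (forall k, smooth_bounded (F k)) ->
  smooth_bounded (fun y => \prod_(k <- r) F k y).
Proof.
move=> bF; elim: r => [|k r IH].
  rewrite (_ : (fun y => _) = fun=> 1); first exact: smooth_bounded_cst.
  by apply/funext => y; rewrite big_nil.
rewrite (_ : (fun y => _) = fun y => F k y * \prod_(j <- r) F j y).
  exact: smooth_boundedM.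
by apply/funext => y; rewrite big_cons.
Qed.

Definition flat_coord k (e : R) j y : R[i] := (flat k (1 + e * y 0 j))%:C.

(** Stable under derivation and made of bounded functions, so that smoothness and the boundedness of
    all derivatives are both read off from it. *)
Inductive flat_span (e : R) j : ('rV[R]_N -> R[i]) -> Prop :=
| flat_span_base (a : R[i]) k : flat_span e j (fun y => a *: flat_coord k e j y)
| flat_span_add c c' : flat_span e j c -> flat_span e j c' ->
    flat_span e j (fun y => c y + c' y).

Lemma is_pderiv_flat_coord k e i j y : is_pderiv absC i (flat_coord k e j) y
  ((e *+ (j == i))%:C *: flat_coord k.+2 e j y +
   (- (e *+ (j == i) * k%:R)%:C) *: flat_coord k.+1 e j y).
Proof.
pose x := 1 + e * y 0 j; pose c := e *+ (j == i).
have df : is_derive (0 : R) 1 (fun h => flat k (1 + e * (y + h *: delta_mx 0 i) 0 j))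
    ((flat k.+2 x - k%:R * flat k.+1 x) * c).
  rewrite (_ : (fun h => _) = flat k \o (fun h => x + h * c)).
    apply: is_derive1_comp; last exact: is_derive_affine.
    by rewrite mul0r addr0; exact: is_derive_flat.
  apply/funext => h /=; rewrite line_coord /x /c; congr (flat k _).
  by rewrite -mulr_natr -[e *+ _]mulr_natr; ring.
rewrite (_ : _ + _ = ((flat k.+2 x - k%:R * flat k.+1 x) * c) +i* 0).
  have d0 : is_derive (0 : R) 1 (fun _ : R => 0 : R) 0 by exact: is_derive_cst.
  exact (is_pderiv_complex (g := fun=> 0) df d0).
rewrite /flat_coord -/x -/c /GRing.scale /=.
by apply/eqP; rewrite eq_complex /=; apply/andP; split; apply/eqP; ring.
Qed.

Arguments is_pderiv_flat_coord k e i j y _ _ : clear implicits.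

Lemma flat_span_coind e j c : flat_span e j c ->
  seminorm_continuous absC c /\ forall i, exists2 c', flat_span e j c' &
    forall y, is_pderiv absC i c y (c' y).
Proof.
elim=> [a k|f g _ [cf df] _ [cg dg]]; split.
- apply: (seminorm_continuousZ hC); apply: seminorm_continuous_real => y.
  apply: (@continuous_comp _ _ _ (fun z : 'rV[R]_N => 1 + e * z 0 j) (flat k)).
    apply: (@continuousD R); first exact: cst_continuous.
    by apply: (@continuousM R); [exact: cst_continuous|exact: coord_continuous].
  have [dfl _] := is_derive_flat k (1 + e * y 0 j).
  exact/differentiable_continuous/derivable1_diffP.
- move=> i; exists (fun y => (a * (e *+ (j == i))%:C) *: flat_coord k.+2 e j y +
     (a * - (e *+ (j == i) * k%:R)%:C) *: flat_coord k.+1 e j y).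
    exact (flat_span_add (flat_span_base _ _ _ _) (flat_span_base _ _ _ _)).
  move=> y; rewrite -!scalerA -scalerDr.
  exact (is_pderivZ hC a (is_pderiv_flat_coord k e i j y)).
- exact: (seminorm_continuousD hC).
- move=> i; have [f' Sf' ff'] := df i; have [g' Sg' gg'] := dg i.
  exists (fun y => f' y + g' y); first exact: flat_span_add.
  by move=> y; exact (is_pderivD hC (ff' y) (gg' y)).
Qed.

Lemma smooth_bounded_flat k e j : smooth_bounded (flat_coord k e j).
Proof.
have S0 : flat_span e j (flat_coord k e j).
  rewrite (_ : flat_coord k e j = fun y => 1 *: flat_coord k e j y).
    exact: flat_span_base.
  by apply/funext => y; rewrite scale1r.
split; first exact: (smooth_coind hC (S := flat_span e j) (@flat_span_coind e j)).
move=> s; have : flat_span e j (foldr (pderiv absC) (flat_coord k e j) s).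
  elim: s => [//|i s /flat_span_coind[_ /(_ i)[g' Sg' gg']]] /=.
  rewrite [X in flat_span _ _ X](_ : _ = g') //.
  by apply/funext => y; apply: (pderivE hC).
elim=> [a m|f g _ [B hB] _ [B' hB']].
  exists (normc a * m.+1`!%:R) => y; rewrite Normc.normcM normc_real.
  by rewrite ger0_norm ?flat_ge0 // ler_wpM2l ?normc_ge0 ?flat_le.
exists (B + B') => y; apply: le_trans (le_normcD _ _) _; exact: lerD.
Qed.

(** In each variable this is the classical bump exp (2 - 2 / (1 - y_j^2)) on (-1, 1), extended by 0.
    The signs 1 and -1 cut off at the two ends, and the factors [expR 1] normalize the value at
    0. *)
Definition cutoff y : R[i] := \prod_(j < N)
  ((expR 1)%:C * flat_coord 0 1 j y * ((expR 1)%:C * flat_coord 0 (-1) j y)).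

Lemma smooth_bounded_cutoff : smooth_bounded cutoff.
Proof.
have h := @smooth_bounded_prod _ (enum 'I_N) (fun j y =>
  (expR 1)%:C * flat_coord 0 1 j y * ((expR 1)%:C * flat_coord 0 (-1) j y)).
rewrite (_ : cutoff = fun y => \prod_(j <- enum 'I_N)
    ((expR 1)%:C * flat_coord 0 1 j y * ((expR 1)%:C * flat_coord 0 (-1) j y))).
  apply: h => j; apply: smooth_boundedM; apply: smooth_boundedM;
    by [exact: smooth_bounded_cst | exact: smooth_bounded_flat].
by apply/funext => y; rewrite /cutoff big_enum.
Qed.

Lemma cutoff0 : cutoff 0 = 1.
Proof.
rewrite /cutoff big1 // => j _; rewrite /flat_coord mxE !mulr0 addr0.
have -> : (expR 1)%:C * (flat 0 1)%:C = 1 :> R[i].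
  rewrite -rmorphM /= /flat ltr01 expr0 mul1r invr1.
  by rewrite -expRD subrr expR0.
by rewrite mul1r.
Qed.

Lemma cutoff_out y j : 1 <= `|y 0 j| -> cutoff y = 0.
Proof.
move=> yj; rewrite /cutoff (bigD1 j) //= /flat_coord /flat mul1r mulN1r.
move: yj; rewrite ler_normr => /orP[yj|yj].
  by rewrite [X in _ * (_ * X%:C)]ifF ?mulr0 ?mul0r //; apply/negbTE; rewrite -leNgt; lra.
by rewrite ifF ?mulr0 ?mul0r //; apply/negbTE; rewrite -leNgt; lra.
Qed.

End smooth_bounded.

(** * Uniqueness *)

Section dilation.
Context {R : realType} {N : nat}.
Implicit Types (i : 'I_N) (y : 'rV[R]_N) (c : 'rV[R]_N -> R[i]).
Let hC := @absC_seminorms R.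

Lemma smooth_dilate (a : R) c : a != 0 -> smooth absC c ->
  smooth absC (fun y => c (a *: y)).
Proof.
move=> a0 sc; apply: (smooth_coind hC
  (S := [set c' | exists b c, smooth absC c /\ c' = fun y => b *: c (a *: y)])).
  move=> _ [b [{sc}c [sc ->]]]; split.
    apply: (seminorm_continuousZ hC) => y.
    have dil : (fun z : 'rV[R]_N => a *: z) @ y --> a *: y.
      exact: scaler_continuous.
    by move=> A /(smooth_continuous sc) /dil.
  move=> i; exists (fun y => b *: (a%:C *: pderiv absC i c (a *: y))).
    exists (b * a%:C), (pderiv absC i c); split.
      exact (smooth_foldr [:: i] sc).
    by apply/funext => y; rewrite scalerA.
  move=> y; exact (is_pderivZ hC b
    (is_pderiv_dilate hC a0 (smooth_is_pderiv hC i (a *: y) sc))).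
by exists 1, c; split => //; apply/funext => y; rewrite scale1r.
Qed.

Lemma foldr_pderiv_dilate (a : R) c s y : a != 0 -> smooth absC c ->
  foldr (pderiv absC) (fun y => c (a *: y)) s y =
  a%:C ^+ size s * foldr (pderiv absC) c s (a *: y).
Proof.
move=> a0 sc; elim: s y => [|i s IH] y; first by rewrite expr0 mul1r.
rewrite /= (funext IH); apply: (pderivE hC).
rewrite exprSr -mulrA.
exact (is_pderivZ hC (a%:C ^+ size s)
  (is_pderiv_dilate hC a0 (smooth_is_pderiv hC i (a *: y) (smooth_foldr s sc)))).
Qed.

Definition dilated_cutoff k y : R[i] := cutoff (k.+1%:R^-1 *: y).

Lemma smooth_dilated_cutoff k : smooth absC (dilated_cutoff k).
Proof.
apply: smooth_dilate; first by rewrite invr_eq0.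
by have [] := @smooth_bounded_cutoff R N.
Qed.

(** Each derivation brings out a factor 1/(k+1) by the chain rule; [B] does not depend on [k]. *)
Lemma dilated_cutoff_bound s : exists B : R, forall k y,
  normc (foldr (pderiv absC) (dilated_cutoff k) s y) <= k.+1%:R^-1 ^+ size s * B.
Proof.
have [sc /(_ s)[B hB]] := @smooth_bounded_cutoff R N; exists B => k y.
rewrite foldr_pderiv_dilate ?invr_eq0 //.
rewrite Normc.normcM normcX normc_real ger0_norm ?invr_ge0 //.
by apply: ler_wpM2l => //; rewrite exprn_ge0 // invr_ge0.
Qed.

Lemma dilated_cutoff_out k y j : k.+1%:R <= `|y 0 j| -> dilated_cutoff k y = 0.
Proof.
move=> ky; apply: (@cutoff_out _ _ _ j).
rewrite mxE normrM ger0_norm ?invr_ge0 // mulrC ler_pdivlMr // mul1r //.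
Qed.

Lemma foldr_pderiv_cutoff_sub1 k i s y :
  foldr (pderiv absC) (fun y => dilated_cutoff k y - 1) (i :: s) y =
  foldr (pderiv absC) (dilated_cutoff k) (i :: s) y.
Proof.
have -> : (fun y => dilated_cutoff k y - 1) =
   fun y => 1 *: dilated_cutoff k y + (fun=> -1) y.
  by apply/funext => z; rewrite scale1r.
rewrite (foldr_pderiv_lin hC) ?scale1r; last 2 first.
- exact: smooth_dilated_cutoff.
- exact: smooth_cst.
by rewrite foldr_pderiv_cst addr0.
Qed.

End dilation.

Section null.
Context {R : realType} {N : nat} (mu' : 'rV[R]_N -> R).
Hypothesis (mu'0 : forall y, 0 < mu' y).
Implicit Types F G : nat -> 'rV[R]_N -> R.

(** Convergence to 0 in the norm weighted by [mu'], stated pointwise so that sums and multiples are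
    handled without suprema. *)
Definition uniformly_null F := forall e : R, 0 < e ->
  \forall k \near \oo, forall y, F k y <= e * mu' y.

Lemma uniformly_null_le F G : (forall k y, F k y <= G k y) ->
  uniformly_null G -> uniformly_null F.
Proof.
move=> FG G0 e e0; apply: filterS (G0 e e0) => k h y.
exact: le_trans (FG k y) (h y).
Qed.

Lemma uniformly_nullZ (c : R) F : 0 <= c -> uniformly_null F ->
  uniformly_null (fun k y => c * F k y).
Proof.
move=> c0 F0 e e0; have c1 : 0 < c + 1 by rewrite ltr_wpDl.
have := F0 (e / (c + 1)); rewrite divr_gt0 // => /(_ isT).
apply: filterS => k h y; apply: le_trans (ler_wpM2l c0 (h y)) _.
rewrite mulrA ler_wpM2r ?(ltW (mu'0 y)) // mulrCA ger_pMr //.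
by rewrite ler_pdivrMr // mul1r lerDl.
Qed.

Lemma uniformly_null_sum (I : eqType) (r : seq I) (F : I -> nat -> 'rV[R]_N -> R) :
  (forall a, a \in r -> uniformly_null (F a)) ->
  uniformly_null (fun k y => \sum_(a <- r) F a k y).
Proof.
elim: r => [|a r IH] Fr e e0.
  by apply: filterE => k y; rewrite big_nil mulr_ge0 ?ltW.
have e2 : 0 < e / 2 by rewrite divr_gt0.
have h1 := Fr a (mem_head _ _) _ e2.
have h2 : uniformly_null (fun k y => \sum_(a <- r) F a k y).
  by apply: IH => b br; apply: Fr; rewrite inE br orbT.
apply: filterS2 h1 (h2 _ e2) => k h3 h4 y; rewrite big_cons [e]splitr mulrDl.
exact: lerD.
Qed.

(** If [s] is nonempty, the derivatives decay like 1/(k+1) and mu <= mu' suffices. If it is empty,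
    the cutoff minus 1 does not tend to 0 uniformly: outside a large ball the smallness comes from
    mu/mu', inside it from the continuity of the cutoff at 0. *)
Lemma cutoff_sub1_null (mu : 'rV[R]_N -> R) (s : seq 'I_N) :
  (forall y, 0 < mu y) -> (forall y, mu y <= mu' y) ->
  (mu y / mu' y) @[y --> norm_infty] --> (0 : R) ->
  uniformly_null (fun k y => normc
    (foldr (pderiv absC) (fun y => dilated_cutoff k y - 1) s y) * mu y).
Proof.
move=> mu0 mm hlim e e0; have [B hB] := @dilated_cutoff_bound R N s.
case: s hB => [|i s] hB; last first.
  have B0 : 0 <= B.
    have := le_trans (normc_ge0 _) (hB 0%N 0).
    by rewrite pmulr_rge0 // exprn_gt0 // invr_gt0.
  have B1 : 0 < B + 1 by rewrite ltr_wpDl.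
  have /cvgrPdist_lt/(_ (e / (B + 1))) := @cvg_harmonic R.
  rewrite divr_gt0 // => /(_ isT); apply: filterS => k.
  rewrite sub0r normrN ger0_norm ?invr_ge0 // => ke y.
  rewrite foldr_pderiv_cutoff_sub1; apply: ler_pM; rewrite ?normc_ge0 ?(ltW (mu0 _)) //.
  apply: le_trans (hB k y) _.
  apply: le_trans (_ : k.+1%:R^-1 * B <= _).
    rewrite ler_wpM2r //= exprS ger_pMr ?invr_gt0 //.
    by rewrite exprn_ile1 ?invr_ge0 // invf_le1 // ler1n.
  apply: le_trans (_ : e / (B + 1) * B <= _); first by rewrite ler_wpM2r // ltW.
  by rewrite mulrAC ler_pdivrMr // ler_pM2l // lerDl.
have B0 : 0 <= B.
  by have := le_trans (normc_ge0 _) (hB 0%N 0); rewrite expr0 mul1r.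
have B2 : 0 < B + 2 by rewrite ltr_wpDl.
have eB : 0 < e / (B + 2) by rewrite divr_gt0.
(* The cutoff minus 1 has modulus at most B + 1, which the divisor B + 2 exceeds. *)
have [M hM] := hlim _ (nbhsx_ballx 0 (e / (B + 2)) eB).
have [sc _] := @smooth_bounded_cutoff R N.
have := proj1 (cvg_seminormP (FF := nbhs_filter (0 : 'rV[R]_N)) (@absC_seminorms R) _ _)
  (smooth_continuous sc (y := 0)) 0%N.
move=> /cvgrPdist_le/(_ e e0)/nbhs_rowP[d d0 hd].
(* A positive radius beyond [M], whatever its sign; for large [k] the ball scaled by 1/(k+1) lies
   where the cutoff is close to 1. *)
have M1 : 0 < `|M| + 1 by rewrite ltr_wpDl.
have /cvgrPdist_lt/(_ (d / (`|M| + 1))) := @cvg_harmonic R.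
rewrite divr_gt0 // => /(_ isT); apply: filterS => k.
rewrite sub0r normrN ger0_norm ?invr_ge0 // => kd y /=.
have [My|yM] := ltP M `|y|.
  have := hM y My; rewrite /ball /= sub0r normrN ger0_norm; last first.
    by rewrite divr_ge0 ?ltW.
  rewrite ltr_pdivrMr // => muy.
  apply: le_trans (_ : (B + 1) * (e / (B + 2) * mu' y) <= _).
    apply: ler_pM; rewrite ?normc_ge0 ?(ltW (mu0 _)) ?(ltW muy) //.
    apply: le_trans (le_normcD _ _) _; apply: lerD.
      by have := hB k y; rewrite expr0 mul1r.
    by rewrite (normcN (1 : R[i])) Normc.normc1.
  rewrite mulrA ler_wpM2r ?(ltW (mu'0 _)) // mulrCA ger_pMr //.
  by rewrite ler_pdivrMr // mul1r lerD2l ler1n.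
apply: ler_pM; rewrite ?normc_ge0 ?(ltW (mu0 _)) //.
have := hd (k.+1%:R^-1 *: y); rewrite /absC cutoff0 sub0r normrN ger0_norm ?normc_ge0 //.
apply => l; rewrite mxE mxE subr0 normrM ger0_norm ?invr_ge0 //.
apply: le_lt_trans (_ : k.+1%:R^-1 * (`|M| + 1) < _); last by rewrite -ltr_pdivlMr.
rewrite ler_wpM2l ?invr_ge0 //; apply: le_trans (coord_norm_le y l) _.
apply: le_trans yM _; apply: le_trans (ler_norm M) _.
by rewrite lerDl.
Qed.

End null.

(** * Density of compactly supported functions and uniqueness *)

Section density.
Context {R : realType} {N n : nat} {E : lmodType R[i]}.
Context {p : nat -> E -> R} (hp : seminorms p).
Implicit Types (f : superfun R N n E) (y : 'rV[R]_N).

Definition truncated k f : superfun R N n E := body_mul (dilated_cutoff k) f.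

Lemma superD_truncated (mu : 'rV[R]_N -> R) k f : superB p mu f ->
  superD p (truncated k f).
Proof.
move=> [sf _] J; split; first exact (smoothM hp (smooth_dilated_cutoff k) (sf J)).
pose Q := [set v : 'rV[R]_N | forall i, `[- k.+1%:R, k.+1%:R]%classic (v ord0 i)].
have cQ : compact Q.
  apply: (@rV_compact R _ (fun=> `[- k.+1%:R, k.+1%:R]%classic)) => i.
  exact: segment_compact.
apply: (subclosed_compact _ cQ); first exact: (@closed_closure).
have clQ : closed Q by apply: compact_closed => //; exact: norm_hausdorff.
rewrite ((closure_id Q).1 clQ); apply: closure_subset => y /= fy i.
rewrite /= in_itv /= -ler_norml leNgt; apply/negP => ky.
move/eqP: fy; apply; rewrite /truncated /body_mul (@dilated_cutoff_out _ _ _ _ i) ?scale0r //.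
exact: ltW.
Qed.

Lemma foldr_pderiv_multi_le mu f j J alpha s : superB p mu f ->
  subseq s (multi_seq alpha) ->
  exists2 C, 0 <= C & forall y, p j (foldr (pderiv p) (f J) s y) <= C * mu y.
Proof.
move=> [_ bf] /multi_seq_subseq ss.
have [C [C0 hC]] := bf [ffun i => count_mem i s] j J.
by exists C => [|y]; [exact: ltW | rewrite ss -DmultiE ltW].
Qed.

Lemma superB_truncated (mu : 'rV[R]_N -> R) k f : (forall y, 0 < mu y) ->
  superB p mu f -> superB p mu (truncated k f).
Proof.
move=> mu0 Bf; have [sf _] := Bf; split=> [J|alpha j J].
  exact (smoothM hp (smooth_dilated_cutoff k) (sf J)).
suff [C C0 hC] : exists2 C, 0 <= C & forall y,
    p j (Dmulti p alpha (truncated k f J) y) <= C * mu y.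
  exists (C + 1); split; first by rewrite ltr_wpDl.
  by move=> y; rewrite mulrDl mul1r; apply: le_lt_trans (hC y) _; rewrite ltrDl.
rewrite DmultiE.
have hD y := foldr_pderivM hp (multi_seq alpha) y (smooth_dilated_cutoff k) (sf J).
have {hD} : forall y, p j (foldr (pderiv p) (truncated k f J) (multi_seq alpha) y) <=
    \sum_(a <- splits (multi_seq alpha))
      normc (foldr (pderiv absC) (dilated_cutoff k) a.1 y) *
      p j (foldr (pderiv p) (f J) a.2 y).
  move=> y; rewrite hD; apply: le_trans (seminorm_sum hp _ _ _ _) _.
  by apply: ler_sum => a _; rewrite (seminormZ hp).
have : {subset splits (multi_seq alpha) <= splits (multi_seq alpha)} by [].
(* The sum is generalized to a list contained in [splits], so that induction keeps the information
   that each second component is a subsequence. *)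
move: {1 3}(splits _) => r rs hr.
suff [C C0 hC] : exists2 C, 0 <= C & forall y, \sum_(a <- r)
      normc (foldr (pderiv absC) (dilated_cutoff k) a.1 y) *
      p j (foldr (pderiv p) (f J) a.2 y) <= C * mu y.
  by exists C => // y; exact: le_trans (hr y) (hC y).
elim: r rs {hr} => [|a r IH] rs.
  by exists 0 => // y; rewrite big_nil mul0r.
have [|C C0 hC] := IH; first by move=> b br; apply: rs; rewrite inE br orbT.
have [B hB] := @dilated_cutoff_bound R N a.1.
have [C' C'0 hC'] := foldr_pderiv_multi_le j J Bf
  (splits_subseq (rs _ (mem_head _ _))).
exists (k.+1%:R^-1 ^+ size a.1 * B * C' + C) => [|y].
  by rewrite addr_ge0 // mulr_ge0 // (le_trans (normc_ge0 _) (hB k 0)).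
rewrite big_cons mulrDl; apply: lerD; last exact: hC.
rewrite -[leRHS]mulrA.
apply: ler_pM; rewrite ?normc_ge0 ?(seminorm_ge0 hp) //;
  by [exact: hB|exact: hC'].
Qed.

(** The difference is f multiplied by the cutoff minus 1. In each Leibniz term the derivative of f
    is bounded by a multiple of [mu], and [cutoff_sub1_null] handles the other factor times [mu]. *)
Lemma Bseminorm_truncated (mu mu' : 'rV[R]_N -> R) f (e : R) j alpha :
  (forall y, 0 < mu y) -> (forall y, mu y <= mu' y) ->
  (mu y / mu' y) @[y --> norm_infty] --> (0 : R) ->
  superB p mu f -> 0 < e ->
  \forall k \near \oo, Bseminorm p mu' (j, alpha) (truncated k f - f) <= e.
Proof.
move=> mu0 mm hlim Bf e0; have [sf _] := Bf.
have mu'0 y : 0 < mu' y := lt_le_trans (mu0 y) (mm y).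
suff H : uniformly_null mu' (fun k y => \sum_(J <- enum {set 'I_n})
     p j (Dmulti p alpha ((truncated k f - f) J) y)).
  apply: filterS (H e e0) => k hk; apply: Bseminorm_le => y.
  by rewrite mulrC ler_pdivrMr //= -big_enum; exact: hk.
apply: (uniformly_null_sum mu'0) => J _.
apply: (uniformly_null_le (G := fun k y => \sum_(a <- splits (multi_seq alpha))
    normc (foldr (pderiv absC) (fun y => dilated_cutoff k y - 1) a.1 y) *
    p j (foldr (pderiv p) (f J) a.2 y))).
  move=> k y; rewrite DmultiE.
  have -> : (truncated k f - f) J = fun y => (dilated_cutoff k y - 1) *: f J y.
    by apply/funext => z; rewrite scalerBl scale1r.
  have sc : smooth absC (fun y => dilated_cutoff k y - 1).
    apply: (smoothD (@absC_seminorms R)); first exact: smooth_dilated_cutoff.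
    exact: (smooth_cst (@absC_seminorms R)).
  rewrite (foldr_pderivM hp _ _ sc (sf J)).
  apply: le_trans (seminorm_sum hp _ _ _ _) _.
  by apply: ler_sum => a _; rewrite (seminormZ hp).
apply: (uniformly_null_sum mu'0) => a ar.
have [C C0 hC] := foldr_pderiv_multi_le j J Bf (splits_subseq ar).
apply: (uniformly_null_le (G := fun k y => C * (normc
   (foldr (pderiv absC) (fun y => dilated_cutoff k y - 1) a.1 y) * mu y))).
  by move=> k y; rewrite mulrCA ler_wpM2l ?normc_ge0.
by apply: (uniformly_nullZ mu'0 C0); exact: cutoff_sub1_null.
Qed.

Lemma truncated_cvg (mu mu' : 'rV[R]_N -> R) f (L : superfun R N n E -> E) :
  (forall y, 0 < mu y) -> (forall y, mu y <= mu' y) ->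
  (mu y / mu' y) @[y --> norm_infty] --> (0 : R) ->
  superB p mu f -> seminorm_continuous_on (Bseminorm p mu') (superB p mu) p L ->
  L (truncated k f) @[k --> \oo] `=>` seminorm_nbhs p (L f).
Proof.
move=> mu0 mm hlim Bf cL A /(cL f Bf)[s [e [e0 As]]].
(* Only a weak inequality survives the supremum, while the neighbourhood asks for a strict one. *)
have e2 : 0 < e / 2 by rewrite divr_gt0.
have : \forall k \near \oo, forall ja, ja \in s ->
    Bseminorm p mu' ja (truncated k f - f) <= e / 2.
  elim: s {As} => [|[j alpha] s IH]; first exact: filterE.
  apply: filterS2 (Bseminorm_truncated j alpha mu0 mm hlim Bf e2) IH => k h1 h2 ja.
  by rewrite inE => /orP[/eqP ->|/h2].
apply: filterS => k hk; apply: As; last exact: superB_truncated.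
move=> ja jas; apply: le_lt_trans (hk ja jas) _; lra.
Qed.

End density.

(** On truncations both functionals equal the oscillating integral, whose value is unique; the
    truncations converge in the topology for which both are continuous. *)
Lemma extension_unique (R : realType) (d n : nat) (a0 : R) (E : lmodType R[i])
    (p : nat -> E -> R) (fp : frechet p) (mu mu' : 'rV[R]_(d + d) -> R)
    (L L' : superfun R (d + d) n E -> E) f :
  (forall y, 0 < mu y) -> (forall y, mu y <= mu' y) ->
  (mu y / mu' y) @[y --> norm_infty] --> (0 : R) ->
  is_extension a0 p mu L -> Bcontinuous p mu mu' L ->
  is_extension a0 p mu L' -> Bcontinuous p mu mu' L' ->
  superB p mu f -> L' f = L f.
Proof.
move=> mu0 mm hlim [_ extL] cL [_ extL'] cL' Bf.
have hp := frechet_seminorms fp.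
apply: (cvg_seminorm_unique hp (truncated_cvg hp mu0 mm hlim Bf cL')).
apply: (cvg_seminorm_near hp _ (truncated_cvg hp mu0 mm hlim Bf cL)).
apply: filterE => k; have Df := superD_truncated hp k Bf.
exact: (is_integral_unique hp (extL' _ Df) (extL _ Df)).
Qed.

Theorem theorem3p13 (R : realType) (a0 : R) (m n : nat) (E : lmodType R[i])
    (p : nat -> E -> R) (ha0 : a0 != 0) (hm : ~~ odd m) (hE : frechet p)
    (mu : 'rV[R]_(m./2 + m./2) -> R)
    (hmu : weight mu) (hmuP : poly_bounded mu) :
  (exists L : superfun R (m./2 + m./2) n E -> E,
     is_extension a0 p mu L /\ Bcontinuous p mu mu L)
  /\
  (forall mu' : 'rV[R]_(m./2 + m./2) -> R,
     weight mu' -> poly_bounded mu' ->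
     (forall y, mu y < mu' y) ->
     (mu y / mu' y) @[y --> norm_infty] --> (0 : R) ->
     exists L : superfun R (m./2 + m./2) n E -> E,
       [/\ is_extension a0 p mu L,
           Bcontinuous p mu mu L,
           Bcontinuous p mu mu' L
         & forall L' : superfun R (m./2 + m./2) n E -> E,
             is_extension a0 p mu L' -> Bcontinuous p mu mu' L' ->
             forall f, superB p mu f -> L' f = L f]).
Proof.
have [mu0 _] := hmu; have hp := frechet_seminorms hE; split.
  have [C [D [C0 muC]]] := poly_bounded_bracket hmuP.
  exists (osc_functional a0 p (2 * D.+1)); split.
    exact: (osc_functional_extension ha0 hE mu0 _ muC).
  exact: (osc_functional_continuous hE mu0 C0 _ muC).
move=> mu' [mu'0 _] mu'P mumu' hlim.
have mm y : mu y <= mu' y by exact: ltW.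
(* The exponent now comes from [mu'], since continuity in its topology requires the integral to
   converge on B^mu'. *)
have [C [D [C0 muC]]] := poly_bounded_bracket mu'P.
have extL := osc_functional_extension (n := n) ha0 hE mu0 mm muC.
have cL := osc_functional_continuous (n := n) (a0 := a0) hE mu0 C0 mm muC.
exists (osc_functional a0 p (2 * D.+1)); split => //.
- by apply: cL => ja f; exact: Bseminorm_mono.
- exact: cL.
- move=> L' extL' cL' f Bf.
  exact: (extension_unique hE mu0 mm hlim extL (cL _ _) extL' cL' Bf).
Qed.
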